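(* Let $n\ge2$, let $\Omega\subset\mathbb{R}^n$ be a (nonempty) bounded open convex set, and let $F:\mathbb{R}^n\times\mathbb{R}\times\mathbb{R}^n\times S_n\to\mathbb{R}$ be a continuous, proper, degenerate elliptic, rotationally invariant operator. Let $u\in C^2(\Omega)\cap C(\overline\Omega)$ be a classical solution of $$F(x,u,Du,D^2u)=0\ \text{ in }\Omega,\qquad u=0\ \text{ on }\partial\Omega,\qquad u>0\ \text{ in }\Omega,$$ such that $$\liminf_{y\to x,\ y\in\Omega}\frac{\partial u(y)}{\partial\nu}>0$$ for every $x\in\partial\Omega$ and every inward direction $\nu$ of $\Omega$ at $x$. Let $p\in(0,1)$ and assume that for every fixed $\theta\in\mathbb{R}^n$ the set $$\{(x,t,A)\in\mathbb{R}^n\times(0,\infty)\times S_n:\ F(x,t^{1/p},t^{1/p-1}\theta,t^{1/p-3}A)\ge0\}$$ is convex. Let $\Omega^\sharp$ be the ball and $u_p^\sharp\in C(\overline{\Omega^\sharp})$ the function (mean width rearrangement of $u$) defined in the context, and let $v$ be the solution of $$F(x,v,Dv,D^2v)=0\ \text{ in }\Omega^\sharp,\qquad v=0\ \text{ on }\partial\Omega^\sharp,\qquad v>0\ \text{ in }\Omega^\sharp.$$ If $F$ satisfies the comparison principle (CP) in $\Omega^\sharp$, then $$u_p^\sharp\le v\quad\text{in }\Omega^\sharp$$ and $$\|u\|_{L^q(\Omega)}\le\|v\|_{L^q(\Omega^\sharp)}\quad\text{for every }q\in(0,+\infty].$$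
   Context: $S_n$: real symmetric $n\times n$ matrices; $A\le B$ means $B-A$ is nonnegative definite. $F(x,t,\xi,A)$ is proper if it is nonincreasing in $t$, degenerate elliptic if $F(x,t,\xi,A)\le F(x,t,\xi,B)$ whenever $A\le B$, and rotationally invariant if $F(\rho x,t,\rho\xi,\rho A\rho^T)=F(x,t,\xi,A)$ for all $(x,t,\xi,A)$ and all $\rho\in SO(n)$. $\|w\|_{L^q}=(\int|w|^q)^{1/q}$ for $0<q<\infty$. Inward direction: $\nu\in S^{n-1}$ is an inward direction of $\Omega$ at $x\in\partial\Omega$ if $x+s\nu\in\Omega$ for all sufficiently small $s>0$. Viscosity notions: an upper (resp. lower) semicontinuous $w$ is a viscosity subsolution (resp. supersolution) of $F=0$ in $\Omega$ if $F(x,w(x),D\phi(x),D^2\phi(x))\ge0$ (resp. $\le 0$) for every $x\in\Omega$ and every $C^2$ function $\phi$ with $\phi(x)=w(x)$ and $\phi\ge w$ (resp. $\phi\le w$) near $x$; a viscosity solution is a continuous function that is both. A classical supersolution is a $C^2$ function with $F(x,w,Dw,D^2w)\le0$ pointwise. (CP) for $F$ in $\Omega^\sharp$: if $z\in C(\overline{\Omega^\sharp})\cap C^2(\Omega^\sharp)$ is a classical supersolution and $w\in C(\overline{\Omega^\sharp})$ is a viscosity subsolution of $F=0$ in $\Omega^\sharp$ with $z\ge w$ on $\partial\Omega^\sharp$, then $z\ge w$ in $\Omega^\sharp$. The solution $v$ is a classical solution ($C^2(\Omega^\sharp)\cap C(\overline{\Omega^\sharp})$); if it is only a viscosity solution in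 $C(\overline{\Omega^\sharp})$, (CP) is understood with $z\in C(\overline{\Omega^\sharp})$ a viscosity supersolution. Mean width: $w(\Omega)=\frac{2}{n\omega_n}\int_{S^{n-1}}h_\Omega(\xi)\,d\xi$, where $h_\Omega(\xi)=\max_{y\in\overline\Omega}\langle\xi,y\rangle$ and $\omega_n$ is the volume of the unit ball. Definition of $\Omega^\sharp$ and $u_p^\sharp$. Fix a sequence $\{\rho_i\}_{i\ge1}\subset SO(n)$ such that the rotation means $\Omega^\sharp_m=\frac1m(\rho_1\Omega+\dots+\rho_m\Omega)$ (Minkowski sums) converge in the Hausdorff metric, as $m\to\infty$, to a ball $\Omega^\sharp$ of diameter $w(\Omega)$ (such a sequence exists by a theorem of Hadwiger). Let $\Omega_i=\rho_i\Omega$ and $u_i(x)=u(\rho_i^{-1}x)$ for $x\in\overline{\Omega_i}$. For $m\in\mathbb{N}$ and $x\in\overline{\Omega^\sharp_m}$ let $$u^\sharp_{p,m}(x)=\sup\Big\{\Big[\tfrac1m\sum_{i=1}^m u_i(x_i)^p\Big]^{1/p}:\ x_i\in\overline{\Omega_i},\ x=\tfrac1m\sum_{i=1}^m x_i\Big\}.$$ Let $R=\max_{x\in\overline\Omega}|x|$ and $B=B(0,2R)$, and extend $u^\sharp_{p,m}$ by $0$ to $\overline B\setminus\Omega^\sharp_m$. The sequence $(u^\sharp_{p,m})^p$ has a subsequence $(u^\sharp_{p,m_k})^p$ converging uniformly in $\overline B$; one sets $u^\sharp_p(x)=\big(\lim_{k\to\infty}u^\sharp_{p,m_k}(x)^p\big)^{1/p}$,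 which is continuous and vanishes on $\partial\Omega^\sharp$. The statement holds for any such choice of rotations and of subsequence. *)

(* Defs.v *)
From HB Require Import structures.
From mathcomp Require Import all_boot all_order all_algebra.
From mathcomp Require Import all_classical all_reals all_analysis.
From mathcomp Require Import measurable_realfun.
Set Implicit Arguments.
Unset Strict Implicit.
Unset Printing Implicit Defensive.
Import Order.TTheory GRing.Theory Num.Theory.
Import numFieldNormedType.Exports.
Local Open Scope classical_set_scope.
Local Open Scope ring_scope.

(* The library norm on 'cV[R]_n is the sup norm. It gives the Euclidean        *)
(* topology, so open, closure, continuous and bounded_set are the library      *)
(* notions; lengths and balls use enorm.                                       *)
Section Euclidean.
Context {R : realType} {n : nat}.
Implicit Types (x y c : 'cV[R]_n) (A B : set 'cV[R]_n).

Definition dotv x y : R := \sum_(i < n) x i 0 * y i 0.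

Definition enorm x : R := Num.sqrt (dotv x x).

Definition eball c (r : R) : set 'cV[R]_n := [set x | enorm (x - c) < r].

Definition closed_eball c (r : R) : set 'cV[R]_n :=
  [set x | enorm (x - c) <= r].

Definition usphere : set 'cV[R]_n := [set x | enorm x = 1].

Definition boundary A : set 'cV[R]_n := closure A `\` A^°.

Definition dist_to x A : R := inf [set enorm (x - y) | y in A].

(* Meaningful for nonempty bounded sets. *)
Definition hausdorff_dist A B : R :=
  Num.max (sup [set dist_to x B | x in A]) (sup [set dist_to y A | y in B]).

Definition inward_direction A x (nu : 'cV[R]_n) : Prop :=
  enorm nu = 1 /\ \forall s \near 0^'+, A (x + s *: nu).

Definition special_orthogonal (rho : 'M[R]_n) : Prop :=
  rho *m rho^T = 1%:M /\ \det rho = 1.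

Definition symmx (A : 'M[R]_n) : Prop := A^T = A.

Definition lemx (A B : 'M[R]_n) : Prop :=
  forall x, 0 <= dotv x ((B - A) *m x).

End Euclidean.

(* Lebesgue measure on 'cV[R]_n, for the product sigma-algebra (generated by   *)
(* the coordinates), as an iterated product of the measure on the line.        *)
Definition cV_display : measure_display.
Proof. exact. Qed.

Section measurable_cV.
Context {R : realType} {n : nat}.

Definition cV_coord (i : 'I_n) (x : 'cV[R]_n) : measurableTypeR R := x i 0.

Let cV_set0 : g_sigma_preimage cV_coord set0.
Proof. exact: sigma_algebra0. Qed.

Let cV_setC A : g_sigma_preimage cV_coord A -> g_sigma_preimage cV_coord (~` A).
Proof. exact: sigma_algebraC. Qed.

Let cV_bigcup (F : _^nat) : (forall i, g_sigma_preimage cV_coord (F i)) ->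
  g_sigma_preimage cV_coord (\bigcup_i (F i)).
Proof. exact: sigma_algebra_bigcup. Qed.

HB.instance Definition _ := @isMeasurable.Build cV_display
  'cV[R]_n (g_sigma_preimage cV_coord) cV_set0 cV_setC cV_bigcup.

End measurable_cV.

Lemma measurable_cV_coord (R : realType) n (i : 'I_n) :
  measurable_fun [set: 'cV[R]_n] (@cV_coord R n i).
Proof.
move=> _ Y mY; rewrite setTI; apply: sub_sigma_algebra => /=.
rewrite -bigcup_seq/=; exists i => /=; first by rewrite mem_index_enum.
by exists Y => //; rewrite setTI.
Qed.

Lemma measurable_fun_cV d (T : measurableType d) (R : realType) n
    (f : T -> 'cV[R]_n) :
  (forall i, measurable_fun [set: T] (@cV_coord R n i \o f)) ->
  measurable_fun [set: T] f.
Proof.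
move=> mf; suff H : preimage_set_system setT f (@measurable _ 'cV[R]_n)
    `<=` measurable by move=> _ A mA; apply: H; exists A.
rewrite -[X in X `<=` _]/(preimage_set_system setT f (g_sigma_preimage _)).
rewrite -g_sigma_preimage_comp.
apply: smallest_sub; first exact: sigma_algebra_measurable.
case: n f mf => [|n] f mf; first by rewrite big_ord0.
rewrite -bigcup_mkord_ord; apply: bigcup_sub => i Ii.
by move=> A [B mB <-]; exact: mf.
Qed.

Section lebesgue_cV.
Context {R : realType}.

Definition cV_cons n (z : measurableTypeR R * 'cV[R]_n) : 'cV[R]_n.+1 :=
  col_mx (z.1 : R)%:M z.2.

Lemma measurable_cV_cons n : measurable_fun setT (@cV_cons n).
Proof.
apply: measurable_fun_cV => i.
have [j ->|j ->] := split_ordP (i : 'I_(1 + n)).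
  rewrite (_ : _ \o _ = fst) //; apply/funext => z.
  by apply: etrans (col_mxEu _ _ _ _) _; rewrite mxE (ord1 j).
rewrite (_ : _ \o _ = cV_coord j \o snd).
  by apply: measurableT_comp => //; exact: measurable_cV_coord.
by apply/funext => z; exact: (col_mxEd _ _ _ _).
Qed.

Section lebesgue_cV_succ.
Context {n : nat}.
Variable mu : {measure set 'cV[R]_n -> \bar R}.

Definition lebesgue_cV_succ : set 'cV[R]_n.+1 -> \bar R :=
  pushforward (@lebesgue_measure R \x^ mu)%E (@cV_cons n).

Let mcons := @measurable_cV_cons n.

Let succ0 : lebesgue_cV_succ set0 = 0%E.
Proof. exact: measure0. Qed.

Let succ_ge0 A : (0 <= lebesgue_cV_succ A)%E.
Proof. exact: measure_ge0. Qed.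

Let succ_sigma_additive : semi_sigma_additive lebesgue_cV_succ.
Proof. exact: measure_semi_sigma_additive. Qed.

HB.instance Definition _ := isMeasure.Build _ _ _ lebesgue_cV_succ
  succ0 succ_ge0 succ_sigma_additive.

End lebesgue_cV_succ.

Fixpoint lebesgue_cV n : {measure set 'cV[R]_n -> \bar R} :=
  match n with
  | 0 => dirac (0 : 'cV[R]_0)
  | m.+1 => lebesgue_cV_succ (lebesgue_cV m)
  end.

Definition Lq_norm n (A : set 'cV[R]_n) (q : \bar R) (w : 'cV[R]_n -> R) :
  \bar R := 'N[lebesgue_cV n]_q[EFin \o (w \_ A)].

End lebesgue_cV.

(* The surface measure of the unit sphere, as the image of n times Lebesgue    *)
(* measure on the unit ball under the radial projection, that is,              *)
(* sigma(E) = n |{t xi : xi \in E, 0 < t <= 1}| for E in the sphere.           *)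
Section surface_measure.
Context {R : realType} {n : nat}.

Definition radial_proj (x : 'cV[R]_n) : 'cV[R]_n := (enorm x)^-1 *: x.

Lemma measurable_enorm :
  measurable_fun setT (@enorm R n : 'cV[R]_n -> measurableTypeR R).
Proof.
rewrite (_ : enorm = fun x : 'cV[R]_n => (dotv x x) `^ (2^-1)).
  apply: (@measurableT_comp _ _ _ _ _ _ (fun t : measurableTypeR R => t `^ 2^-1)).
    exact: measurable_powR.
  apply: measurable_sum => i; apply: measurable_funM; exact: measurable_cV_coord.
by apply/funext => x; rewrite powR12_sqrt// sumr_ge0// => i _; rewrite -expr2 sqr_ge0.
Qed.

Lemma measurable_radial_proj : measurable_fun setT radial_proj.
Proof.
apply: measurable_fun_cV => i.
rewrite (_ : _ \o _ = fun x : 'cV[R]_n => enorm x `^ (-1) * cV_coord i x).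
  apply: measurable_funM; last exact: measurable_cV_coord.
  apply: (@measurableT_comp _ _ _ _ _ _ (fun t : measurableTypeR R => t `^ (-1))).
    exact: measurable_powR.
  exact: measurable_enorm.
apply/funext => x; rewrite powR_inv1 ?sqrtr_ge0//.
by rewrite /= /cV_coord mxE.
Qed.

Lemma measurable_unit_eball : measurable (closed_eball 0 1 : set 'cV[R]_n).
Proof.
rewrite (_ : closed_eball 0 1 = setT `&` (@enorm R n) @^-1` `]-oo, 1]).
  exact: measurable_enorm.
by apply/seteqP; split => x /=; rewrite /closed_eball /= subr0 in_itv //= => -[].
Qed.

Definition sphere_measure (E : set 'cV[R]_n) : \bar R :=
  (n%:R%:E * lebesgue_cV n (radial_proj @^-1` E `&` closed_eball 0 1))%E.

Let mproj := measurable_radial_proj.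

Let ball_measure := mrestr (lebesgue_cV n) measurable_unit_eball.

Let sphere_measure0 : sphere_measure set0 = 0%E.
Proof. by rewrite /sphere_measure preimage_set0 set0I measure0 mule0. Qed.

Let sphere_measure_ge0 E : (0 <= sphere_measure E)%E.
Proof. by rewrite mule_ge0. Qed.

Let sphere_measure_sigma_additive : semi_sigma_additive sphere_measure.
Proof.
apply: (@measure_semi_sigma_additive _ _ _
  (mscale n%:R%:nng (pushforward ball_measure radial_proj))).
Unshelve. exact: mproj.
Qed.

HB.instance Definition _ := isMeasure.Build _ _ _ sphere_measure
  sphere_measure0 sphere_measure_ge0 sphere_measure_sigma_additive.

End surface_measure.

Section mean_width.
Context {R : realType} {n : nat}.

Definition support_fun (A : set 'cV[R]_n) (xi : 'cV[R]_n) : R :=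
  sup [set dotv xi y | y in closure A].

Definition mean_width (A : set 'cV[R]_n) : R :=
  2 / (n%:R * fine (lebesgue_cV n (eball 0 1))) *
  \int[sphere_measure]_(xi in usphere) support_fun A xi.

End mean_width.

Section calculus.
Context {R : realType} {n : nat}.
Implicit Types (f : 'cV[R]_n -> R) (A : set 'cV[R]_n).

Definition basis_cV (i : 'I_n) : 'cV[R]_n := delta_mx i 0.

Definition pder (i : 'I_n) f : 'cV[R]_n -> R := 'D_(basis_cV i) f.

Definition grad f (x : 'cV[R]_n) : 'cV[R]_n := \col_i pder i f x.

Definition hess f (x : 'cV[R]_n) : 'M[R]_n := \matrix_(i, j) pder i (pder j f) x.

Definition C0_on A f : Prop := forall x, A x -> {for x, continuous f}.

(* C^1 and C^2 on an open set: the partial derivatives exist and are           *)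
(* continuous up to the given order.                                           *)
Definition C1_on A f : Prop :=
  [/\ C0_on A f,
      forall i x, A x -> derivable f x (basis_cV i) &
      forall i, C0_on A (pder i f)].

Definition C2_on A f : Prop := C1_on A f /\ forall i, C1_on A (pder i f).

Definition C0_closure A f : Prop := {within closure A, continuous f}.

Definition usc_on A f : Prop :=
  forall x a, A x -> f x < a -> \forall y \near x, f y < a.

Definition lsc_on A f : Prop :=
  forall x a, A x -> a < f x -> \forall y \near x, a < f y.

End calculus.

(* An operator is a function on all matrices of which only the values at       *)
(* symmetric matrices matter.                                                  *)
Definition operator (R : realType) (n : nat) :=
  'cV[R]_n -> R -> 'cV[R]_n -> 'M[R]_n -> R.

Section operators.
Context {R : realType} {n : nat}.
Variable F : operator R n.
Implicit Types (A : set 'cV[R]_n) (w : 'cV[R]_n -> R).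

Definition op_continuous : Prop :=
  {within [set z : 'cV[R]_n * R * 'cV[R]_n * 'M[R]_n | symmx z.2],
    continuous (fun z => F z.1.1.1 z.1.1.2 z.1.2 z.2)}.

Definition op_proper : Prop :=
  forall x s t xi M, symmx M -> s <= t -> F x t xi M <= F x s xi M.

Definition op_degenerate_elliptic : Prop :=
  forall x t xi M N, symmx M -> symmx N -> lemx M N -> F x t xi M <= F x t xi N.

Definition op_rotation_invariant : Prop :=
  forall rho, special_orthogonal rho -> forall x t xi M, symmx M ->
    F (rho *m x) t (rho *m xi) (rho *m M *m rho^T) = F x t xi M.

Definition op_power_superlevel (p : R) (theta : 'cV[R]_n) :
    set ('cV[R]_n * R^o * 'M[R]_n) :=
  [set z | [/\ 0 < z.1.2, symmx z.2 &
    0 <= F z.1.1 (z.1.2 `^ p^-1) ((z.1.2 `^ (p^-1 - 1)) *: theta)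
           ((z.1.2 `^ (p^-1 - 3)) *: z.2)]].

Definition op_at w (x : 'cV[R]_n) : R := F x (w x) (grad w x) (hess w x).

Definition classical_solution A w : Prop :=
  C2_on A w /\ forall x, A x -> op_at w x = 0.

Definition classical_supersolution A w : Prop :=
  C2_on A w /\ forall x, A x -> op_at w x <= 0.

Definition viscosity_subsolution A w : Prop :=
  usc_on A w /\
  forall x phi, A x -> C2_on A phi -> phi x = w x ->
    (\forall y \near x, w y <= phi y) ->
    0 <= F x (w x) (grad phi x) (hess phi x).

Definition viscosity_supersolution A w : Prop :=
  lsc_on A w /\
  forall x phi, A x -> C2_on A phi -> phi x = w x ->
    (\forall y \near x, phi y <= w y) ->
    F x (w x) (grad phi x) (hess phi x) <= 0.

Definition viscosity_solution A w : Prop :=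
  [/\ C0_on A w, viscosity_subsolution A w & viscosity_supersolution A w].

(* The comparison principle, relative to the class super of supersolutions. *)
Definition comparison_principle
    (super : set 'cV[R]_n -> ('cV[R]_n -> R) -> Prop) A : Prop :=
  forall z w, C0_closure A z -> super A z ->
    C0_closure A w -> viscosity_subsolution A w ->
    (forall x, boundary A x -> w x <= z x) ->
    forall x, A x -> w x <= z x.

End operators.

Definition positive_zero_boundary (R : realType) (n : nat) (A : set 'cV[R]_n)
    (w : 'cV[R]_n -> R) : Prop :=
  [/\ C0_closure A w, forall x, boundary A x -> w x = 0 &
      forall x, A x -> 0 < w x].

Section mean_width_rearrangement.
Context {R : realType} {n : nat}.
(* rho i is the (i+1)-st rotation of the sequence. *)
Variables (rho : nat -> 'M[R]_n) (A : set 'cV[R]_n).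

Definition rotated (i : nat) : set 'cV[R]_n := [set rho i *m x | x in A].

Definition barycenter m (y : 'I_m -> 'cV[R]_n) : 'cV[R]_n :=
  m%:R^-1 *: \sum_i y i.

(* At m = 0 this is {0}; the value is irrelevant as m tends to infinity. *)
Definition rotation_mean m : set 'cV[R]_n :=
  [set barycenter y | y in [set y : 'I_m -> 'cV[R]_n | forall i : 'I_m, rotated i (y i)]].

Variables (u : 'cV[R]_n -> R) (p : R).

Definition rotated_fun (i : nat) (x : 'cV[R]_n) : R := u (invmx (rho i) *m x).

Definition rearr_step m : 'cV[R]_n -> R :=
  (fun x => sup [set (m%:R^-1 * \sum_(i < m) rotated_fun i (y i) `^ p) `^ p^-1
                | y in [set y : 'I_m -> 'cV[R]_n |
                    (forall i : 'I_m, closure (rotated i) (y i)) /\ x = barycenter y]])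
  \_ (closure (rotation_mean m)).

Variable k : nat -> nat.

Definition rearr_pow_lim (x : 'cV[R]_n) : R :=
  limn (fun j => rearr_step (k j) x `^ p).

Definition rearrangement (x : 'cV[R]_n) : R := rearr_pow_lim x `^ p^-1.

Definition rearr_cvg : Prop :=
  {uniform closed_eball 0 (2 * sup [set enorm x | x in closure A]),
    (fun j x => rearr_step (k j) x `^ p) @ \oo --> rearr_pow_lim}.

End mean_width_rearrangement.

(* Main.v *)
Require Import Defs.
From HB Require Import structures.
From mathcomp Require Import all_boot all_order all_algebra.
From mathcomp Require Import all_classical all_reals all_analysis.
From mathcomp Require Import measurable_realfun ess_sup_inf.
From mathcomp Require Import ring lra.
Set Implicit Arguments.
Unset Strict Implicit.
Unset Printing Implicit Defensive.
Import Order.TTheory GRing.Theory Num.Theory.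
Import numFieldNormedType.Exports.
Local Open Scope classical_set_scope.
Local Open Scope ring_scope.

(** Write W_m for the m-th step of the rearrangement. Where W_m(x) > 0, a maximizing
    tuple x = (1/m) sum_i rho_i z_i has all z_i in Omega, because u grows at least linearly
    near the boundary and p < 1. If phi touches W_m from above at x, then
    phi(x + s h)^p - (1/m) sum_i u(z_i + s a_i rho_i^T h)^p has a minimum at s = 0 whenever
    sum_i a_i = m. With a_i = m at a single index this makes the vectors
    u(z_i)^(p-1) rho_i grad u(z_i) all equal to theta = W_m(x)^(p-1) grad phi(x); with
    a_i = u(z_i)^p / W_m(x)^p it bounds D^2 phi(x) below by a weighted mean of the matrices
    rho_i D^2 u(z_i) rho_i^T. The convexity hypothesis at theta, rotation invariance and
    ellipticity then show that W_m is a viscosity subsolution. This passes to the uniform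
    limit w, which is continuous, positive in the limit ball and zero outside it, so the
    comparison principle gives w <= v. By the Brunn-Minkowski inequality, the superlevel
    sets of W_m, hence those of w, are at least as large as those of u, and the norms
    compare by the layer cake formula. *)

(** The weights a_i proportional to u(z_i)^p are dictated by the second variation. Once all the
    vectors u(z_i)^(p-1) rho_i grad u(z_i) equal theta, every squared-gradient term is a multiple of
    the square of the scalar product of h and theta, and with these weights the terms from the z_i
    add up to exactly the term coming from phi. What is left compares Hessians only, with factors
    u(z_i)^(3p-1); for t = u^p this is the scaling t^(1/p-3) of the convexity hypothesis.

    The touching argument is available only where the value is positive, since only there maximizing
    tuples are known to be interior. Positivity of w in the whole open limit ball is therefore a
    separate step, which needs a lower bound for W_m that does not depend on m.

    The rotated superlevel sets of u all have the same measure, so the multiplicative form of the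
    Brunn-Minkowski inequality suffices. It follows by induction on the dimension from a
    one-dimensional Prekopa-Leindler inequality applied to the measures of slices. *)

Section euclidean_norm.
Context {R : realType} {n : nat}.
Implicit Types (x y z : 'cV[R]_n) (A : set 'cV[R]_n).

Lemma dotvE x y : dotv x y = (x^T *m y) 0 0.
Proof. by rewrite mxE; apply: eq_bigr => i _; rewrite mxE. Qed.

Lemma dotvC x y : dotv x y = dotv y x.
Proof. by apply: eq_bigr => i _; rewrite mulrC. Qed.

Lemma dotvDr x y z : dotv x (y + z) = dotv x y + dotv x z.
Proof. by rewrite !dotvE mulmxDr mxE. Qed.

Lemma dotvZr x y a : dotv x (a *: y) = a * dotv x y.
Proof. by rewrite !dotvE -scalemxAr mxE. Qed.

Lemma dotvNr x y : dotv x (- y) = - dotv x y.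
Proof. by rewrite -scaleN1r dotvZr mulN1r. Qed.

Lemma dotvBr x y z : dotv x (y - z) = dotv x y - dotv x z.
Proof. by rewrite dotvDr dotvNr. Qed.

Lemma dotvDl x y z : dotv (x + y) z = dotv x z + dotv y z.
Proof. by rewrite !(dotvC _ z) dotvDr. Qed.

Lemma dotvZl x y a : dotv (a *: x) y = a * dotv x y.
Proof. by rewrite !(dotvC _ y) dotvZr. Qed.

Lemma dotvNl x y : dotv (- x) y = - dotv x y.
Proof. by rewrite !(dotvC _ y) dotvNr. Qed.

Lemma dotvBl x y z : dotv (x - y) z = dotv x z - dotv y z.
Proof. by rewrite dotvDl dotvNl. Qed.

Lemma dotv_sumr x (I : finType) (f : I -> 'cV[R]_n) :
  dotv x (\sum_i f i) = \sum_i dotv x (f i).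
Proof.
rewrite dotvE mulmx_sumr summxE; apply: eq_bigr => i _; by rewrite dotvE.
Qed.

Lemma dotv_delta x i : dotv x (basis_cV i) = x i 0.
Proof.
rewrite /dotv (bigD1 i)//= mxE !eqxx mulr1 big1 ?addr0// => j /negbTE ji.
by rewrite mxE ji mulr0.
Qed.

Lemma dotv_mulmx x y (M : 'M[R]_n) : dotv x (M *m y) = dotv (M^T *m x) y.
Proof. by rewrite !dotvE trmx_mul trmxK mulmxA. Qed.

Lemma dotvv_ge0 x : 0 <= dotv x x.
Proof. by apply: sumr_ge0 => i _; rewrite -expr2 sqr_ge0. Qed.

Lemma enorm_ge0 x : 0 <= enorm x. Proof. exact: sqrtr_ge0. Qed.

Lemma sqr_enorm x : enorm x ^+ 2 = dotv x x.
Proof. by rewrite sqr_sqrtr ?dotvv_ge0. Qed.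

Lemma enorm0 : enorm (0 : 'cV[R]_n) = 0.
Proof. by rewrite /enorm /dotv big1 ?sqrtr0// => i _; rewrite mxE mul0r. Qed.

Lemma enormZ a x : enorm (a *: x) = `|a| * enorm x.
Proof.
by rewrite /enorm dotvZl dotvZr mulrA -expr2 sqrtrM ?sqr_ge0// sqrtr_sqr.
Qed.

Lemma enormN x : enorm (- x) = enorm x.
Proof. by rewrite -scaleN1r enormZ normrN1 mul1r. Qed.

Lemma enormB x y : enorm (x - y) = enorm (y - x).
Proof. by rewrite -enormN opprB. Qed.

(** Cauchy-Schwarz, from expanding the squared length of (y.y) x - (x.y) y and cancelling y.y, which
    requires y = 0 to be treated apart. *)
Lemma dotv_le_enorm x y : dotv x y <= enorm x * enorm y.
Proof.
have [|xy0] := lerP (dotv x y) 0.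
  by move=> /le_trans; apply; rewrite mulr_ge0 ?enorm_ge0.
rewrite -ler_sqr ?nnegrE ?mulr_ge0 ?enorm_ge0 ?(ltW xy0)//.
rewrite exprMn !sqr_enorm.
have := dotvv_ge0 (dotv y y *: x - dotv x y *: y).
rewrite !(dotvBl, dotvBr, dotvZl, dotvZr) (dotvC y x).
have := dotvv_ge0 y; rewrite le_eqVlt => /predU1P[y0 _|y0].
  suff -> : dotv x y = 0 by rewrite expr0n/= -y0 mulr0.
  rewrite /dotv big1// => i _; suff -> : y i 0 = 0 by rewrite mulr0.
  apply/eqP; rewrite -sqrf_eq0 expr2; move/esym/eqP : y0.
  rewrite psumr_eq0 => [/allP/(_ i)|j _]; last by rewrite -expr2 sqr_ge0.
  by rewrite mem_index_enum => /(_ isT).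
move=> H; have : 0 <= dotv y y * (dotv x x * dotv y y - dotv x y ^+ 2).
  by move: H; congr (_ <= _); ring.
by rewrite pmulr_rge0// subr_ge0.
Qed.

Lemma enormD x y : enorm (x + y) <= enorm x + enorm y.
Proof.
rewrite -ler_sqr ?nnegrE ?addr_ge0 ?enorm_ge0// sqr_enorm sqrrD !sqr_enorm.
rewrite dotvDl !dotvDr (dotvC y x).
have := dotv_le_enorm x y; rewrite mulr2n; lra.
Qed.

Lemma enorm_sum (I : Type) (r : seq I) (f : I -> 'cV[R]_n) :
  enorm (\sum_(i <- r) f i) <= \sum_(i <- r) enorm (f i).
Proof.
elim/big_rec2 : _ => [|i a b _ h]; first by rewrite enorm0.
by apply: le_trans (enormD _ _) _; rewrite lerD2l.
Qed.

Lemma coord_le_norm (m : nat) (M : 'M[R]_(n, m)) i j : `|M i j| <= `|M|.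
Proof.
rewrite [leRHS]/Num.Def.normr /= mx_normrE.
by apply: (@le_bigmax _ _ _ 0 (fun ij : 'I_n * 'I_m => `|M ij.1 ij.2|) (i, j)).
Qed.

Lemma norm_le_coord (m : nat) (M : 'M[R]_(n, m)) a :
  0 <= a -> (forall i j, `|M i j| <= a) -> `|M| <= a.
Proof.
move=> a0 Ma; rewrite [leLHS]/Num.Def.normr /= mx_normrE.
by apply/bigmax_leP; split => // -[i j] _ /=.
Qed.

Lemma coord_le_enorm x i : `|x i 0| <= enorm x.
Proof.
rewrite -ler_sqr ?nnegrE ?enorm_ge0// sqr_enorm real_normK ?num_real//.
rewrite /dotv (bigD1 i)//= -expr2 lerDl sumr_ge0// => j _.
by rewrite -expr2 sqr_ge0.
Qed.

Lemma norm_le_enorm x : `|x| <= enorm x.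
Proof.
by apply: norm_le_coord; [exact: enorm_ge0|move=> i j; rewrite ord1 coord_le_enorm].
Qed.

Lemma enorm_le_norm x : enorm x <= n%:R * `|x|.
Proof.
rewrite -ler_sqr ?nnegrE ?enorm_ge0 ?mulr_ge0// sqr_enorm exprMn.
apply: (@le_trans _ _ (n%:R * `|x| ^+ 2)).
  rewrite /dotv mulr_natl -[X in _ *+ X]card_ord -sumr_const ler_sum// => i _.
  by rewrite -expr2 -real_normK ?num_real// ler_sqr ?nnegrE// coord_le_norm.
rewrite ler_wpM2r ?sqr_ge0// -natrX ler_nat.
by case: n => // m; rewrite expnS expn1 leq_pmull.
Qed.

Lemma enorm_eq0 x : (enorm x == 0) = (x == 0).
Proof.
apply/eqP/eqP => [x0|->]; last exact: enorm0.
apply/eqP; rewrite -normr_eq0 eq_le normr_ge0 andbT -x0; exact: norm_le_enorm.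
Qed.

Lemma enorm_gt0 x : (0 < enorm x) = (x != 0).
Proof. by rewrite lt_neqAle enorm_ge0 andbT eq_sym enorm_eq0. Qed.

Lemma nbhs_enormP x A :
  nbhs x A <-> exists2 r, 0 < r & forall y, enorm (y - x) < r -> A y.
Proof.
split=> [/nbhs_ballP[e /= e0 eA]|[r r0 rA]].
  exists e => // y yxe; apply: eA; rewrite -ball_normE /=.
  by rewrite distrC; apply: le_lt_trans yxe; exact: norm_le_enorm.
(* The comparison constant between the two norms is n; n + 1 also covers n = 0. *)
apply/nbhs_ballP; exists (r / n.+1%:R) => /=; first by rewrite divr_gt0.
move=> y; rewrite -ball_normE /= distrC ltr_pdivlMr// => h; apply: rA.
apply: le_lt_trans (enorm_le_norm _) _; apply: le_lt_trans h.
by rewrite mulrC ler_wpM2l// ler_nat.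
Qed.

Lemma near_enorm x r : 0 < r -> \forall y \near x, enorm (y - x) < r.
Proof. by move=> r0; apply/nbhs_enormP; exists r. Qed.

Lemma closure_enormP A x :
  closure A x <-> forall e, 0 < e -> exists2 y, A y & enorm (y - x) < e.
Proof.
split=> [Ax e e0|h B /nbhs_enormP[r r0 rB]].
  by have [y [Ay ye]] := Ax _ (near_enorm x e0); exists y.
by have [y Ay yr] := h _ r0; exists y; split => //; exact: rB.
Qed.

Lemma near_line x (h : 'cV[R]_n) A :
  nbhs x A -> \forall s \near (0 : R), A (x + s *: h).
Proof.
move=> xA; have : (fun s : R => x + s *: h) @ (0 : R) --> x.
  rewrite -[X in _ --> X]addr0 -(scale0r h).
  by apply: cvgD; [exact: cvg_cst|apply: cvgZr_tmp; exact: cvg_id].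
exact.
Qed.

Lemma special_orthogonal_tr (rho : 'M[R]_n) :
  special_orthogonal rho -> rho^T *m rho = 1%:M.
Proof. by case=> h _; exact: mulmx1C. Qed.

Lemma special_orthogonal_inv (rho : 'M[R]_n) :
  special_orthogonal rho -> invmx rho = rho^T.
Proof.
move=> [h d]; have u : rho \in unitmx by rewrite unitmxE d unitr1.
by rewrite -[LHS]mulmx1 -h mulmxA mulVmx// mul1mx.
Qed.

Lemma enorm_orthogonal (rho : 'M[R]_n) x :
  rho^T *m rho = 1%:M -> enorm (rho *m x) = enorm x.
Proof. by move=> h; rewrite /enorm dotv_mulmx mulmxA h mul1mx. Qed.

End euclidean_norm.

(** Flattening by [mxvec] preserves the sup norm, so the statement is transported from row vectors.
    General matrices are needed because tuples of points are later stored as columns. *)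
Lemma mx_bounded_closed_compact (R : realType) (m n : nat) (A : set 'M[R]_(m, n)) :
  bounded_set A -> closed A -> compact A.
Proof.
move=> [M [Mr AM]] cA.
have mxvec_cont : continuous (@mxvec R m n).
  move=> X; apply/(@cvgrPdist_lt _ _ _ (nbhs X)) => e e0; near=> Y.
  apply: (@le_lt_trans _ _ `|X - Y|); last by near: Y; exact: cvgr_dist_lt.
  rewrite -linearB; apply: norm_le_coord => // i j.
  case/mxvec_indexP : j => k l; rewrite ord1 mxvecE; exact: coord_le_norm.
have vec_mx_cont : continuous (@vec_mx R m n).
  move=> X; apply/(@cvgrPdist_lt _ _ _ (nbhs X)) => e e0; near=> Y.
  apply: (@le_lt_trans _ _ `|X - Y|); last by near: Y; exact: cvgr_dist_lt.
  rewrite -linearB; apply: norm_le_coord => // i j.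
  rewrite mxE; exact: coord_le_norm.
rewrite (_ : A = @vec_mx R m n @` (vec_mx @^-1` A)); last first.
  apply/seteqP; split => [x Ax|x [y Ay <-]//].
  by exists (mxvec x) => //=; rewrite mxvecK.
apply: continuous_compact; first exact: continuous_subspaceT.
apply: bounded_closed_compact; last by apply: preimage_closed => // x _; exact: vec_mx_cont.
exists M; split=> // x Mx y /= Ay; have := AM _ Mx _ Ay; apply: le_trans.
apply: norm_le_coord => // i j; rewrite ord1 -[y]vec_mxK.
by case/mxvec_indexP : j => k l; rewrite mxvecE vec_mxK; exact: coord_le_norm.
Unshelve. all: by end_near. Qed.

(** * Second order expansions along lines *)

Section real_line_derivative.
Context {R : realType}.
Implicit Types (g : R -> R) (d s t : R).

Lemma is_derive0P g d : is_derive (0 : R) 1 g d <->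
  forall e, 0 < e -> \forall s \near (0 : R), `|g s - g 0 - d * s| <= e * `|s|.
Proof.
split=> [[dg <-] e e0|H].
  have /cvgrPdist_le /(_ _ e0) := dg : cvg _.
  rewrite near_withinE; apply: filterS => h; rewrite -/(derive g 0 1).
  have [->|h0] := eqVneq h 0; first by rewrite mulr0 subr0 subrr !normr0 mulr0.
  move=> /(_ isT); rewrite /= addr0 [h *: _]mulr1 /GRing.scale/= => H.
  rewrite distrC -[X in `|_ - X|](@mulVKf _ h)// [X in `|X - _|]mulrC -mulrBr.
  by rewrite normrM mulrC ler_wpM2r.
suff K : h^-1 *: ((g \o shift 0) (h *: 1) - g 0) @[h --> 0^'] --> d.
  by split; [exact: cvgP K|exact: cvg_lim K].
apply/cvgrPdist_le => e e0; rewrite near_withinE.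
apply: filterS (H _ e0) => h K h0 /=.
rewrite addr0 [h *: _]mulr1 /GRing.scale/=.
rewrite -[d](@mulKf _ h)// -mulrBr normrM normfV mulrC ler_pdivrMr ?normr_gt0//.
by rewrite distrC [h * d]mulrC.
Qed.

(** Passing to G(s) = g(s t) on [0, 1] makes a single statement serve t of either sign. *)
Lemma mean_value_at0 g (dg : R -> R) t :
  (forall s, 0 <= s <= 1 -> is_derive (s * t) 1 g (dg (s * t))) ->
  exists2 s, 0 < s < 1 & g t - g 0 = dg (s * t) * t.
Proof.
move=> H; pose G s := g (s * t).
have HG s : s \in `[0, 1] -> is_derive s 1 G (dg (s * t) * t).
  rewrite in_itv /= => /H K.
  have := @is_derive1_comp _ g (fun s => s * t) s _ _ K.
  by apply; apply: is_derive_eq; rewrite /GRing.scale/= mulr0 add0r mulr1.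
have HG' s : s \in `]0, 1[ -> is_derive s 1 G (dg (s * t) * t).
  by move=> /subset_itv_oo_cc; exact: HG.
have cG : {within `[0, 1], continuous G}.
  by apply: derivable_within_continuous => s /HG[].
have [s] := MVT ltr01 HG' cG.
by rewrite in_itv /= /G mul1r mul0r subr0 mulr1 => s01 ->; exists s.
Qed.

Lemma near0P (P : set R) :
  nbhs (0 : R) P <-> exists2 r, 0 < r & forall s, `|s| < r -> P s.
Proof.
split=> [/nbhs_ballP[r /= r0 H]|[r r0 H]].
  by exists r => // s sr; apply: H; rewrite -ball_normE /= sub0r normrN.
apply/nbhs_ballP; exists r => //= s; rewrite -ball_normE /= sub0r normrN; exact: H.
Qed.

(** First and second derivative of g at 0. As a relation it composes under sums, multiples and
    powers without separate derivability conditions; g' has to exist near 0, g'' only at 0. *)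
Definition jet2 g (a b : R) : Prop :=
  exists dg : R -> R, [/\ \forall s \near (0 : R), is_derive (s : R) 1 g (dg s),
    dg 0 = a & is_derive (0 : R) 1 dg b].

Lemma jet2D g h a b a' b' :
  jet2 g a b -> jet2 h a' b' -> jet2 (g \+ h) (a + a') (b + b').
Proof.
move=> [dg [Hg <- dg0]] [dh [Hh <- dh0]]; exists (dg \+ dh); split => //.
  by apply: filterS2 Hg Hh => s Hg Hh; exact: is_deriveD.
exact: is_deriveD.
Qed.

Lemma jet2Z k g a b : jet2 g a b -> jet2 (k \*: g) (k * a) (k * b).
Proof.
move=> [dg [Hg <- dg0]]; exists (k \*: dg); split => //.
  by apply: filterS Hg => s Hg; exact: is_deriveZ.
exact: is_deriveZ.
Qed.

Lemma jet2_cst k : jet2 (cst k) 0 0.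
Proof.
exists (cst 0); split => //; last exact: is_derive_cst.
by apply/near0P; exists 1 => // s _; exact: is_derive_cst.
Qed.

Lemma jet2_sum (I : Type) (r : seq I) (g : I -> R -> R) (a b : I -> R) :
  (forall i, jet2 (g i) (a i) (b i)) ->
  jet2 (fun s => \sum_(i <- r) g i s) (\sum_(i <- r) a i) (\sum_(i <- r) b i).
Proof.
move=> H; elim: r => [|i r IH].
  rewrite !big_nil (_ : (fun _ => _) = cst 0); first exact: jet2_cst.
  by apply/funext => s; rewrite big_nil.
rewrite !big_cons (_ : (fun _ => _) = g i \+ fun s => \sum_(i <- r) g i s).
  exact: jet2D.
by apply/funext => s; rewrite big_cons.
Qed.

Lemma jet2_powR p g a b : 0 < g 0 -> jet2 g a b ->
  jet2 (fun s => g s `^ p) (p * g 0 `^ (p - 1) * a)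
    (p * g 0 `^ (p - 1) * b + p * (p - 1) * g 0 `^ (p - 2) * a ^+ 2).
Proof.
move=> g0 [dg [Hg <- dg0]]; exists (fun s => p * g s `^ (p - 1) * dg s).
have gc : {for 0, continuous g}.
  have [+ _] := nbhs_singleton Hg.
  by move=> /derivable1_diffP/differentiable_continuous.
have gpos : \forall s \near (0 : R), 0 < g s by exact: cvgr_gt gc _ g0.
have powD q s : is_derive s 1 g (dg s) -> 0 < g s ->
    is_derive s 1 (fun s => g s `^ q) (q * g s `^ (q - 1) * dg s).
  move=> H gs.
  exact: (@is_derive1_comp _ (fun x => x `^ q) g s _ _ (is_derive1_powR q gs) H).
split=> //; first by apply: filterS2 Hg gpos => s; exact: powD.
have H1 := powD (p - 1) _ (nbhs_singleton Hg) g0.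
have [D1 D2] := @is_deriveM _ _ (fun s => p * g s `^ (p - 1)) dg 0 1 _ _
  (is_deriveZ p H1) dg0.
split => //; rewrite -[LHS]/('D_1 ((fun s => p * g s `^ (p - 1)) * dg) 0) D2.
rewrite /GRing.scale/= -addrA (_ : -1 + - 1 = - 2 :> R); last by ring.
ring.
Qed.

Lemma jet2_min g a b : jet2 g a b -> (\forall s \near (0 : R), g 0 <= g s) ->
  a = 0 /\ 0 <= b.
Proof.
move=> [dg [Hg <- dg0]] mg.
have a0 : dg 0 = 0.
  apply/eqP/negPn/negP => a0.
  have e0 : 0 < `|dg 0| / 2 by rewrite divr_gt0 ?normr_gt0.
  have K1 := (is_derive0P g _).1 (nbhs_singleton Hg) _ e0.
  have [r r0 H] := (near0P _).1 (filterI mg K1).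
  (* The point at distance r / 2 in the direction opposite to the sign of g'(0) is where g falls
     below g(0). *)
  have rr : `|- Num.sg (dg 0) * (r / 2)| < r.
    rewrite normrM normrN normr_sg a0 mul1r gtr0_norm ?divr_gt0//; lra.
  have [] := H _ rr; rewrite ler_norml => /[swap] /andP[_].
  rewrite normrM normrN normr_sg a0 mul1r (gtr0_norm (divr_gt0 _ _))//.
  have -> : dg 0 * (- Num.sg (dg 0) * (r / 2)) = - `|dg 0| * (r / 2).
    by rewrite mulrA mulrN; congr (- _ * _); rewrite mulrC -normrEsg.
  set u := g (_ * _); have : 0 < `|dg 0| * r by rewrite mulr_gt0 ?normr_gt0.
  nra.
split=> //; rewrite leNgt; apply/negP => b0.
(* If b < 0, an error of at most -b / 2 times s keeps g' negative to the right of 0, and the mean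
   value theorem gives g(r / 2) < g(0). *)
have e0 : 0 < - b / 2 by lra.
have H1 := (is_derive0P dg b).1 dg0 _ e0.
have [r r0 H] := (near0P _).1 (filterI (filterI mg Hg) H1).
have [s /andP[s0 s1] E] : exists2 s, 0 < s < 1 & g (r / 2) - g 0 = dg (s * (r / 2)) * (r / 2).
  apply: mean_value_at0 => s /andP[s0 s1].
  have /H[[_ K] _] : `|s * (r / 2)| < r by rewrite ger0_norm ?mulr_ge0//; nra.
  exact: K.
have sr0 : 0 < s * (r / 2) by rewrite mulr_gt0// divr_gt0.
have /H[_] : `|s * (r / 2)| < r by rewrite gtr0_norm//; nra.
rewrite a0 subr0 (gtr0_norm sr0) ler_norml => /andP[_ K].
have /H[[L _] _] : `|r / 2| < r by rewrite gtr0_norm//; lra.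
have : dg (s * (r / 2)) < 0 by nra.
nra.
Qed.

End real_line_derivative.

Section partial_derivatives.
Context {R : realType} {n : nat}.
Implicit Types (f : 'cV[R]_n -> R) (A : set 'cV[R]_n) (x h e : 'cV[R]_n).

Lemma is_derive_line f x e s : derivable f (x + s *: e) e ->
  is_derive s 1 (fun t : R => f (x + t *: e)) ('D_e f (x + s *: e)).
Proof.
have E : (fun h : R => h^-1 *: (((fun t : R => f (x + t *: e)) \o shift s) (h *: 1)
    - f (x + s *: e))) =
    (fun h : R => h^-1 *: ((f \o shift (x + s *: e)) (h *: e) - f (x + s *: e))).
  apply/funext => h /=; congr (_ *: (f _ - _)).
  by rewrite [h *: 1]mulr1 scalerDl addrCA.
by move=> H; split; rewrite /derivable/derive E.
Qed.

Lemma is_derive_lineP f x e d :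
  is_derive (0 : R) 1 (fun t : R => f (x + t *: e)) d -> is_derive x e f d.
Proof.
have E : (fun h : R => h^-1 *: (((fun t : R => f (x + t *: e)) \o shift 0) (h *: 1)
    - f (x + 0 *: e))) =
    (fun h : R => h^-1 *: ((f \o shift x) (h *: e) - f x)).
  apply/funext => h /=; congr (_ *: (f _ - f _)).
    by rewrite [h *: 1]mulr1 addr0 addrC.
  by rewrite scale0r addr0.
by case; rewrite /derivable/derive E => H K; split.
Qed.

Lemma norm_basis_cV (i : 'I_n) : enorm (basis_cV i : 'cV[R]_n) = 1.
Proof. by rewrite /enorm dotv_delta mxE !eqxx sqrtr1. Qed.

(** The base point x + s w moves with s, so the existence of the partial derivative at x is not
    enough: the mean value theorem evaluates it at a point tending to x, where its continuity
    applies. *)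
Lemma is_derive_increment A f x w a i : open A -> C1_on A f -> A x ->
  is_derive (0 : R) 1
    (fun s : R => f (x + s *: w + (s * a) *: basis_cV i) - f (x + s *: w))
    (a * pder i f x).
Proof.
move=> oA [_ df dc] Ax; apply/is_derive0P => e e0.
have xA : nbhs x A by exact: open_nbhs_nbhs.
have a1 : 0 < `|a| + 1 by rewrite ltr_wpDl.
have := dc i x Ax; move=> /(@cvgrPdist_lt _ _ _ (nbhs x)) /(_ (e / (`|a| + 1))).
move=> /(_ (divr_gt0 e0 a1)) dcx.
have [r r0 H] := (nbhs_enormP _ _).1 (filterI xA dcx).
apply/near0P; exists (r / (enorm w + `|a| + 1)) => [|s].
  by rewrite divr_gt0// ltr_wpDl// addr_ge0// enorm_ge0.
rewrite ltr_pdivlMr ?ltr_wpDl ?addr_ge0 ?enorm_ge0// => sr.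
have Hin t : 0 <= t <= 1 -> enorm (x + s *: w + (t * (s * a)) *: basis_cV i - x) < r.
  move=> /andP[t0 t1]; rewrite addrC -!addrA addKr.
  apply: le_lt_trans (enormD _ _) _; rewrite !enormZ norm_basis_cV mulr1.
  apply: le_lt_trans sr; rewrite -addrA mulrDr lerD2l !normrM (ger0_norm t0).
  rewrite mulrDr mulr1 ler_wpDr//.
  by rewrite ler_piMl ?mulr_ge0.
have [|t /andP[t0 t1] E] := @mean_value_at0 _
  (fun t => f (x + s *: w + t *: basis_cV i))
  (fun t => pder i f (x + s *: w + t *: basis_cV i)) (s * a).
  by move=> t /Hin/H[At _]; apply: is_derive_line; exact: df.
move: E; rewrite /= scale0r addr0 => ->.
rewrite scale0r mul0r scale0r !addr0 subrr subr0.
have /Hin/H[_] : 0 <= t <= 1 by rewrite !ltW.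
rewrite distrC ltr_pdivlMr// => K.
rewrite (_ : _ - _ = s * (a * (pder i f (x + s *: w + (t * (s * a)) *: basis_cV i) - pder i f x))); last by ring.
rewrite normrM mulrC ler_wpM2r// normrM mulrC; apply: le_trans (ltW K).
by rewrite mulrDr mulr1 lerDl.
Qed.

Lemma sum_coord_basis h : h = \sum_(i < n) h i 0 *: basis_cV i.
Proof.
apply/matrixP => i j; rewrite ord1 summxE (bigD1 i)//= !mxE !eqxx mulr1 big1 ?addr0//.
by move=> k /negbTE ki; rewrite !mxE eq_sym ki mulr0.
Qed.

Lemma is_derive_C1 A f x h : open A -> C1_on A f -> A x ->
  is_derive x h f (dotv h (grad f x)).
Proof.
move=> oA Cf Ax; apply: is_derive_lineP.
rewrite [in X in is_derive _ _ X _](sum_coord_basis h).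
rewrite (_ : dotv _ _ = \sum_(i <- index_enum 'I_n) h i 0 * pder i f x); last first.
  by apply: eq_bigr => i _; rewrite mxE.
(* The direction h is assembled one coordinate at a time, each adding its own increment. *)
elim/big_rec2 : _ => [|i d w _ IH].
  rewrite (_ : (fun _ => _) = cst (f x)); first exact: is_derive_cst.
  by apply/funext => t; rewrite scaler0 addr0.
have := is_deriveD (is_derive_increment w (h i 0) i oA Cf Ax) IH.
congr (is_derive _ _ _ _); apply/funext => t.
rewrite -[LHS]/(f (x + t *: w + (t * h i 0) *: basis_cV i) - f (x + t *: w) + f (x + t *: w)).
rewrite subrK; congr f.
by rewrite scalerDr scalerA addrAC addrA.
Qed.

Lemma C2_pder A f i : C2_on A f -> C1_on A (pder i f).
Proof. by move=> [_]; exact. Qed.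

Lemma is_derive_line_C1 A f x h s : open A -> C1_on A f -> A (x + s *: h) ->
  is_derive s 1 (fun t : R => f (x + t *: h)) (dotv h (grad f (x + s *: h))).
Proof.
move=> oA Cf Ax; have [H <-] := is_derive_C1 h oA Cf Ax.
exact: is_derive_line.
Qed.

Lemma jet2_line A f x h : open A -> C2_on A f -> A x ->
  jet2 (fun t : R => f (x + t *: h)) (dotv h (grad f x)) (dotv h (hess f x *m h)).
Proof.
move=> oA Cf Ax; exists (fun s => dotv h (grad f (x + s *: h))).
have xA : nbhs x A by exact: open_nbhs_nbhs.
split; last 1 first.
- have H i : is_derive (0 : R) 1 (fun s : R => h i 0 *: pder i f (x + s *: h))
      (h i 0 *: dotv h (grad (pder i f) x)).
    apply: is_deriveZ; rewrite -[in X in is_derive _ _ _ X](addr0 x) -(scale0r h).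
    by apply: (is_derive_line_C1 oA (C2_pder i Cf)); rewrite scale0r addr0.
  have := is_derive_sum H; congr (is_derive _ _ _ _).
    by apply/funext => s; rewrite fct_sumE; apply: eq_bigr => i _; rewrite mxE.
  rewrite dotv_mulmx dotvC /dotv; apply: eq_bigr => i _; congr (_ * _).
  by rewrite mxE; apply: eq_bigr => j _; rewrite !mxE mulrC.
- have := near_line h xA; apply: filterS => s.
  by apply: (is_derive_line_C1 oA); case: Cf.
- by rewrite scale0r addr0.
Qed.

(** The mean value theorem is applied twice, first in direction i to the difference in direction j,
    then in direction j to the i-th partial derivative. *)
Lemma second_difference A f x i j (r : R) : C2_on A f ->
  (forall y, enorm (y - x) < r -> A y) -> forall s, 0 < s -> s + s < r ->
  exists2 y, enorm (y - x) < r &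
    f (x + s *: basis_cV i + s *: basis_cV j) - f (x + s *: basis_cV i)
    - f (x + s *: basis_cV j) + f x = s ^+ 2 * pder j (pder i f) y.
Proof.
move=> Cf rA s s0 sr.
have near a b : 0 <= a <= s -> 0 <= b <= s ->
    enorm (x + a *: basis_cV i + b *: basis_cV j - x) < r.
  move=> /andP[a0 as'] /andP[b0 bs]; rewrite addrC -!addrA addKr.
  apply: le_lt_trans (enormD _ _) _; rewrite !enormZ !norm_basis_cV !mulr1.
  by rewrite !ger0_norm//; lra.
have [[_ df _] dpf] := Cf.
have [|t /andP[t0 t1]] := @mean_value_at0 _
  (fun t => f (x + t *: basis_cV i + s *: basis_cV j) - f (x + t *: basis_cV i))
  (fun t => pder i f (x + t *: basis_cV i + s *: basis_cV j)
            - pder i f (x + t *: basis_cV i)) s.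
  move=> t /andP[t0 t1].
  have ts : 0 <= t * s <= s by rewrite mulr_ge0//= ?ler_piMl// ltW.
  apply: is_deriveB.
    rewrite (_ : (fun _ => _) = fun t => f (x + s *: basis_cV j + t *: basis_cV i)); last first.
      by apply/funext => u; rewrite addrAC.
    rewrite addrAC; apply: is_derive_line; apply: df; rewrite addrAC; apply: rA.
    by apply: near => //; rewrite lexx ltW.
  apply: is_derive_line; apply: df; apply: rA.
  rewrite -[X in X - x]addr0 -(scale0r (basis_cV j)); apply: near => //.
  by rewrite lexx ltW.
rewrite /= scale0r addr0 opprB addrA => E.
have ts : 0 <= t * s <= s by rewrite ltW ?mulr_gt0//= ler_piMl// ltW.
have [|v /andP[v0 v1]] := @mean_value_at0 _
  (fun v => pder i f (x + (t * s) *: basis_cV i + v *: basis_cV j))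
  (fun v => pder j (pder i f) (x + (t * s) *: basis_cV i + v *: basis_cV j)) s.
  move=> v /andP[v0 v1]; apply: is_derive_line.
  have [_ + _] := dpf i; apply; apply: rA; apply: near => //.
  by rewrite mulr_ge0//= ?ler_piMl// ltW.
rewrite /= scale0r addr0 => E'.
exists (x + (t * s) *: basis_cV i + (v * s) *: basis_cV j).
  by apply: near => //; rewrite ltW ?mulr_gt0//= ler_piMl// ltW.
rewrite E' in E; move: E => /(canRL (subrK _)) E.
lra.
Qed.

(** The second difference is symmetric in i and j, so both mixed derivatives take a common value at
    two points near x. The symmetry matters because F is controlled only at symmetric matrices. *)
Lemma pder_comm A f x i j : open A -> C2_on A f -> A x ->
  pder j (pder i f) x = pder i (pder j f) x.
Proof.
have lt_third (r : R) : 0 < r -> r / 3 + r / 3 < r by move=> r0; lra.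
move=> oA Cf Ax; have [_ dpf] := Cf.
apply/eqP/negPn/negP => ne.
set d := `|pder j (pder i f) x - pder i (pder j f) x|.
have d0 : 0 < d by rewrite normr_gt0 subr_eq0.
have d2 : 0 < d / 2 by rewrite divr_gt0.
have xA : nbhs x A by exact: open_nbhs_nbhs.
have [_ _ /(_ j x Ax)] := dpf i.
move=> /(@cvgrPdist_lt _ _ _ (nbhs x)) /(_ _ d2) Hi.
have [_ _ /(_ i x Ax)] := dpf j.
move=> /(@cvgrPdist_lt _ _ _ (nbhs x)) /(_ _ d2) Hj.
have [r r0 H] := (nbhs_enormP _ _).1 (filterI xA (filterI Hi Hj)).
have rA y : enorm (y - x) < r -> A y by move=> /H[].
have s0 : 0 < r / 3 by rewrite divr_gt0.
have sr := lt_third _ r0.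
have [y /H[_ [Hy _]] E] := second_difference i j Cf rA s0 sr.
have [z /H[_ [_ Hz]] E'] := second_difference j i Cf rA s0 sr.
have Eyz : pder j (pder i f) y = pder i (pder j f) z.
  have r2 : (r / 3) ^+ 2 != 0 by rewrite expf_neq0// gt_eqF.
  have E2 : (r / 3) ^+ 2 * pder j (pder i f) y = (r / 3) ^+ 2 * pder i (pder j f) z.
    by apply: etrans (esym E) _; apply: etrans E'; rewrite (addrAC x); ring.
  exact: (mulfI r2 E2).
clear H E E'; suff : d < d / 2 + d / 2 by rewrite -splitr ltxx.
rewrite {1}/d -(subrKA (pder j (pder i f) y)).
apply: le_lt_trans (ler_normD _ _) _; apply: ltrD; first exact: Hy.
by rewrite Eyz distrC.
Qed.

Lemma hess_sym A f x : open A -> C2_on A f -> A x -> symmx (hess f x).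
Proof.
by move=> oA Cf Ax; apply/matrixP => i j; rewrite !mxE; exact: pder_comm oA Cf Ax.
Qed.

End partial_derivatives.

(** * Lebesgue measure of column vectors *)

Section lebesgue_cV_theory.
Context {R : realType}.
Local Open Scope ereal_scope.
Local Notation lambda := (@lebesgue_measure R).

Definition box n (N : R) : set 'cV[R]_n := [set x | forall i, (`|x i 0%R| <= N)%R].

Definition open_box n (e : R) : set 'cV[R]_n := [set x | forall i, (`|x i 0%R| < e)%R].

Arguments box : clear implicits.
Arguments open_box : clear implicits.

Lemma measurable_coords n (P : R -> bool) : measurable [set t : measurableTypeR R | P t] ->
  measurable [set x : 'cV[R]_n | forall i, P (x i 0%R)].
Proof.
move=> mP; rewrite (_ : mkset _ = \bigcap_(i in [set: 'I_n]) (cV_coord i @^-1` [set t | P t])).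
  apply: fin_bigcap_measurable; first exact: finite_finset.
  by move=> i _; rewrite -[X in measurable X]setTI; exact: measurable_cV_coord.
by apply/seteqP; split => x /= H i => [_|]; exact: H.
Qed.

Lemma cV_cons_head n (s : R) (y : 'cV[R]_n) (j : 'I_1) : cV_cons (s, y) (lshift n j) 0%R = s.
Proof. by apply: etrans (col_mxEu _ _ _ _) _; rewrite mxE (ord1 j). Qed.

Lemma cV_cons_tail n (s : R) (y : 'cV[R]_n) j : cV_cons (s, y) (rshift 1 j) 0%R = y j 0%R.
Proof. exact: col_mxEd. Qed.

Lemma forall_cV_cons n (s : R) (y : 'cV[R]_n) (P : R -> bool) :
  (forall i, P (cV_cons (s, y) i 0%R)) <-> P s /\ forall i, P (y i 0%R).
Proof.
split=> [H|[Ps H] i]; last first.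
  have [j ->|j ->] := split_ordP (i : 'I_(1 + n)).
    by rewrite cV_cons_head.
  by rewrite cV_cons_tail.
split=> [|i]; first by rewrite -(cV_cons_head s y ord0).
by rewrite -(cV_cons_tail s y).
Qed.

Lemma norm_le_itv (N : R) :
  [set t : measurableTypeR R | (`|t| <= N)%R] = `[(- N)%R, N]%classic.
Proof. by apply/seteqP; split => t /=; rewrite in_itv/= ler_norml. Qed.

Lemma norm_lt_itv (N : R) :
  [set t : measurableTypeR R | (`|t| < N)%R] = `](- N)%R, N[%classic.
Proof. by apply/seteqP; split => t /=; rewrite in_itv/= ltr_norml. Qed.

Lemma measurable_norm_le (N : R) : measurable [set t : measurableTypeR R | (`|t| <= N)%R].
Proof. by rewrite norm_le_itv. Qed.

Lemma measurable_norm_lt (N : R) : measurable [set t : measurableTypeR R | (`|t| < N)%R].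
Proof. by rewrite norm_lt_itv. Qed.

Lemma measurable_box n N : measurable (box n N).
Proof. exact: (@measurable_coords n _ (measurable_norm_le N)). Qed.

Lemma measurable_open_box n N : measurable (open_box n N).
Proof. exact: (@measurable_coords n _ (measurable_norm_lt N)). Qed.

Lemma cV_cons_prod n (P : R -> bool) :
  cV_cons (n := n) @^-1` [set x | forall i, P (x i 0%R)] =
  [set t : measurableTypeR R | P t] `*` [set x : 'cV[R]_n | forall i, P (x i 0%R)].
Proof. by apply/seteqP; split => -[s y] /=; rewrite forall_cV_cons. Qed.

Lemma lebesgue_cV_box_lty n N : lebesgue_cV n (box n N) < +oo.
Proof.
elim: n => [|n IH] /=.
  by rewrite diracE ltry.
rewrite /lebesgue_cV_succ /pushforward.
rewrite (cV_cons_prod n (fun t => (`|t| <= N)%R)) product_measure2E//; last 2 first.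
- exact: measurable_norm_le.
- exact: measurable_box.
have fin : lambda [set t : measurableTypeR R | (`|t| <= N)%R] < +oo.
  by rewrite norm_le_itv lebesgue_measure_itv/=; case: ifP => // _; rewrite -EFinB ltry.
by rewrite lte_mul_pinfty ?ge0_fin_numE.
Qed.

Lemma lebesgue_cV_open_box_gt0 n e : (0 < e)%R -> 0 < lebesgue_cV n (open_box n e).
Proof.
move=> e0; elim: n => [|n IH] /=.
  by rewrite diracE mem_set//= => -[].
rewrite /lebesgue_cV_succ /pushforward.
rewrite (cV_cons_prod n (fun t => (`|t| < e)%R)) product_measure2E//; last 2 first.
- exact: measurable_norm_lt.
- exact: measurable_open_box.
apply: mule_gt0 => //.
by rewrite norm_lt_itv /= lebesgue_measure_itv/= lte_fin ifT ?lte_fin; lra.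
Qed.

(* A copy of lebesgue_cV carrying the sigma-finiteness instance needed by the  *)
(* Fubini-Tonelli theorem.                                                     *)
Definition leb n : set 'cV[R]_n -> \bar R := lebesgue_cV n.

HB.instance Definition _ n := Measure.copy (@leb n) (lebesgue_cV n).

Lemma leb_sigma_finite n : sigma_finite setT (@leb n).
Proof.
exists (fun N => box n N%:R).
  apply/seteqP; split => // x _; have [N /= xN] : exists N : nat, (`|x| <= N%:R)%R.
    by exists (Num.truncn `|x|).+1; rewrite ltW// truncnS_gt.
  by exists N => // i /=; apply: le_trans (coord_le_norm _ _ _) xN.
by move=> N; split; [exact: measurable_box|exact: lebesgue_cV_box_lty].
Qed.

HB.instance Definition _ n := Measure_isSigmaFinite.Build _ _ _ (@leb n)
  (@leb_sigma_finite n).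

Definition cV_slice n (A : set 'cV[R]_n.+1) (s : R) : set 'cV[R]_n :=
  [set y | A (cV_cons (s, y))].

Lemma cV_sliceE n (A : set 'cV[R]_n.+1) s :
  cV_slice A s = xsection (cV_cons (n := n) @^-1` A) (s : measurableTypeR R).
Proof. by apply/seteqP; split => y; rewrite /xsection /= inE. Qed.

Lemma measurable_preimage_cons n (A : set 'cV[R]_n.+1) :
  measurable A -> measurable (cV_cons (n := n) @^-1` A).
Proof. by move=> mA; rewrite -[X in measurable X]setTI; exact: measurable_cV_cons. Qed.

Lemma measurable_slice n (A : set 'cV[R]_n.+1) s :
  measurable A -> measurable (cV_slice A s).
Proof.
by move=> mA; rewrite cV_sliceE; apply: measurable_xsection; exact: measurable_preimage_cons.
Qed.

Lemma measurable_leb_slice n (A : set 'cV[R]_n.+1) : measurable A ->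
  measurable_fun [set: measurableTypeR R] (fun s : measurableTypeR R => leb (cV_slice A s)).
Proof.
move=> mA; rewrite (_ : (fun _ => _) = leb (n := n) \o xsection (cV_cons (n := n) @^-1` A)).
  by apply: measurable_fun_xsection; exact: measurable_preimage_cons.
by apply/funext => s; rewrite cV_sliceE.
Qed.

Lemma leb_slice n (A : set 'cV[R]_n.+1) : measurable A ->
  leb A = \int[lambda]_s leb (cV_slice A s).
Proof.
move=> mA; rewrite {1}/leb /= /lebesgue_cV_succ /pushforward.
(* [\x^] integrates over the tail the measures of sections in the first coordinate; uniqueness of
   the product measure exchanges the two roles. *)
transitivity ((lambda \x @leb n) (cV_cons (n := n) @^-1` A)).
  apply/esym.
  apply: (@product_measure_unique _ _ _ _ _ lambda (@leb n) (lambda \x^ @leb n)%E) => //.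
    by move=> X Y mX mY; exact: product_measure2E.
  exact: measurable_preimage_cons.
by apply: eq_integral => s _ /=; rewrite cV_sliceE.
Qed.

End lebesgue_cV_theory.
Arguments box {R} n N.
Arguments open_box {R} n e.

Section lebesgue_affine.
Context {R : realType}.
Local Notation lambda := (@lebesgue_measure R).

Let affine (a b : R) : measurableTypeR R -> measurableTypeR R := fun x => a * x + b.

Let measurable_affine a b : measurable_fun setT (affine a b).
Proof. by apply: measurable_funD => //; apply: measurable_funM. Qed.

(** The image measure multiplied by a agrees with [lambda] on half-open intervals, hence
    everywhere. *)
Lemma lebesgue_measure_affine (a b : R) (A : set (measurableTypeR R)) : 0 < a ->
  measurable A -> lambda (affine a b @^-1` A) = (a^-1%:E * lambda A)%E.
Proof.
move=> a0 mA.
have aP : 0 <= a by exact: ltW.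
pose m : {measure set (measurableTypeR R) -> \bar R} :=
  mscale (NngNum aP) (pushforward lambda (affine a b)).
have -> : lambda A = m (measurable_affine a b) A.
  apply: lebesgue_measure_unique => // _ [[x y] _ <-].
  rewrite /m /= /mscale /= /pushforward /=.
  rewrite (_ : affine a b @^-1` _ = `](x - b) / a, (y - b) / a]%classic); last first.
    apply/seteqP; split => t /=; rewrite !in_itv/= /affine;
      by rewrite ltr_pdivrMr// ler_pdivlMr// ltrBlDr lerBrDr mulrC.
  rewrite !lebesgue_measure_itv/= !lte_fin ltr_pM2r ?invr_gt0// ltrD2r.
  case: ifP => _; last by rewrite mule0.
  rewrite -!EFinB -EFinM; congr (_%:E); rewrite -mulrBl mulrC mulfVK ?gt_eqF//.
  by rewrite opprB addrA subrK.
rewrite /m /= /mscale /= /pushforward muleA -EFinM mulVf ?gt_eqF// mul1e.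
by [].
Qed.

Lemma lebesgue_integral_shift (f : measurableTypeR R -> \bar R) (b : R) :
  measurable_fun setT f -> (forall s, (0 <= f s)%E) ->
  (\int[lambda]_s f (s + b)%R = \int[lambda]_s f s)%E.
Proof.
move=> mf f0.
have := @ge0_integral_pushforward _ _ _ _ R _ (measurable_affine 1 b) lambda setT f
  measurableT mf (fun x _ => f0 x).
rewrite preimage_setT => E.
transitivity (\int[lambda]_(x in setT) (f \o affine 1 b) x)%E.
  by apply: eq_integral => x _; rewrite /= /affine mul1r.
rewrite -E; apply: eq_measure_integral => A mA _.
have := lebesgue_measure_affine b ltr01 mA.
by rewrite invr1 mul1e.
Qed.

End lebesgue_affine.

(** * Open sets, translations and orthogonal maps *)

Section lebesgue_cV_invariance.
Context {R : realType}.
Local Open Scope ereal_scope.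

(** The sigma-algebra is generated by the coordinates, so U is written as the countable union of the
    rational cubes that it contains. *)
Lemma cV_open_measurable n (U : set 'cV[R]_n) : open U -> measurable U.
Proof.
move=> oU.
pose B (q : 'cV[rat]_n * nat) : set 'cV[R]_n :=
  [set y | forall i, (`|y i 0%R - ratr (q.1 i 0%R)| < q.2.+1%:R^-1)%R].
have mB q : measurable (B q).
  rewrite (_ : B q = \bigcap_(i in [set: 'I_n]) (cV_coord i @^-1`
     [set t : measurableTypeR R | (`|t - ratr (q.1 i 0%R)| < q.2.+1%:R^-1)%R])).
    apply: fin_bigcap_measurable; first exact: finite_finset.
    move=> i _; rewrite -[X in measurable X]setTI; apply: measurable_cV_coord => //.
    rewrite (_ : mkset _ = ball (ratr (q.1 i 0%R) : R) q.2.+1%:R^-1).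
      exact: measurable_ball.
    by apply/seteqP; split => t; rewrite -ball_normE /= distrC.
  by apply/seteqP; split => x /= H i => [_|]; exact: H.
rewrite (_ : U = \bigcup_q (if `[< B q `<=` U >] then B q else set0)).
  apply: countable_bigcupT_measurable => [|q]; first exact: countableP.
  by case: ifP.
apply/seteqP; split => [x Ux|x [q _]]; last by case: asboolP => // qU /qU.
have /nbhs_ballP[e /= e0 eU] : nbhs x U by exact: open_nbhs_nbhs.
have [k ke] : exists k : nat, (k.+1%:R^-1 < e / 2)%R.
  exists (Num.truncn (2 / e)); rewrite -[ltRHS]invrK ltf_pV2 ?posrE ?invr_gt0 ?divr_gt0//.
  by rewrite invf_div truncnS_gt.
have : (0 < (k.+1%:R^-1 : R))%R by rewrite invr_gt0.
rewrite /B; set d : R := (k.+1%:R^-1)%R in ke * => d0.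
have /choice[q qx] : forall i, exists q : rat, (`|x i 0%R - ratr q| < d)%R.
  move=> i; have : (x i 0 - d < x i 0 + d)%R by lra.
  move=> /rat_in_itvoo[q]; rewrite in_itv/= => /andP[q1 q2]; exists q.
  by rewrite ltr_norml; apply/andP; split; lra.
exists (\col_i q i, k) => //; rewrite asboolT => [i|y yB]; first by rewrite mxE; exact: qx.
apply: eU; rewrite -ball_normE /=.
apply: (@le_lt_trans _ _ (d + d)%R); last by lra.
apply: norm_le_coord => [|i j]; first by lra.
rewrite ord1 !mxE; have := yB i; rewrite /= mxE => H.
have := qx i; move: H; rewrite -/d !ltr_norml ler_norml => /andP[? ?] /andP[? ?].
by apply/andP; split; lra.
Qed.

Lemma measurable_addcV n (v : 'cV[R]_n) : measurable_fun setT (fun x : 'cV[R]_n => (x + v)%R).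
Proof.
apply: measurable_fun_cV => i.
rewrite (_ : _ \o _ = fun x => (cV_coord i x + v i 0)%R).
  by apply: measurable_funD => //; exact: measurable_cV_coord.
by apply/funext => x; rewrite /= /cV_coord mxE.
Qed.

Lemma measurable_mulmxcV n (M : 'M[R]_n) : measurable_fun setT (fun x : 'cV[R]_n => M *m x).
Proof.
apply: measurable_fun_cV => i.
rewrite (_ : _ \o _ = fun x => \sum_(j < n) (M i j * cV_coord j x)%R)%R.
  apply: measurable_sum => j; apply: measurable_funM => //; exact: measurable_cV_coord.
by apply/funext => x; rewrite /= /cV_coord mxE.
Qed.

Lemma measurable_addcV2 n :
  measurable_fun setT (fun z : 'cV[R]_n * 'cV[R]_n => (z.1 + z.2)%R).
Proof.
apply: measurable_fun_cV => i.
rewrite (_ : _ \o _ = ((@cV_coord R n i \o fst) \+ (@cV_coord R n i \o snd))%R).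
  by apply: measurable_funD; apply: measurableT_comp => //; exact: measurable_cV_coord.
by apply/funext => x; rewrite /= /cV_coord mxE.
Qed.

Lemma measurable_preimageT d d' (T : measurableType d) (T' : measurableType d')
    (f : T -> T') A : measurable_fun setT f -> measurable A -> measurable (f @^-1` A).
Proof. by move=> mf mA; rewrite -[X in measurable X]setTI; exact: mf. Qed.

Lemma leb_translation n (A : set 'cV[R]_n) (v : 'cV[R]_n) : measurable A ->
  leb [set x | A (x + v)%R] = leb A.
Proof.
elim: n A v => [|n IH] A v mA.
  by congr (leb _); apply/seteqP; split => x; rewrite /= (_ : (x + v)%R = x)//;
    apply/matrixP => -[].
have mAv : measurable [set x | A (x + v)%R].
  by apply: (measurable_preimageT (measurable_addcV v)).
rewrite !leb_slice//.
pose v0 : R := v (lshift n (0%R : 'I_1)) 0%R.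
pose v1 : 'cV[R]_n := dsubmx (v : 'cV[R]_(1 + n)).
have consD s y : (cV_cons (s, y) + v)%R = cV_cons ((s + v0)%R, (y + v1)%R).
  apply/matrixP => i j; rewrite ord1 mxE.
  have [k ->|k ->] := split_ordP (i : 'I_(1 + n)).
    by rewrite !cV_cons_head (ord1 k).
  by rewrite !cV_cons_tail !mxE.
rewrite -(lebesgue_integral_shift v0 (measurable_leb_slice mA))//.
apply: eq_integral => s _; rewrite -(IH (cV_slice A (s + v0)%R) v1); last exact: measurable_slice.
by congr (leb _); apply/seteqP; split => y; rewrite /cV_slice /= consD.
Qed.

Lemma leb_open_gt0 n (U : set 'cV[R]_n) : open U -> U !=set0 -> 0 < leb U.
Proof.
move=> oU [x Ux]; have /nbhs_ballP[e /= e0 eU] : nbhs x U by exact: open_nbhs_nbhs.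
have e20 : (0 < e / 2)%R by rewrite divr_gt0.
apply: lt_le_trans (lebesgue_cV_open_box_gt0 n e20) _.
have mB := @measurable_open_box R n (e / 2).
rewrite -[X in X <= _]/(leb _) -(leb_translation (- x)%R mB).
apply: le_measure; rewrite ?inE.
- exact: (measurable_preimageT (measurable_addcV _)).
- exact: cV_open_measurable.
- move=> y /= yx; apply: eU; rewrite -ball_normE /= distrC.
  apply: (@le_lt_trans _ _ (e / 2)%R); last by lra.
  apply: norm_le_coord => [|i j]; first by lra.
  by rewrite ord1 ltW// (yx i).
Qed.

Lemma measurable_closed_eball n (r : R) : measurable (closed_eball 0 r : set 'cV[R]_n).
Proof.
rewrite (_ : closed_eball 0 r = (@enorm R n) @^-1` `]-oo, r]).
  by apply: (measurable_preimageT (@measurable_enorm R n)).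
by apply/seteqP; split => x /=; rewrite /closed_eball /= subr0 in_itv.
Qed.

Lemma leb_bounded_lty n (A : set 'cV[R]_n) (N : R) : measurable A ->
  (forall x, A x -> enorm x <= N)%R -> leb A < +oo.
Proof.
move=> mA AN; apply: le_lt_trans (lebesgue_cV_box_lty n N).
rewrite -[leRHS]/(leb _); apply: le_measure; rewrite ?inE//; first exact: measurable_box.
by move=> x /AN xN i; apply: le_trans xN; exact: coord_le_enorm.
Qed.

Section orthogonal.
Context {n : nat} (rho : 'M[R]_n).
Hypothesis rhoK : rho^T *m rho = 1%:M.

Let f (x : 'cV[R]_n) := rho *m x.

Let mf : measurable_fun setT f. Proof. exact: measurable_mulmxcV. Qed.

Definition leb_image (A : set 'cV[R]_n) : \bar R := pushforward (@leb R n) f A.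

Local Notation nu := leb_image.

Let nu0 : nu set0 = 0. Proof. exact: measure0. Qed.

Let nu_ge0 A : 0 <= nu A. Proof. exact: measure_ge0. Qed.

Let nu_sigma_additive : semi_sigma_additive nu.
Proof. exact: measure_semi_sigma_additive. Qed.

HB.instance Definition _ := isMeasure.Build _ _ _ nu nu0 nu_ge0 nu_sigma_additive.

Let nu_ball r : nu (closed_eball 0 r) = leb (closed_eball (0 : 'cV[R]_n) r).
Proof.
rewrite /leb_image /pushforward; congr (leb _); apply/seteqP.
by split => x; rewrite /closed_eball /= !subr0 enorm_orthogonal.
Qed.

Let leb_ball_lty r : leb (closed_eball (0 : 'cV[R]_n) r) < +oo.
Proof.
apply: (@leb_bounded_lty _ _ r); first exact: measurable_closed_eball.
by move=> x; rewrite /closed_eball /= subr0.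
Qed.

Let nu_sigma_finite : sigma_finite setT nu.
Proof.
exists (fun N => closed_eball 0 N%:R) => [|N].
  apply/seteqP; split => // x _; exists (Num.truncn (enorm x)).+1 => //.
  by rewrite /closed_eball /= subr0 ltW// truncnS_gt.
by split; [exact: measurable_closed_eball|rewrite nu_ball].
Qed.

HB.instance Definition _ := Measure_isSigmaFinite.Build _ _ _ nu nu_sigma_finite.

Let nu_translation (A : set 'cV[R]_n) (v : 'cV[R]_n) : measurable A -> nu [set x | A (x + v)%R] = nu A.
Proof.
move=> mA; rewrite /leb_image /pushforward.
rewrite -(leb_translation (rho^T *m v) (measurable_preimageT mf mA)).
congr (leb _); apply/seteqP; split => x; rewrite /= /f mulmxDr mulmxA;
  by rewrite (mulmx1C rhoK) mul1mx.
Qed.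

(* Both sides are Haar measures: compare them by computing the measure of      *)
(* {(x, y) | x + y \in A, y \in B} and of {(x, z) | z \in A, z - x \in B} for  *)
(* the symmetric, rotation invariant unit ball B.                              *)
Lemma leb_orthogonal (A : set 'cV[R]_n) : measurable A -> leb [set x | A (rho *m x)] = leb A.
Proof.
move=> mA; rewrite -[LHS]/(nu A).
set B : set 'cV[R]_n := closed_eball 0 1.
have mB : measurable B by exact: measurable_closed_eball.
have symB x : B (- x)%R = B x by rewrite /B /closed_eball /= !subr0 enormN.
pose S : set ('cV[R]_n * 'cV[R]_n) := [set z | A (z.1 + z.2)%R /\ B z.2].
pose S' : set ('cV[R]_n * 'cV[R]_n) := [set z | A z.2 /\ B (z.1 - z.2)%R].
have mS : measurable S.
  apply: measurableI; first exact: (measurable_preimageT (@measurable_addcV2 n)).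
  exact: measurable_preimageT measurable_snd mB.
have mS' : measurable S'.
  apply: measurableI; first exact: measurable_preimageT measurable_snd mA.
  apply: (measurable_preimageT (f := fun z : 'cV[R]_n * 'cV[R]_n => (z.1 - z.2)%R)) => //.
  apply: measurable_fun_cV => i.
  rewrite (_ : _ \o _ = ((@cV_coord R n i \o fst) \- (@cV_coord R n i \o snd))%R).
    by apply: measurable_funB; apply: measurableT_comp => //; exact: measurable_cV_coord.
  by apply/funext => x; rewrite /= /cV_coord !mxE.
have I1 : \int[nu]_y leb (ysection S y) = leb A * nu B.
  transitivity (\int[nu]_y (leb A * (\1_B y)%:E)).
    apply: eq_integral => y _; rewrite indicE.
    have [yB|yB] := boolP (y \in B).
      rewrite mule1 -(leb_translation y mA); congr (leb _); apply/seteqP.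
      by split => x; rewrite /ysection /= !inE /S /=; move: yB; rewrite inE; tauto.
    rewrite mule0 -[RHS](measure0 (@leb R n)); congr (leb _).
    apply/seteqP; split => // x.
    by rewrite /ysection /= inE => -[_]; move: yB; rewrite notin_setE.
  rewrite ge0_integralZl ?integral_indic ?setIT//.
  by apply/measurable_EFinP; exact: measurable_indic.
have I2 : \int[nu]_y leb (ysection S' y) = leb B * nu A.
  transitivity (\int[nu]_y (leb B * (\1_A y)%:E)).
    apply: eq_integral => y _; rewrite indicE.
    have [yA|yA] := boolP (y \in A).
      rewrite mule1 -(leb_translation (- y)%R mB); congr (leb _); apply/seteqP.
      by split => x; rewrite /ysection /= !inE /S' /=; move: yA; rewrite inE; tauto.
    rewrite mule0 -[RHS](measure0 (@leb R n)); congr (leb _).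
    apply/seteqP; split => // x.
    by rewrite /ysection /= inE => -[]; move: yA; rewrite notin_setE.
  rewrite ge0_integralZl ?integral_indic ?setIT//.
  by apply/measurable_EFinP; exact: measurable_indic.
have B0 : 0 < leb B.
  apply: lt_le_trans (leb_open_gt0 (U := ball 0%R (n.+1%:R^-1)) _ _) _.
  - exact: ball_open.
  - by exists 0%R; apply: ballxx; rewrite invr_gt0.
  - apply: le_measure; [|by rewrite inE|].
      rewrite inE; apply: cV_open_measurable; exact: ball_open.
    move=> x; rewrite -ball_normE /= sub0r normrN /B /closed_eball /= subr0 => xn.
    have {}xn : (n.+1%:R * `|x| < 1)%R by rewrite mulrC -ltr_pdivlMr// mul1r.
    apply: le_trans (enorm_le_norm _) _; apply: le_trans (ltW xn).
    by rewrite ler_wpM2r// ler_nat.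
have E1 := indic_fubini_tonelli (@leb R n) nu mS.
have E2 := indic_fubini_tonelli (@leb R n) nu mS'.
rewrite indic_fubini_tonelli_FE// indic_fubini_tonelli_GE// in E1.
rewrite indic_fubini_tonelli_FE// indic_fubini_tonelli_GE// in E2.
have E : \int[nu]_y leb (ysection S y) = \int[nu]_y leb (ysection S' y).
  rewrite -[LHS]E1 -[RHS]E2; apply: eq_integral => x _ /=.
  rewrite -(nu_translation x (measurable_xsection x mS')); congr (nu _).
  apply/seteqP; split => y; rewrite /xsection/= !inE /S /S' /=.
    by rewrite opprD addrCA subrr addr0 addrC symB.
  by rewrite opprD addrCA subrr addr0 addrC symB.
move: E; rewrite I1 I2 nu_ball => E.
have fB : leb B \is a fin_num by rewrite ge0_fin_numE ?leb_ball_lty.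
have {}E : leb B * nu A = leb B * leb A by rewrite -E muleC.
by apply/eqP; rewrite eq_le; apply/andP; split; rewrite -(lee_pmul2l fB B0) E.
Qed.

End orthogonal.

End lebesgue_cV_invariance.

(** * The Brunn-Minkowski inequality *)

Section layer_cake.
Context d (T : measurableType d) (R : realType).
Variable mu : {sigma_finite_measure set T -> \bar R}.
Local Open Scope ereal_scope.
Local Notation lambda := (@lebesgue_measure R).

Lemma measurable_subgraph (f : T -> \bar R) : measurable_fun setT f ->
  measurable [set z : T * measurableTypeR R | (z.2 : R)%:E < f z.1].
Proof.
move=> mf; rewrite (_ : mkset _ =
    (fun z : T * measurableTypeR R => f z.1 - (z.2 : R)%:E) @^-1` `]0, +oo[).
  apply: measurable_preimageT; last exact: emeasurable_itv.
  by apply: (emeasurable_funB (f := f \o fst) (g := fun z => (z.2 : R)%:E));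
    [exact: measurableT_comp|apply/measurable_EFinP; exact: measurable_snd].
by apply/seteqP; split => z /=; rewrite in_itv/= andbT EFinN lteBrDr ?add0e.
Qed.

Lemma measurable_tail (f : T -> \bar R) : measurable_fun setT f ->
  measurable_fun [set: measurableTypeR R] (fun t : measurableTypeR R => mu [set x | t%:E < f x]).
Proof.
move=> /measurable_subgraph mS; have := measurable_fun_ysection mu mS.
congr (measurable_fun _ _); apply/funext => t /=; congr (mu _).
by apply/seteqP; split => x; rewrite /ysection /= inE.
Qed.

(** Tonelli for the region 0 <= t < f(x): its sections at fixed x have length f(x), those at fixed t
    are superlevel sets. *)
Lemma layer_cake (f : T -> \bar R) : measurable_fun setT f -> (forall x, 0 <= f x) ->
  \int[mu]_x f x = \int[lambda]_(t in `[0%R, +oo[) mu [set x | t%:E < f x].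
Proof.
move=> mf f0.
pose S := [set z : T * measurableTypeR R | (z.2 : R)%:E < f z.1]
  `&` (snd @^-1` (`[0%R, +oo[%classic : set (measurableTypeR R))).
have mS : measurable S.
  apply: measurableI; first exact: measurable_subgraph.
  by apply: measurable_preimageT => //; exact: measurable_snd.
have := indic_fubini_tonelli mu lambda mS.
rewrite indic_fubini_tonelli_FE// indic_fubini_tonelli_GE// => E.
transitivity (\int[mu]_x lambda (xsection S x)).
  apply: eq_integral => x _.
  have -> : xsection S x = [set t : R | (0 <= t)%R /\ t%:E < f x].
    apply/seteqP; split => t; rewrite /xsection /= inE /S /= in_itv /= andbT;
      tauto.
  move: (f0 x); case: (f x) => [r| |]//.
    rewrite lee_fin => r0; rewrite (_ : mkset _ = `[0%R, r[%classic).
      by rewrite lebesgue_measure_itv/= lte_fin; case: ltgtP r0 => //= [_|<-];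
        rewrite ?oppr0 ?adde0 ?sube0.
    by apply/seteqP; split => t /=; rewrite in_itv/= lte_fin => /andP.
  move=> _; rewrite (_ : mkset _ = `[0%R, +oo[%classic).
    by rewrite lebesgue_measure_itv/= ltry.
  by apply/seteqP; split => t /=; rewrite in_itv/= andbT ltry; [case|].
rewrite [LHS]E [RHS]integral_mkcond; apply: eq_integral => t _.
rewrite patchE /=; case: ifPn => [|] t0.
  congr (mu _); apply/seteqP; split => x; rewrite /ysection /= inE /S /=;
    by [case|split => //; rewrite inE in t0].
rewrite -[RHS](measure0 mu); congr (mu _); apply/seteqP; split => x //.
by rewrite /ysection /= inE /S => -[_] /=; rewrite notin_setE in t0.
Qed.

End layer_cake.

Section brunn_minkowski.
Context {R : realType}.
Local Open Scope ereal_scope.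
Local Notation lambda := (@lebesgue_measure R).

Let compact_max (K : set R) : compact K -> K !=set0 ->
  exists2 a, K a & forall x, K x -> (x <= a)%R.
Proof.
move=> cK K0; have [|a aK amax] := compact_EVT_max (f := id) K0 cK.
  by apply: continuous_subspaceT => x; exact: cvg_id.
by rewrite inE in aK; exists a => // x Kx; apply: amax; rewrite inE.
Qed.

Let compact_min (K : set R) : compact K -> K !=set0 ->
  exists2 a, K a & forall x, K x -> (a <= x)%R.
Proof.
move=> cK K0; have [|a aK amax] := compact_EVT_min (f := id) K0 cK.
  by apply: continuous_subspaceT => x; exact: cvg_id.
by rewrite inE in aK; exists a => // x Kx; apply: amax; rewrite inE.
Qed.

(* With a = max K and b = min L, the sets l K + (1 - l) b and l a + (1 - l) L  *)
(* only meet in one point.                                                     *)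
Let brunn_minkowski_compact (l : R) (K L C : set R) : (0 < l < 1)%R ->
  compact K -> compact L -> K !=set0 -> L !=set0 -> measurable (C : set (measurableTypeR R)) ->
  (forall x y, K x -> L y -> C (l * x + (1 - l) * y)%R) ->
  l%:E * lambda K + (1 - l)%:E * lambda L <= lambda C.
Proof.
move=> /andP[l0 l1] cK cL K0 L0 mC KLC.
have [a Ka aK] := compact_max cK K0; have [b Lb bL] := compact_min cL L0.
have l'0 : (0 < 1 - l)%R by rewrite subr_gt0.
pose c := (l * a + (1 - l) * b)%R.
(* [C1] is l K + (1 - l) b and [C2] is l a + (1 - l) L, written as preimages so that
   [lebesgue_measure_affine] applies. *)
pose C1 := (fun x : R => l^-1 * x - (1 - l) * b / l)%R @^-1` K.
pose C2 := (fun x : R => (1 - l)^-1 * x - l * a / (1 - l))%R @^-1` L.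
have mK := compact_measurable cK; have mL := compact_measurable cL.
have li0 : (0 < l^-1)%R by rewrite invr_gt0.
have l'i0 : (0 < (1 - l)^-1)%R by rewrite invr_gt0.
have E1 : lambda C1 = l%:E * lambda K.
  by have := lebesgue_measure_affine (- ((1 - l) * b / l))%R li0 mK; rewrite invrK.
have E2 : lambda C2 = (1 - l)%:E * lambda L.
  by have := lebesgue_measure_affine (- (l * a / (1 - l)))%R l'i0 mL; rewrite invrK.
have mC1 : measurable (C1 : set (measurableTypeR R)).
  apply: measurable_preimageT mK.
  by apply: measurable_funD => //; apply: measurable_funM.
have mC2 : measurable (C2 : set (measurableTypeR R)).
  apply: measurable_preimageT mL.
  by apply: measurable_funD => //; apply: measurable_funM.
have C1C : C1 `<=` C.
  move=> x C1x; have := KLC _ _ C1x Lb; congr C.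
  by field; rewrite gt_eqF.
have C2C : C2 `<=` C.
  move=> x C2x; have := KLC _ _ Ka C2x; congr C.
  by field; rewrite gt_eqF.
have C1c x : C1 x -> (x <= c)%R.
  move=> /aK; rewrite -(ler_pM2l l0) mulrBr mulrA mulfV ?gt_eqF// mul1r /c.
  by rewrite (mulrC l (_ / l)%R) mulfVK ?gt_eqF// => H; lra.
have C2c x : C2 x -> (c <= x)%R.
  move=> /bL; rewrite -(ler_pM2l l'0) mulrBr mulrA mulfV ?gt_eqF// mul1r /c.
  by rewrite (mulrC (1 - l)%R (_ / _)%R) mulfVK ?gt_eqF// => H; lra.
have mC1' : measurable (C1 `\ c : set (measurableTypeR R)).
  by apply: measurableD.
(* Removing the common point c makes the pieces disjoint at no cost in measure. *)
have leC1 : lambda C1 <= lambda (C1 `\ c).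
  apply: (@le_trans _ _ (lambda ((C1 `\ c) `|` [set c]))).
    apply: le_measure; rewrite ?inE//; first exact: measurableU.
    by move=> x C1x; have [->|/eqP xc] := eqVneq x c; [right|left].
  apply: le_trans (measureU2 _ _ _) _ => //.
  by rewrite [X in _ + X]lebesgue_measure_set1 adde0.
rewrite -E1 -E2; apply: (@le_trans _ _ (lambda (C1 `\ c) + lambda C2)).
  exact: leeD2r.
rewrite -measureU//; last first.
  apply/seteqP; split => // x [[C1x xc] C2x]; apply: xc => /=.
  by apply/eqP; rewrite eq_le C1c ?C2c.
apply: le_measure; rewrite ?inE//; first exact: measurableU.
by move=> x [[/C1C]|/C2C].
Qed.

(** Inner regularity reduces to compact subsets; adjoining the fixed points a and b keeps the
    approximating compact sets nonempty. *)
Let brunn_minkowski1 (l : R) (A B C : set (measurableTypeR R)) : (0 < l < 1)%R ->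
  measurable A -> measurable B -> measurable C -> A !=set0 -> B !=set0 ->
  (forall x y, A x -> B y -> C (l * x + (1 - l) * y)%R) ->
  l%:E * lambda A + (1 - l)%:E * lambda B <= lambda C.
Proof.
move=> l01 mA mB mC [a Aa] [b Bb] ABC.
have /andP[l0 l1] := l01; have l'0 : (0 < 1 - l)%R by rewrite subr_gt0.
have [->|Cfin] := eqVneq (lambda C) +oo; first exact: leey.
have {}Cfin : lambda C < +oo by rewrite ltey.
have H (K L : set R) : compact K -> compact L -> K `<=` A -> L `<=` B ->
    l%:E * lambda K + (1 - l)%:E * lambda L <= lambda C.
  move=> cK cL KA LB.
  have cK' : compact (K `|` [set a]) by apply: compactU => //; exact: compact_set1.
  have cL' : compact (L `|` [set b]) by apply: compactU => //; exact: compact_set1.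
  apply: (@le_trans _ _ (l%:E * lambda (K `|` [set a]) + (1 - l)%:E * lambda (L `|` [set b]))).
    have leU (X Y : set R) : compact X -> compact (X `|` Y) -> lambda X <= lambda (X `|` Y).
      move=> cX cXY; apply: le_measure; [| |exact: subsetUl];
        by rewrite inE; exact: compact_measurable.
    by apply: leeD; rewrite lee_pmul2l ?lte_fin//; exact: leU.
  apply: brunn_minkowski_compact => //; [by exists a; right|by exists b; right|].
  by move=> x y [/KA Ax|->] [/LB By|->]; exact: ABC.
have HA (L : set R) : compact L -> L `<=` B ->
    l%:E * lambda A + (1 - l)%:E * lambda L <= lambda C.
  move=> cL LB.
  have Lfin : (1 - l)%:E * lambda L \is a fin_num.
    by rewrite fin_numM// ge0_fin_numE//; exact: compact_finite_measure.
  rewrite -leeBrDr// muleC -lee_pdivlMr// lebesgue_regularity_inner_sup//.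
  apply: ge_ereal_sup => _ [K [cK KA] <-].
  by rewrite lee_pdivlMr// muleC leeBrDr//; exact: H.
(* The bound [HA] with L empty makes this term finite, so that it can be subtracted. *)
have Afin : l%:E * lambda A \is a fin_num.
  rewrite ge0_fin_numE; last by rewrite mule_ge0// lee_fin ltW.
  apply: le_lt_trans Cfin; have := HA set0 compact0 (@sub0set _ _).
  by rewrite [lambda set0]measure0 mule0 adde0.
rewrite addeC -leeBrDr// muleC -lee_pdivlMr// (lebesgue_regularity_inner_sup mB).
apply: ge_ereal_sup => _ [L [cL LB] <-].
by rewrite lee_pdivlMr// muleC leeBrDr// addeC; exact: HA.
Qed.

(* When sup f = sup g = 1 the superlevel sets {f > t} and {g > t} are nonempty *)
(* for exactly the same t >= 0, so brunn_minkowski1 applies to them.           *)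
Let prekopa_leindler_normalized (l : R) (f g : measurableTypeR R -> R)
    (h : measurableTypeR R -> \bar R) : (0 < l < 1)%R ->
  measurable_fun setT f -> measurable_fun setT g -> measurable_fun setT h ->
  (forall s, 0 <= f s <= 1)%R -> (forall s, 0 <= g s <= 1)%R -> (forall s, 0 <= h s) ->
  (forall t, (t < 1)%R -> exists s, (t < f s)%R) ->
  (forall t, (t < 1)%R -> exists s, (t < g s)%R) ->
  (forall s t, (Num.min (f s) (g t))%:E <= h (l * s + (1 - l) * t)%R) ->
  l%:E * \int[lambda]_s (f s)%:E + (1 - l)%:E * \int[lambda]_s (g s)%:E
    <= \int[lambda]_s h s.
Proof.
move=> l01 mf mg mh f01 g01 h0 f1 g1 fgh.
have /andP[l0 l1] := l01; have l'0 : (0 < 1 - l)%R by rewrite subr_gt0.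
have mf' : measurable_fun setT (EFin \o f) by exact/measurable_EFinP.
have mg' : measurable_fun setT (EFin \o g) by exact/measurable_EFinP.
have level (w : measurableTypeR R -> \bar R) t : measurable_fun setT w ->
    measurable [set s | t%:E < w s].
  move=> mw; rewrite (_ : mkset _ = w @^-1` `]t%:E, +oo[%classic).
    by apply: measurable_preimageT mw _; exact: emeasurable_itv.
  by apply/seteqP; split => s /=; rewrite in_itv/= andbT.
rewrite (layer_cake lambda mf') ?(layer_cake lambda mg') ?(layer_cake lambda mh)//;
  do ?[by move=> s; rewrite lee_fin; have /andP[] := f01 s
      |by move=> s; rewrite lee_fin; have /andP[] := g01 s].
have mS : measurable (`[0%R, +oo[%classic : set (measurableTypeR R)) by [].
have mtail (w : measurableTypeR R -> \bar R) : measurable_fun setT w ->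
    measurable_fun (`[0%R, +oo[%classic : set (measurableTypeR R))
      (fun t : measurableTypeR R => lambda [set s | t%:E < w s]).
  by move=> mw; apply: measurable_funS (measurable_tail lambda mw).
have tail0 (w : measurableTypeR R -> \bar R) t : 0 <= lambda [set s | t%:E < w s] by [].
rewrite -ge0_integralZl//; [|exact: mtail|by rewrite lee_fin ltW].
rewrite -ge0_integralZl//; [|exact: mtail|by rewrite lee_fin ltW].
have mZ (k : R) (w : measurableTypeR R -> \bar R) : measurable_fun setT w ->
    measurable_fun (`[0%R, +oo[%classic : set (measurableTypeR R))
      (fun t : measurableTypeR R => k%:E * lambda [set s | t%:E < w s]).
  by move=> mw; apply: measurable_funeM; exact: mtail.
have Z0 (k : R) (w : measurableTypeR R -> \bar R) t : (0 < k)%R ->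
    0 <= k%:E * lambda [set s | t%:E < w s].
  by move=> k0; rewrite mule_ge0// lee_fin ltW.
rewrite -ge0_integralD//; [|by move=> t _; exact: Z0|exact: mZ|by move=> t _; exact: Z0|exact: mZ].
apply: ge0_le_integral => //.
- by move=> t _; apply: adde_ge0; exact: Z0.
- by apply: emeasurable_funD; exact: mZ.
- exact: mtail.
move=> t /=; rewrite in_itv/= andbT => t0.
have [t1|t1] := ltP t 1%R.
  apply: brunn_minkowski1 => //; do ?exact: level.
  - by have [s ts] := f1 _ t1; exists s; rewrite /= lte_fin.
  - by have [s ts] := g1 _ t1; exists s; rewrite /= lte_fin.
  - move=> x y /=; rewrite !lte_fin => tx ty.
    by apply: lt_le_trans (fgh x y); rewrite lte_fin lt_min tx ty.
have E0 (w : measurableTypeR R -> R) : (forall s, 0 <= w s <= 1)%R ->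
    lambda [set s | t%:E < (EFin \o w) s] = 0.
  move=> w01; rewrite -[RHS](measure0 lambda); congr (lambda _).
  apply/seteqP; split => s //=; rewrite lte_fin => ts.
  by have /andP[_ w1] := w01 s; have := lt_le_trans ts (le_trans w1 t1); rewrite ltxx.
by rewrite !E0// !mule0 adde0.
Qed.

(** Young's inequality with conjugate exponents 1/l and 1/(1 - l). *)
Let weighted_amgm (l x y : R) : (0 < l < 1)%R -> (0 <= x)%R -> (0 <= y)%R ->
  (x `^ l * y `^ (1 - l) <= l * x + (1 - l) * y)%R.
Proof.
move=> /andP[l0 l1] x0 y0; have l'0 : (0 < 1 - l)%R by rewrite subr_gt0.
have := @conjugate_powR _ (x `^ l)%R (y `^ (1 - l))%R l^-1%R (1 - l)^-1%R (powR_ge0 _ _) (powR_ge0 _ _).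
rewrite !invr_gt0 !invrK -!powRrM !mulfV ?gt_eqF// !powRr1// => /(_ l0 l'0).
by rewrite subrKC => /(_ erefl); rewrite (mulrC x) (mulrC y).
Qed.

(** Dividing f and g by their suprema, and h by the corresponding weighted geometric mean, gives the
    normalized case; its additive bound becomes multiplicative by the weighted mean inequality. The
    integrals enter through real lower bounds a and b because they may be infinite. *)
Let prekopa_leindler (l M : R) (f g : measurableTypeR R -> R)
    (h : measurableTypeR R -> \bar R) : (0 < l < 1)%R ->
  measurable_fun setT f -> measurable_fun setT g -> measurable_fun setT h ->
  (forall s, 0 <= f s <= M)%R -> (forall s, 0 <= g s <= M)%R -> (forall s, 0 <= h s) ->
  (forall s t, (f s `^ l * g t `^ (1 - l))%:E <= h (l * s + (1 - l) * t)%R) ->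
  forall a b : R, (0 <= a)%R -> (0 <= b)%R ->
  a%:E <= \int[lambda]_s (f s)%:E -> b%:E <= \int[lambda]_s (g s)%:E ->
  (a `^ l * b `^ (1 - l))%:E <= \int[lambda]_s h s.
Proof.
move=> l01 mf mg mh fM gM h0 fgh a b.
have /andP[l0 l1] := l01; have l'0 : (0 < 1 - l)%R by rewrite subr_gt0.
rewrite le_eqVlt => /predU1P[<- _ _ _|a0].
  by rewrite powR0 ?gt_eqF// mul0r integral_ge0.
rewrite le_eqVlt => /predU1P[<- _ _|b0].
  by rewrite [X in (_ * X)%R]powR0 ?gt_eqF// mulr0 integral_ge0.
have sup_pos (w : measurableTypeR R -> R) (c : R) : (forall s, 0 <= w s <= M)%R ->
    (0 < c)%R -> c%:E <= \int[lambda]_s (w s)%:E ->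
    exists2 al : R, (0 < al)%R & (forall s, w s <= al)%R /\
      forall t, (t < al)%R -> exists s, (t < w s)%R.
  move=> wM c0 cw; have ub : has_sup (range w).
    by split; [exists (w 0%R), 0%R|exists M => _ [s _ <-]; have /andP[] := wM s].
  exists (sup (range w)).
    rewrite ltNge; apply/negP => s0; move: cw; apply/negP; rewrite -ltNge.
    rewrite integral0_eq ?lte_fin// => s _; congr (_%:E); apply/eqP.
    rewrite eq_le; have /andP[-> _] := wM s; rewrite andbT.
    by apply: le_trans s0; apply: ub_le_sup; [case: ub|exists s].
  split=> [s|t tal]; first by apply: ub_le_sup; [case: ub|exists s].
  by have [_ [s _ <-] ts] := sup_gt ub.1 tal; exists s.
move=> aw bw.
have [al al0 [fal fsup]] := sup_pos _ _ fM a0 aw.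
have [be be0 [gbe gsup]] := sup_pos _ _ gM b0 bw.
pose ga : R := (al `^ l * be `^ (1 - l))%R.
have ga0 : (0 < ga)%R by rewrite mulr_gt0 ?powR_gt0.
have fr0 s : (0 <= f s / al)%R.
  by rewrite divr_ge0 ?(ltW al0)//; have /andP[] := fM s.
have gr0 s : (0 <= g s / be)%R.
  by rewrite divr_ge0 ?(ltW be0)//; have /andP[] := gM s.
have := @prekopa_leindler_normalized l (fun s => f s / al)%R (fun s => g s / be)%R
  (fun s => ga^-1%:E * h s) l01.
move=> /(_ (measurable_funM mf (measurable_cst _)) (measurable_funM mg (measurable_cst _))).
move=> /(_ (measurable_funeM _ mh)).
have -> : \int[lambda]_s (ga^-1%:E * h s) = ga^-1%:E * \int[lambda]_s h s.
  by rewrite ge0_integralZl// lee_fin invr_ge0 ltW.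
have intZ (w : measurableTypeR R -> R) (k : R) : measurable_fun setT w -> (0 < k)%R ->
    (forall s, 0 <= w s <= M)%R ->
    \int[lambda]_s (w s / k)%:E = k^-1%:E * \int[lambda]_s (w s)%:E.
  move=> mw k0 wM; rewrite -ge0_integralZl//.
  - by apply: eq_integral => s _; rewrite -EFinM mulrC.
  - exact/measurable_EFinP.
  - by move=> s _; rewrite lee_fin; have /andP[] := wM s.
  - by rewrite lee_fin invr_ge0 ltW.
rewrite (intZ f)// (intZ g)// => H.
have {}H : l%:E * (al^-1%:E * \int[lambda]_s (f s)%:E) +
    (1 - l)%:E * (be^-1%:E * \int[lambda]_s (g s)%:E) <= ga^-1%:E * \int[lambda]_s h s.
  apply: H.
  - by move=> s; rewrite fr0/= ler_pdivrMr// mul1r.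
  - by move=> s; rewrite gr0/= ler_pdivrMr// mul1r.
  - by move=> s; rewrite mule_ge0// lee_fin invr_ge0 ltW.
  - move=> t t1; have [|s ts] := fsup (t * al)%R; first by rewrite gtr_pMl.
    by exists s; rewrite ltr_pdivlMr.
  - move=> t t1; have [|s ts] := gsup (t * be)%R; first by rewrite gtr_pMl.
    by exists s; rewrite ltr_pdivlMr.
  - move=> s t; rewrite lee_pdivlMl//; apply: le_trans (fgh s t).
    rewrite -EFinM lee_fin; set m := Num.min _ _.
    have m0 : (0 <= m)%R by rewrite le_min fr0 gr0.
    (* Writing m = m^l m^(1-l) distributes the minimum over the two factors. *)
    rewrite (_ : ga * m = (al * m) `^ l * (be * m) `^ (1 - l))%R; last first.
      rewrite !powRM ?(ltW al0) ?(ltW be0)// mulrACA -/ga; congr (_ * _)%R.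
      rewrite -powRD ?subrKC ?powRr1//; apply/implyP => /eqP; lra.
    apply: ler_pM; rewrite ?powR_ge0//; apply: ge0_ler_powR; rewrite ?nnegrE ?(ltW l0) ?(ltW l'0)//.
    + by rewrite mulr_ge0 ?(ltW al0).
    + by have /andP[] := fM s.
    + by rewrite -ler_pdivlMl// mulrC ge_min lexx.
    + by rewrite mulr_ge0 ?(ltW be0).
    + by have /andP[] := gM t.
    + by rewrite -ler_pdivlMl// mulrC ge_min lexx orbT.
rewrite -(lee_pmul2l (x := ga^-1%:E)) ?lte_fin ?invr_gt0//; apply: le_trans H.
apply: (@le_trans _ _ (l%:E * (al^-1%:E * a%:E) + (1 - l)%:E * (be^-1%:E * b%:E))); last first.
  by apply: leeD; do 2 rewrite lee_pmul2l ?lte_fin ?invr_gt0//.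
rewrite -!EFinM -EFinD lee_fin.
apply: le_trans (weighted_amgm l01 _ _); [|by rewrite mulr_ge0 ?invr_ge0 ?ltW..].
have powV (x r : R) : (0 < x)%R -> (x^-1 `^ r = (x `^ r)^-1)%R.
  by move=> x0; rewrite -powR_inv1 ?ltW// -powRrM mulN1r powRN.
by rewrite !powRM ?invr_ge0 ?(ltW al0) ?(ltW be0) ?(ltW a0) ?(ltW b0)// !powV// mulrACA -invfM lexx.
Qed.

Lemma cV_cons_conv n (a b s t : R) (x y : 'cV[R]_n) :
  cV_cons ((a * s + b * t)%R, (a *: x + b *: y)%R) =
  (a *: cV_cons (s, x) + b *: cV_cons (t, y))%R.
Proof.
apply/matrixP => i j; rewrite ord1 [RHS]mxE [X in _ = (X + _)%R]mxE [X in _ = (_ + X)%R]mxE.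
have [k ->|k ->] := split_ordP (i : 'I_(1 + n)).
  by rewrite !cV_cons_head.
by rewrite !cV_cons_tail !mxE.
Qed.

(** Induction on the dimension: the inequality for slices is the pointwise hypothesis of
    [prekopa_leindler] for the slice measures of A, B and C. The common box bounds the slice
    measures of A and B uniformly. *)
Theorem brunn_minkowski (n : nat) (l N : R) (A B C : set 'cV[R]_n) : (0 < l < 1)%R ->
  measurable A -> measurable B -> measurable C -> A `<=` box n N -> B `<=` box n N ->
  (forall x y, A x -> B y -> C (l *: x + (1 - l) *: y)%R) ->
  forall a b : R, (0 <= a)%R -> (0 <= b)%R -> a%:E <= leb A -> b%:E <= leb B ->
  (a `^ l * b `^ (1 - l))%:E <= leb C.
Proof.
move=> l01; have /andP[l0 l1] := l01; have l'0 : (0 < 1 - l)%R by rewrite subr_gt0.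
elim: n A B C => [|n IH] A B C mA mB mC AN BN ABC a b.
  (* In dimension 0 the measure is a Dirac mass: positive a and b are at most 1, and A and B, hence
     C, contain the only point. *)
  rewrite le_eqVlt => /predU1P[<- _ _ _|a0]; first by rewrite powR0 ?gt_eqF// mul0r.
  rewrite le_eqVlt => /predU1P[<- _ _|b0].
    by rewrite [X in (_ * X)%R]powR0 ?gt_eqF// mulr0.
  have inA (X : set 'cV[R]_0) (c : R) : (0 < c)%R -> c%:E <= leb X -> X 0%R /\ (c <= 1)%R.
    move=> c0; rewrite /leb/= diracE; case: (boolP (0%R \in X)) => X0.
      by rewrite lee_fin; rewrite inE in X0.
    by rewrite lee_fin leNgt c0.
  move=> /(inA _ _ a0)[A0 a1] /(inA _ _ b0)[B0 b1].
  have C0 : C 0%R by have := ABC _ _ A0 B0; rewrite !scaler0 addr0.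
  rewrite /leb/= diracE mem_set// lee_fin mulr_ile1 ?powR_ge0//.
    by rewrite -[leRHS](powRr0 a) ger_powR ?a0 ?a1// ltW.
  by rewrite -[leRHS](powRr0 b) ger_powR ?b0 ?b1// ltW.
move=> a0 b0; rewrite !leb_slice//.
have boxlty : leb (box n N) < +oo by exact: lebesgue_cV_box_lty.
have slice_box (X : set 'cV[R]_n.+1) s : X `<=` box n.+1 N -> cV_slice X s `<=` box n N.
  by move=> XN y /XN; rewrite /box /= (forall_cV_cons s y (fun t => (`|t| <= N)%R)) => -[].
have slice_le (X : set 'cV[R]_n.+1) s : measurable X -> X `<=` box n.+1 N ->
    leb (cV_slice X s) <= leb (box n N).
  move=> mX XN; apply: le_measure; rewrite ?inE.
  - exact: measurable_slice.
  - exact: measurable_box.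
  - exact: slice_box.
have fin (X : set 'cV[R]_n.+1) s : measurable X -> X `<=` box n.+1 N ->
    leb (cV_slice X s) \is a fin_num.
  by move=> mX XN; rewrite ge0_fin_numE//; apply: le_lt_trans (slice_le _ _ _ _) _.
have intE (X : set 'cV[R]_n.+1) : measurable X -> X `<=` box n.+1 N ->
    \int[lambda]_s leb (cV_slice X s) = \int[lambda]_s (fine (leb (cV_slice X s)))%:E.
  by move=> mX XN; apply: eq_integral => s _; rewrite fineK ?fin.
rewrite (intE A)// (intE B)//.
have mfine (X : set 'cV[R]_n.+1) : measurable X ->
    measurable_fun [set: measurableTypeR R] (fun s => fine (leb (cV_slice X s))).
  by move=> mX; apply: measurableT_comp => //; exact: measurable_leb_slice.
have bnd (X : set 'cV[R]_n.+1) : measurable X -> X `<=` box n.+1 N ->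
    forall s, (0 <= fine (leb (cV_slice X s)) <= fine (leb (box n N)))%R.
  move=> mX XN s; rewrite fine_ge0//= fine_le ?fin//; first by rewrite ge0_fin_numE.
  exact: slice_le.
apply: (prekopa_leindler l01 (mfine _ mA) (mfine _ mB) (measurable_leb_slice mC)
  (bnd _ mA AN) (bnd _ mB BN)) => // s t.
apply: (IH (cV_slice A s) (cV_slice B t)); rewrite ?fine_ge0 ?fineK ?fin//;
  do ?exact: measurable_slice; do ?exact: slice_box.
by move=> x y Ax By; rewrite /cV_slice /= cV_cons_conv; exact: ABC.
Qed.

End brunn_minkowski.

Section barycenter_measure.
Context {R : realType} {n : nat}.
Local Open Scope ereal_scope.

(** Induction on the number of summands: the mean D of the first m + 1 sets is averaged with the
    next one with weight l = (m + 1)/(m + 2), and c^l c^(1-l) = c. The sets D are kept open, which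
    makes them measurable. *)
Lemma leb_barycenter (V : nat -> set 'cV[R]_n) (c N : R) : (0 < c)%R ->
  (forall i, open (V i)) -> (forall i, V i `<=` box n N) ->
  (forall i, c%:E <= leb (V i)) ->
  forall m (C : set 'cV[R]_n), measurable C ->
  (forall y : 'I_m.+1 -> 'cV[R]_n, (forall i : 'I_m.+1, V i (y i)) -> C (barycenter y)) ->
  c%:E <= leb C.
Proof.
move=> c0 oV VN cV m C mC HC.
suff [D [oD _ cD HD]] : exists D : set 'cV[R]_n, [/\ open D, D `<=` box n N, c%:E <= leb D &
    forall x, D x -> exists2 y : nat -> 'cV[R]_n, (forall i, (i <= m)%N -> V i (y i)) &
      x = (m.+1%:R^-1 *: \sum_(i < m.+1) y i)%R].
  apply: le_trans cD _; apply: le_measure; rewrite ?inE//; first exact: cV_open_measurable.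
  move=> x /HD[y Vy ->]; apply: (HC (fun i : 'I_m.+1 => y i)) => i.
  by apply: Vy; rewrite -ltnS.
elim: m {C mC HC} => [|m [D [oD DN cD HD]]].
  exists (V 0%N); split => // x Vx; exists (fun=> x) => [[]//|].
  by rewrite big_ord1 invr1 scale1r.
have [l lE] : exists l : R, l = (m.+1%:R / m.+2%:R)%R by exists (m.+1%:R / m.+2%:R)%R.
have l01 : (0 < l < 1)%R.
  by rewrite lE divr_gt0//= ltr_pdivrMr// mul1r ltr_nat.
have /andP[l0 l1] := l01.
have l'0 : (0 < 1 - l)%R by rewrite subr_gt0.
pose D' : set 'cV[R]_n := [set z | exists x y, [/\ D x, V m.+1 y & z = (l *: x + (1 - l) *: y)%R]].
have oD' : open D'.
  rewrite openE => _ [x [y [Dx Vy ->]]].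
  have /nbhs_ballP[e /= e0 eV] : nbhs y (V m.+1) by apply: open_nbhs_nbhs.
  apply/nbhs_ballP; exists ((1 - l) * e)%R => /=; first exact: mulr_gt0.
  move=> z; rewrite -ball_normE /= => xyz.
  exists x, ((1 - l)^-1 *: (z - l *: x))%R; split => //.
    apply: eV; rewrite -ball_normE /=.
    rewrite -[y](scalerK (lt0r_neq0 l'0)) -scalerBr normrZ gtr0_norm ?invr_gt0//.
    rewrite ltr_pdivrMl//; apply: le_lt_trans xyz.
    by rewrite opprB addrCA addrA.
  by rewrite scalerA mulfV ?gt_eqF// scale1r subrKC.
exists D'; split => //.
- move=> _ [x [y [/DN xN /VN yN ->]]] i; rewrite !mxE.
  apply: le_trans (ler_normD _ _) _; rewrite !normrM (gtr0_norm l0) (gtr0_norm l'0).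
  have := yN i; have := xN i; rewrite -(ler_pM2l l0 _ N) -(ler_pM2l l'0 _ N).
  by move=> Hx Hy; apply: le_trans (lerD Hx Hy) _; rewrite -mulrDl subrKC mul1r.
- have : (c `^ l * c `^ (1 - l))%:E <= leb D'.
    apply: (@brunn_minkowski _ n l N D (V m.+1)) => //; rewrite ?(ltW c0)//;
      do ?exact: cV_open_measurable.
    by move=> x y Dx Vy; exists x, y.
  rewrite -powRD; last by apply/implyP => _; rewrite gt_eqF.
  by rewrite subrKC powRr1 ?(ltW c0).
- move=> _ [x [z [/HD[y Vy ->] Vz ->]]].
  exists (fun i => if i == m.+1 then z else y i).
    by move=> i im; case: eqVneq => [->//|im']; apply: Vy; rewrite -ltnS ltn_neqAle im'.
  rewrite [in RHS]big_ord_recr /= eqxx [RHS]scalerDr; congr (_ + _)%R.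
    rewrite scalerA; congr (_ *: _)%R; last first.
      by apply: eq_bigr => i _; rewrite ltn_eqF.
    by rewrite lE mulrAC mulfV// mul1r.
  congr (_ *: _)%R; rewrite lE -[X in (X - _)%R](@mulfV _ m.+2%:R)// -mulrBl.
  by rewrite -natrB// subSnn mul1r.
Qed.

End barycenter_measure.

(** * Comparison of norms through distribution functions *)

Section distribution_comparison.
Context {R : realType} {n : nat}.
Local Open Scope ereal_scope.

Lemma continuous_measurable_cV (f : 'cV[R]_n -> R) : continuous f ->
  measurable_fun setT (f : 'cV[R]_n -> measurableTypeR R).
Proof.
move=> /continuousP cf; apply: (measurability _ (RGenOpens.measurableE R)).
move=> _ [_ [a [b ->] <-]]; rewrite setTI.
by apply: cV_open_measurable; apply: cf; exact: interval_open.
Qed.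

Lemma Lnorm_le_distribution (f g : 'cV[R]_n -> R) (q : \bar R) : 0 < q ->
  measurable_fun setT (f : 'cV[R]_n -> measurableTypeR R) ->
  measurable_fun setT (g : 'cV[R]_n -> measurableTypeR R) ->
  (forall x, 0 <= f x)%R -> (forall x, 0 <= g x)%R ->
  (forall t : R, (0 <= t)%R -> leb [set x | (t < f x)%R] <= leb [set x | (t < g x)%R]) ->
  'N[lebesgue_cV n]_q[EFin \o f] <= 'N[lebesgue_cV n]_q[EFin \o g].
Proof.
move=> q0 mf mg f0 g0 fg.
rewrite unlock; case: q q0 => [q| |]; last by rewrite ltNge leNye.
  rewrite lte_fin => q0.
  have E (w : 'cV[R]_n -> R) : measurable_fun setT (w : 'cV[R]_n -> measurableTypeR R) ->
      (forall x, 0 <= w x)%R ->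
      \int[lebesgue_cV n]_x `|(EFin \o w) x| `^ q =
      \int[@lebesgue_measure R]_(t in `[0%R, +oo[) leb [set x | (t `^ q^-1 < w x)%R].
    move=> mw w0; transitivity (\int[@leb R n]_x (w x `^ q)%:E).
      by apply: eq_integral => x _; rewrite /= ger0_norm// poweR_EFin.
    rewrite layer_cake; last 2 first.
    - apply/measurable_EFinP.
      by apply: (measurableT_comp (f := fun t : measurableTypeR R => t `^ q)%R).
    - by move=> x; rewrite lee_fin powR_ge0.
    apply: eq_integral => t; rewrite inE/= in_itv/= andbT => t0; congr (leb _).
    apply/seteqP; split => x /=; rewrite lte_fin => H.
      rewrite -[ltRHS]powRr1// -(mulfV (lt0r_neq0 q0)) powRrM.
      by apply: gt0_ltr_powR; rewrite ?nnegrE ?powR_ge0 ?invr_gt0.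
    rewrite -[ltLHS]powRr1// -(mulVf (lt0r_neq0 q0)) powRrM.
    by apply: gt0_ltr_powR; rewrite ?nnegrE ?powR_ge0.
  have int0 (w : 'cV[R]_n -> R) : \int[lebesgue_cV n]_x `|(EFin \o w) x| `^ q \in `[0, +oo%E].
    by rewrite in_itv/= leey andbT; apply: integral_ge0.
  have q1 : (0 <= q^-1)%R by rewrite invr_ge0 ltW.
  apply: (gt0_ler_poweR q1 (int0 f) (int0 g)); rewrite (E f)// (E g)//.
  have mtail (w : 'cV[R]_n -> R) : measurable_fun setT (w : 'cV[R]_n -> measurableTypeR R) ->
      measurable_fun (`[0%R, +oo[%classic : set (measurableTypeR R))
        (fun t : measurableTypeR R => leb [set x | (t `^ q^-1 < w x)%R]).
    move=> mw; apply: measurable_funTS.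
    have := measurableT_comp (measurable_tail (@leb R n) (f := EFin \o w) _)
      (measurable_powR q^-1).
    by apply; exact/measurable_EFinP.
  apply: ge0_le_integral => //; do ?exact: mtail.
  by move=> t _; apply: fg; exact: powR_ge0.
(* For q infinite: g is at most its essential supremum y off a null set, and the set where f > y is
   no larger than the null set where g > y. *)
move=> _; case: ifPn => // mu0.
have g_ge0 : 0 <= ess_sup (lebesgue_cV n) (abse \o (EFin \o g)).
  by apply: ess_sup_gee => //; near=> x; exact: abse_ge0.
apply/ess_supP.
have := ess_sup_ge (lebesgue_cV n) (abse \o (EFin \o g)).
move: g_ge0; case: ess_sup => [y| |]//; last by move=> _ _; near=> x; exact: leey.
rewrite lee_fin => y0 [Z [mZ Z0 gZ]].
have mlevel (w : 'cV[R]_n -> R) : measurable_fun setT (w : 'cV[R]_n -> measurableTypeR R) ->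
    measurable [set x | (y < w x)%R].
  move=> mw; rewrite (_ : mkset _ = (w : 'cV[R]_n -> measurableTypeR R) @^-1` `]y, +oo[%classic).
    exact: measurable_preimageT mw _.
  by apply/seteqP; split => x /=; rewrite in_itv/= andbT.
exists [set x | (y < f x)%R]; split; first exact: mlevel.
  apply/eqP; rewrite eq_le measure_ge0 andbT; apply: le_trans (fg _ y0) _.
  rewrite -Z0; apply: le_measure; rewrite ?inE//; first exact: mlevel.
  move=> x /= yg; apply: gZ => /=; rewrite ger0_norm// lee_fin.
  by apply/negP; rewrite -ltNge.
move=> x /= /negP; rewrite lee_fin ger0_norm// -ltNge //.
Unshelve. all: by end_near. Qed.

End distribution_comparison.

(** * Positivity of the mean width *)

Section mean_width_positive.
Context {R : realType} {n : nat}.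
Implicit Types (A E : set 'cV[R]_n).

Let oppE : (fun x : 'cV[R]_n => - x) = (fun x => (- 1)%:M *m x).
Proof. by apply/funext => x; rewrite mul_scalar_mx scaleN1r. Qed.

(** The map x to -x may reverse orientation, but [leb_orthogonal] asks only for an orthogonal
    matrix. *)
Lemma sphere_measureN E : measurable E ->
  sphere_measure [set x : 'cV[R]_n | E (- x)] = sphere_measure E.
Proof.
move=> mE; rewrite /sphere_measure; congr (_ * _)%E.
have mPE : measurable (@radial_proj R n @^-1` E `&` closed_eball 0 1).
  apply: measurableI; last exact: measurable_closed_eball.
  exact: measurable_preimageT (@measurable_radial_proj R n) mE.
have N1 : ((- 1)%:M : 'M[R]_n)^T *m (- 1)%:M = 1%:M.
  by rewrite tr_scalar_mx -scalar_mxM mulrNN mulr1.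
rewrite -[RHS]/(leb _) -(leb_orthogonal N1 mPE); congr (leb _).
apply/seteqP; split => x;
  by rewrite /closed_eball /radial_proj /= !subr0 mul_scalar_mx scaleN1r enormN scalerN.
Qed.

Lemma sphere_measureT_lty : (sphere_measure [set: 'cV[R]_n] < +oo)%E.
Proof.
rewrite /sphere_measure preimage_setT setTI lte_mul_pinfty//.
apply: (@leb_bounded_lty _ _ _ 1); first exact: measurable_closed_eball.
by move=> x; rewrite /closed_eball /= subr0.
Qed.

Lemma measurable_usphere : measurable (usphere : set 'cV[R]_n).
Proof.
rewrite (_ : usphere = (@enorm R n) @^-1` [set 1]).
  by apply: measurable_preimageT (@measurable_enorm R n) _.
by apply/seteqP; split.
Qed.

Lemma sphere_measure_usphere_gt0 : (0 < n)%N ->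
  (0 < sphere_measure (usphere : set 'cV[R]_n))%E.
Proof.
move=> n0; rewrite mule_gt0 ?lte_fin ?ltr0n//.
pose i := Ordinal n0.
(* The open sup-norm ball of radius d about d e_i misses the origin, and its points have sup norm at
   most 2d = 1/(n + 1), hence Euclidean length at most 1. *)
have [d dE] : exists d : R, d = n.+1%:R^-1 / 2 by exists (n.+1%:R^-1 / 2).
have d0 : 0 < d by rewrite dE divr_gt0// invr_gt0.
pose U : set 'cV[R]_n := ball (d *: basis_cV i) d.
apply: (@lt_le_trans _ _ (leb U)).
  apply: leb_open_gt0; first exact: ball_open.
  by exists (d *: basis_cV i); exact: ballxx.
apply: le_measure; rewrite ?inE//.
- by apply: cV_open_measurable; exact: ball_open.
- apply: measurableI; last exact: measurable_closed_eball.
  exact: measurable_preimageT (@measurable_radial_proj R n) measurable_usphere.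
- move=> x; rewrite /U -ball_normE /= => xU; split.
    have x0 : x != 0.
      apply/eqP => x0; move: xU; rewrite x0 subr0 normrZ; apply/negP; rewrite -leNgt.
      rewrite gtr0_norm// ler_peMr// ?(ltW d0)//.
      by have := coord_le_norm (basis_cV i : 'cV[R]_n) i 0; rewrite mxE !eqxx normr1.
    rewrite /radial_proj /usphere /= enormZ normfV ger0_norm ?enorm_ge0// mulVf//.
    by rewrite enorm_eq0.
  rewrite /closed_eball /= subr0.
  have xn : `|x| <= d + d.
    rewrite -(subKr (d *: basis_cV i) x).
    apply: le_trans (ler_normB _ _) _; apply: lerD (ltW xU).
    rewrite normrZ gtr0_norm// ler_piMr ?(ltW d0)//.
    by apply: le_trans (norm_le_enorm _) _; rewrite norm_basis_cV.
  apply: le_trans (enorm_le_norm _) _.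
  apply: (@le_trans _ _ (n.+1%:R * (d + d))); last by rewrite dE -splitr mulfV.
  by rewrite ler_pM// ler_nat.
Qed.

Let measurable_oppcV : measurable_fun setT (fun x : 'cV[R]_n => - x).
Proof. by rewrite oppE; exact: measurable_mulmxcV. Qed.

Lemma integral_oppcV (m : {measure set 'cV[R]_n -> \bar R}) (D : set 'cV[R]_n)
    (w : 'cV[R]_n -> \bar R) :
  (forall X : set 'cV[R]_n, measurable X -> m [set x : 'cV[R]_n | X (- x)] = m X) ->
  measurable D -> (forall x, D (- x) <-> D x) ->
  measurable_fun setT w -> m.-integrable D (w \o (fun x => - x)) ->
  (\int[m]_(x in D) w (- x)%R = \int[m]_(x in D) w x)%E.
Proof.
move=> mN mD DN mw iw.
have SN : (fun x : 'cV[R]_n => - x) @^-1` D = D by apply/seteqP; split => x /DN.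
have := @integral_pushforward _ _ _ _ R _ measurable_oppcV m D w mw.
rewrite SN => /(_ iw mD) E; apply: etrans (esym E) _.
by apply: eq_measure_integral => X mX _; exact: mN.
Qed.

Lemma support_fun_has_sup A xi : A !=set0 -> bounded_set A ->
  has_sup [set dotv xi y | y in closure A].
Proof.
move=> [x0 Ax0] [N [_ AN]]; split.
  by exists (dotv xi x0), x0 => //; exact: subset_closure.
exists (enorm xi * (n%:R * (`|N| + 2))) => _ [y Ay <-].
have [z Az yz] := (closure_enormP A y).1 Ay 1 ltr01.
apply: le_trans (dotv_le_enorm _ _) _; rewrite ler_wpM2l ?enorm_ge0//.
apply: le_trans (enorm_le_norm _) _; rewrite ler_wpM2l//.
rewrite -(subKr z y); apply: le_trans (ler_normB _ _) _.
have N1 : N < `|N| + 1 by have := ler_norm N; lra.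
have := AN _ N1 z Az; have := norm_le_enorm (z - y); move: yz; rewrite (enormB z) /=; lra.
Qed.

(** The width h(xi) + h(-xi) is at least r in every direction when A contains an open ball of radius
    r, and by symmetry of the surface measure its integral is twice that of h. This makes the limit
    ball nondegenerate. *)
Lemma mean_width_gt0 A : (0 < n)%N -> open A -> A !=set0 -> bounded_set A ->
  0 < mean_width A.
Proof.
have half_gt0 (x y : R) : 0 < x -> x <= y + y -> 0 < y by move=> ? ?; lra.
move=> n0 oA A0 bA; pose h := support_fun A.
have hsup xi := support_fun_has_sup xi A0 bA.
have h_ge xi y : closure A y -> dotv xi y <= h xi.
  by move=> Ay; apply: ub_le_sup; [case: (hsup xi)|exists y].
have [x0 Ax0] := A0; have [N [_ AN]] := bA.
have AN' : exists2 M : R, 0 < M & forall y, closure A y -> enorm y <= M.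
  exists (n%:R * (`|N| + 1) + 1) => [|y Ay].
    by rewrite ltr_wpDl// mulr_ge0// addr_ge0.
  have [z Az yz] := (closure_enormP A y).1 Ay 1 ltr01.
  rewrite -(subrK z y) addrC; apply: le_trans (enormD _ _) _.
  apply: lerD; last by rewrite enormB ltW.
  apply: le_trans (enorm_le_norm _) _; rewrite ler_wpM2l//; apply: AN Az.
  by have := ler_norm N; lra.
have [M M0 AM] := AN'.
(* The Lipschitz bound yields continuity of the support function, hence its measurability. *)
have h_lip xi eta : h xi <= h eta + M * enorm (xi - eta).
  apply: ge_sup; first by case: (hsup xi).
  move=> _ [y Ay <-]; rewrite -{1}(subrKC eta xi) dotvDl lerD ?h_ge//.
  rewrite mulrC; apply: le_trans (dotv_le_enorm _ _) _.
  by rewrite ler_wpM2l ?enorm_ge0// AM.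
have h_cont : continuous h.
  move=> xi; apply/(@cvgrPdist_lt _ _ _ (nbhs xi)) => e e0.
  near=> eta; have : enorm (eta - xi) < e / M by near: eta; apply: near_enorm; rewrite divr_gt0.
  rewrite ltr_pdivlMr// mulrC => H.
  have := h_lip xi eta; have := h_lip eta xi; rewrite (enormB xi) ltr_norml => ? ?.
  by apply/andP; split; lra.
have mh : measurable_fun setT (h : 'cV[R]_n -> measurableTypeR R).
  exact: continuous_measurable_cV.
pose sg : {measure set 'cV[R]_n -> \bar R} := @sphere_measure R n.
have mS := measurable_usphere.
have S_lty : (sg usphere < +oo)%E.
  by apply: le_lt_trans sphere_measureT_lty; apply: le_measure; rewrite ?inE.
have hM xi : usphere xi -> `|h xi| <= M.
  rewrite /usphere /= => xi1; rewrite ler_norml; apply/andP; split.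
    apply: (@le_trans _ _ (dotv xi x0)); last by apply: h_ge; exact: subset_closure.
    rewrite lerNl -dotvNl; apply: le_trans (dotv_le_enorm _ _) _.
    by rewrite enormN xi1 mul1r; apply: AM; exact: subset_closure.
  apply: ge_sup; first by case: (hsup xi).
  move=> _ [y Ay <-]; apply: le_trans (dotv_le_enorm _ _) _.
  by rewrite xi1 mul1r; exact: AM.
have bnd (w : 'cV[R]_n -> R) : (forall xi, usphere xi -> `|w xi| <= M) ->
    [bounded w x | x in (usphere : set 'cV[R]_n)].
  by move=> wM; exists M; split=> [|a Ma x /wM /le_trans]; [exact: num_real|apply; exact: ltW].
have ih : sg.-integrable usphere (EFin \o h).
  by apply: measurable_bounded_integrable => //; [exact: measurable_funTS|exact: bnd].
have ihN : sg.-integrable usphere (EFin \o (fun x => h (- x))).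
  apply: measurable_bounded_integrable => //.
    by apply: measurable_funTS; exact: measurableT_comp measurable_oppcV.
  by apply: bnd => xi xi1; apply: hM; rewrite /usphere /= enormN.
have EN : \int[sg]_(x in usphere) h (- x) = \int[sg]_(x in usphere) h x.
  rewrite /Rintegral; congr fine.
  apply: (@integral_oppcV sg usphere (EFin \o h)) => //.
  - exact: sphere_measureN.
  - by move=> x; rewrite /usphere /= enormN.
  - exact/measurable_EFinP.
have /nbhs_enormP[r r0 rA] : nbhs x0 A by exact: open_nbhs_nbhs.
have r20 : 0 < r / 2 by rewrite divr_gt0.
have hr xi : usphere xi -> r <= h xi + h (- xi).
  rewrite /usphere /= => xi1.
  have inA s : `|s| = r / 2 -> closure A (x0 + s *: xi).
    move=> sr; apply: subset_closure; apply: rA.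
    by rewrite addrC addKr enormZ xi1 mulr1 sr; lra.
  have := h_ge xi _ (inA (r / 2) (gtr0_norm r20)).
  have sr' : `|- (r / 2)| = r / 2 by rewrite normrN gtr0_norm.
  have := h_ge (- xi) _ (inA _ sr').
  rewrite !dotvDr !dotvZr !dotvNl -sqr_enorm xi1; lra.
have I : r * fine (sg usphere) <= \int[sg]_(x in usphere) h x + \int[sg]_(x in usphere) h x.
  rewrite -{2}EN -RintegralD// -Rintegral_cst//; apply: le_Rintegral => //.
  - apply: measurable_bounded_integrable => //.
    by exists r; split=> [|a ra x _ /=]; [exact: num_real|rewrite gtr0_norm// ltW].
  - have := integrableD mS ih ihN.
    by apply: eq_integrable => // x _.
have sgS : 0 < fine (sg usphere).
  by rewrite fine_gt0// S_lty andbT; exact: sphere_measure_usphere_gt0.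
rewrite /mean_width mulr_gt0//; last exact: half_gt0 (mulr_gt0 r0 sgS) I.
have oB : open (eball 0 1 : set 'cV[R]_n).
  rewrite openE => x; rewrite /eball /= subr0 => x1; apply/nbhs_enormP.
  exists (1 - enorm x); first by rewrite subr_gt0.
  move=> y yx; rewrite /eball /= subr0 -(subrK x y); have := enormD (y - x) x; lra.
rewrite divr_gt0// mulr_gt0 ?ltr0n// fine_gt0//; apply/andP; split.
  by apply: leb_open_gt0 => //; exists 0; rewrite /eball /= subr0 enorm0.
apply: (@leb_bounded_lty _ _ _ 1); first exact: cV_open_measurable.
by move=> x; rewrite /eball /= subr0 => /ltW.
Unshelve. all: by end_near. Qed.

End mean_width_positive.

(** * Continuity of auxiliary maps and extension by zero *)

Section continuity.
Context {R : realType}.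

Lemma mx_continuous (T : topologicalType) m n (f : T -> 'M[R]_(m, n)) :
  (forall i j, continuous (fun x => f x i j)) -> continuous f.
Proof.
move=> cf x; apply/(@cvgrPdist_lt _ _ _ (nbhs x)) => e e0.
have e2 : 0 < e / 2 by rewrite divr_gt0.
have H : \forall y \near x, forall i j, `|f x i j - f y i j| < e / 2.
  apply: filter_forall => i; apply: filter_forall => j.
  by have /(@cvgrPdist_lt _ _ _ (nbhs x)) /(_ _ e2) := cf i j x.
near=> y; apply: (@le_lt_trans _ _ (e / 2)); last by rewrite ltr_pdivrMr// ltr_pMr// ltr1n.
apply: norm_le_coord => [|i j]; first exact: ltW.
rewrite !mxE ltW//; move: i j; near: y; exact: H.
Unshelve. all: by end_near. Qed.

Lemma addf_continuous (T : topologicalType) (V : normedModType R) (f g : T -> V) :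
  continuous f -> continuous g -> continuous (fun x => f x + g x).
Proof. by move=> cf cg x; apply: cvgD; [exact: cf|exact: cg]. Qed.

Lemma scalef_continuous (T : topologicalType) (V : normedModType R) (c : R) (f : T -> V) :
  continuous f -> continuous (fun x => c *: f x).
Proof. by move=> cf x; apply: cvgZl_tmp; exact: cf. Qed.

Lemma mulf_continuous (T : topologicalType) (c : R) (f : T -> R) :
  continuous f -> continuous (fun x => c * f x).
Proof. by move=> cf x; apply: cvgMl_tmp; exact: cf. Qed.

Lemma compf_continuous (T V W : topologicalType) (f : T -> V) (g : V -> W) :
  continuous f -> continuous g -> continuous (fun x => g (f x)).
Proof. by move=> cf cg x; apply: continuous_comp; [exact: cf|exact: cg]. Qed.

Lemma cstf_continuous (T V : topologicalType) (c : V) : continuous (fun _ : T => c).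
Proof. by move=> x; exact: cvg_cst. Qed.

Lemma continuous_near_gt (T : topologicalType) (f : T -> R) x a :
  continuous f -> a < f x -> \forall y \near x, a < f y.
Proof. by move=> cf ax; apply: (cvgr_gt _ (cf x)). Qed.

Lemma continuous_near_lt (T : topologicalType) (f : T -> R) x a :
  continuous f -> f x < a -> \forall y \near x, f y < a.
Proof. by move=> cf ax; apply: (cvgr_lt _ (cf x)). Qed.

Lemma continuous_near_open (T V : topologicalType) (f : T -> V) x (A : set V) :
  continuous f -> open A -> A (f x) -> \forall y \near x, A (f y).
Proof. by move=> cf oA Afx; apply: (cf x); exact: open_nbhs_nbhs. Qed.

(** The form suits a supremum over tuples: compactness gives the closed sets, perturbing one tuple
    the open ones. *)
Lemma continuous_superlevels (T : topologicalType) (f : T -> R) :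
  (forall x, 0 <= f x) -> (forall t, 0 < t -> closed [set x | t <= f x]) ->
  (forall t, 0 <= t -> open [set x | t < f x]) -> continuous f.
Proof.
move=> f0 cf of_ x; apply/(@cvgrPdist_lt _ _ _ (nbhs x)) => e e0.
have H1 : \forall y \near x, f y < f x + e.
  have : open (~` [set y | f x + e <= f y]).
    by apply: closed_openC; apply: cf; rewrite ltr_wpDl.
  have nf : ~ (f x + e <= f x) by apply/negP; rewrite -ltNge ltrDl.
  rewrite openE => /(_ x nf).
  by apply: filterS => y /= /negP; rewrite -ltNge.
have H2 : \forall y \near x, f x - e < f y.
  have [fe|fe] := leP 0 (f x - e).
    by have := of_ _ fe; rewrite openE => /(_ x) /=; apply; rewrite ltrBlDr ltrDl.
  by apply: nearW => y; apply: lt_le_trans fe (f0 _).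
apply: filterS2 H1 H2 => y ? ?.
by rewrite ltr_norml; apply/andP; split; lra.
Qed.

Lemma sum_continuous (T : topologicalType) (I : Type) (r : seq I) (f : I -> T -> R) :
  (forall i, continuous (f i)) -> continuous (fun x => \sum_(i <- r) f i x).
Proof.
move=> cf; elim: r => [|i r IH].
  by rewrite (_ : (fun _ => _) = cst 0); [exact: cstf_continuous|apply/funext => x; rewrite big_nil].
rewrite (_ : (fun _ => _) = fun x => f i x + \sum_(j <- r) f j x); last first.
  by apply/funext => x; rewrite big_cons.
by apply: addf_continuous.
Qed.

Lemma mulmx_continuous m n p (M : 'M[R]_(m, n)) : continuous (fun X : 'M[R]_(n, p) => M *m X).
Proof.
apply: mx_continuous => i j.
rewrite (_ : (fun _ => _) = fun X : 'M[R]_(n, p) => \sum_k M i k * X k j); last first.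
  by apply/funext => X; rewrite mxE.
by apply: sum_continuous => k; apply: mulf_continuous; exact: coord_continuous.
Qed.

Lemma col_continuous m n (j : 'I_n) : continuous (fun X : 'M[R]_(m, n) => col j X).
Proof.
apply: mx_continuous => i k; rewrite (_ : (fun _ => _) = fun X : 'M[R]_(m, n) => X i j).
  exact: coord_continuous.
by apply/funext => X; rewrite mxE.
Qed.

Lemma powR_continuous (T : topologicalType) (f : T -> R) (p : R) : 0 < p ->
  continuous f -> (forall x, 0 <= f x) -> continuous (fun x => f x `^ p).
Proof.
(* The power need not be differentiable at 0, so zeros of f are handled by a direct estimate. *)
move=> p0 cf f0 x; have [fx0|fx0] := eqVneq (f x) 0.
  apply/(@cvgrPdist_lt _ _ _ (nbhs x)) => e e0; rewrite fx0 powR0 ?gt_eqF//.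
  have ep : 0 < e `^ p^-1 by exact: powR_gt0.
  have /(@cvgrPdist_lt _ _ _ (nbhs x)) /(_ _ ep) := cf x; rewrite fx0 => H.
  near=> y; have : `|0 - f y| < e `^ p^-1 by near: y.
  rewrite !sub0r !normrN !ger0_norm ?powR_ge0// => fy.
  rewrite -[ltRHS](powRr1 (ltW e0)) -(mulVf (lt0r_neq0 p0)) powRrM.
  by apply: gt0_ltr_powR; rewrite ?nnegrE ?powR_ge0.
have {}fx0 : 0 < f x by rewrite lt_neqAle eq_sym fx0 f0.
apply: (@continuous_comp _ _ _ f (fun t => t `^ p)); first exact: cf.
have [+ _] := is_derive1_powR p fx0.
by move=> /derivable1_diffP/differentiable_continuous.
Unshelve. all: by end_near. Qed.

End continuity.

Section zero_extension.
Context {R : realType} {n : nat}.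
Implicit Types (A : set 'cV[R]_n) (u : 'cV[R]_n -> R).

Lemma within_continuousP A u : {within A, continuous u} ->
  forall x e, A x -> 0 < e -> \forall y \near x, A y -> `|u x - u y| < e.
Proof.
move=> /subspace_continuousP cu x e Ax e0.
have := cu x Ax; move=> /(@cvgrPdist_lt _ _ _ (within A (nbhs x))) /(_ _ e0).
by rewrite near_withinE.
Qed.

Lemma zero_extension_continuous A u : open A -> positive_zero_boundary A u ->
  continuous (u \_ A).
Proof.
move=> oA [cu bu _] x; apply/(@cvgrPdist_lt _ _ _ (nbhs x)) => e e0.
have [clAx|nclAx] := pselect (closure A x); last first.
  have nA : \forall y \near x, ~ closure A y.
    have : open (~` closure A) by apply: closed_openC; exact: closed_closure.
    by rewrite openE; apply.
  near=> y; rewrite !patchE !ifF ?subr0 ?normr0//; apply: negbTE; rewrite notin_setE => AA.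
    by have /(_ _) := near nA y; apply => //; exact: subset_closure.
  by apply: nclAx; exact: subset_closure.
have H := within_continuousP cu clAx e0.
have uE y : closure A y -> (u \_ A) y = u y.
  move=> cly; rewrite patchE; case: ifPn => //; rewrite notin_setE => nAy.
  by rewrite bu// /boundary; split => //; rewrite ((interior_id A).1 oA).
have [Ax|nAx] := pselect (A x).
  near=> y; rewrite !uE//; first by apply: (near H y) => //; apply: subset_closure; near: y; exact: open_nbhs_nbhs.
  by apply: subset_closure; near: y; exact: open_nbhs_nbhs.
have ux0 : u x = 0 by apply: bu; split => //; rewrite ((interior_id A).1 oA).
near=> y; rewrite (uE x)// ux0; have [Ay|nAy] := pselect (A y).
  by rewrite patchE mem_set// -ux0; apply: (near H y) => //; exact: subset_closure.
by rewrite patchE memNset// subrr normr0.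
Unshelve. all: by end_near. Qed.

End zero_extension.

(** * Rotation means of u *)

Section rearrangement_step.
Context {R : realType} {n : nat}.
Variables (Omega : set 'cV[R]_n) (u : 'cV[R]_n -> R) (p : R) (rho : nat -> 'M[R]_n).
Hypotheses (Omega_neq0 : Omega !=set0) (Omega_bounded : bounded_set Omega)
  (Omega_open : open Omega) (u_dirichlet : positive_zero_boundary Omega u)
  (p_gt0 : 0 < p) (rho_SO : forall i, special_orthogonal (rho i)).

Let U : 'cV[R]_n -> R := u \_ Omega.

Let cU : continuous U. Proof. exact: zero_extension_continuous. Qed.

Let U_ge0 x : 0 <= U x.
Proof.
rewrite /U patchE; case: ifPn => //; rewrite inE => Ox.
by have [_ _ u0] := u_dirichlet; rewrite ltW ?u0.
Qed.

Let U_gt0 x : 0 < U x -> Omega x.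
Proof.
by rewrite /U patchE; case: ifPn => //; [rewrite inE|rewrite ltxx].
Qed.

Let UE x : closure Omega x -> U x = u x.
Proof.
move=> clx; rewrite /U patchE; case: ifPn => //; rewrite notin_setE => nOx.
have [_ bu _] := u_dirichlet; rewrite bu// /boundary; split => //.
by rewrite ((interior_id Omega).1 Omega_open).
Qed.

(* Tuples in the product of the rotated closures are written y_i = rho_i z_i   *)
(* with z_i in the closure of Omega.                                           *)
Definition rot_bary m (z : 'I_m -> 'cV[R]_n) : 'cV[R]_n :=
  barycenter (fun i : 'I_m => rho i *m z i).

Definition pow_avg m (z : 'I_m -> 'cV[R]_n) : R :=
  m%:R^-1 * \sum_(i < m) (u \_ Omega) (z i) `^ p.

Let rhoTK i (x : 'cV[R]_n) : rho i *m ((rho i)^T *m x) = x.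
Proof. by have [h _] := rho_SO i; rewrite mulmxA h mul1mx. Qed.

Let rhoK i (x : 'cV[R]_n) : (rho i)^T *m (rho i *m x) = x.
Proof. by rewrite mulmxA special_orthogonal_tr// mul1mx. Qed.

Lemma closure_rotated i y :
  closure (rotated rho Omega i) y <-> closure Omega ((rho i)^T *m y).
Proof.
have rhoN (x : 'cV[R]_n) : enorm ((rho i)^T *m x) = enorm x.
  by apply: enorm_orthogonal; rewrite trmxK; case: (rho_SO i).
split=> /closure_enormP cly; apply/closure_enormP => e /cly[z].
  move=> [x Ox <-] ze; exists x => //; apply: le_lt_trans ze.
  by rewrite -{1}(rhoK i x) -mulmxBr rhoN.
move=> Oz ze; exists (rho i *m z); first by exists z.
by rewrite -(rhoN (_ - _)) mulmxBr rhoK.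
Qed.

Let fibre m x : set ('I_m -> 'cV[R]_n) :=
  [set z | (forall i, closure Omega (z i)) /\ x = rot_bary z].

Arguments fibre : clear implicits.

Let rearr_set m x :
  [set (m%:R^-1 * \sum_(i < m) rotated_fun rho u i (y i) `^ p) `^ p^-1
     | y in [set y : 'I_m -> 'cV[R]_n |
         (forall i : 'I_m, closure (rotated rho Omega i) (y i)) /\ x = barycenter y]] =
  [set pow_avg z `^ p^-1 | z in fibre m x].
Proof.
have E (y : 'I_m -> 'cV[R]_n) (z : 'I_m -> 'cV[R]_n) :
    (forall i, closure Omega (z i)) -> (forall i : 'I_m, z i = (rho i)^T *m y i) ->
    m%:R^-1 * \sum_(i < m) rotated_fun rho u i (y i) `^ p = pow_avg z.
  move=> clz zE; congr (_ * _); apply: eq_bigr => i _; congr (_ `^ _).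
  by rewrite /rotated_fun special_orthogonal_inv// -zE -UE.
apply/seteqP; split => _ [y [cly xE] <-].
  have cly' (i : 'I_m) : closure Omega ((rho i)^T *m y i) by exact/closure_rotated.
  exists (fun i : 'I_m => (rho i)^T *m y i); last first.
    by rewrite -(E y (fun i : 'I_m => (rho i)^T *m y i)).
  split=> //; rewrite xE; congr barycenter; apply/funext => i.
  by rewrite rhoTK.
exists (fun i : 'I_m => rho i *m y i).
  by split=> // i; apply/closure_rotated; rewrite rhoK.
by rewrite (E (fun i : 'I_m => rho i *m y i) y)// => i; rewrite rhoK.
Qed.

Lemma rot_bary_closure m (z : 'I_m -> 'cV[R]_n) :
  (forall i, closure Omega (z i)) -> closure (rotation_mean rho Omega m) (rot_bary z).
Proof.
move=> clz; apply/closure_enormP => e e0.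
have /choice[y Hy] : forall i, exists y, Omega y /\ enorm (y - z i) < e.
  by move=> i; have [y Oy ye] := (closure_enormP _ _).1 (clz i) e e0; exists y.
exists (rot_bary y).
  by exists (fun i : 'I_m => rho i *m y i) => // i; exists (y i) => //; case: (Hy i).
case: m z clz y Hy => [|m] z clz y Hy.
  by rewrite /rot_bary /barycenter !big_ord0 subrr enorm0.
rewrite /rot_bary /barycenter -scalerBr enormZ -sumrB ger0_norm ?invr_ge0//.
rewrite mulrC ltr_pdivrMr//; apply: le_lt_trans (enorm_sum _ _) _.
rewrite -[m.+1 in ltRHS]card_ord mulr_natr -sumr_const; apply: ltr_sum => [|i _].
  by apply/hasP; exists ord0 => //; exact: mem_index_enum.
rewrite -mulmxBr enorm_orthogonal ?special_orthogonal_tr//; exact: (Hy i).2.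
Qed.

(** Off the closure of the rotation mean no tuple lies over x, and [sup set0 = 0] reproduces the
    extension by zero. *)
Lemma rearr_stepE m x : rearr_step rho Omega u p m x =
  sup [set pow_avg z `^ p^-1 | z in fibre m x].
Proof.
rewrite /rearr_step patchE rearr_set; case: ifPn => //; rewrite notin_setE => nx.
rewrite (_ : [set _ | _ in _] = set0) ?sup0//.
apply/seteqP; split => // _ [z [clz xE] <-]; apply: nx; rewrite xE.
exact: rot_bary_closure.
Qed.

(** Storing a tuple as a matrix puts it in a normed space whose bounded closed sets are compact. *)
Let tuple_mx m (z : 'I_m -> 'cV[R]_n) : 'M[R]_(n, m) := \matrix_(i, j) z j i 0.

Let col_tuple m (z : 'I_m -> 'cV[R]_n) i : col i (tuple_mx z) = z i.
Proof. by apply/matrixP => j k; rewrite !mxE ord1. Qed.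

Let col_tuple_mx m (z : 'I_m -> 'cV[R]_n) : (fun i => col i (tuple_mx z)) = z.
Proof. by apply/funext => i; exact: col_tuple. Qed.

Let pow_avg_continuous m :
  continuous (fun Z : 'M[R]_(n, m) => pow_avg (fun i => col i Z)).
Proof.
apply: mulf_continuous; apply: sum_continuous => i; apply: powR_continuous => //.
by apply: compf_continuous cU; exact: col_continuous.
Qed.

Let rot_bary_continuous m :
  continuous (fun Z : 'M[R]_(n, m) => rot_bary (fun i => col i Z)).
Proof.
apply: mx_continuous => i j.
rewrite (_ : (fun _ => _) = fun Z : 'M[R]_(n, m) =>
    m%:R^-1 * \sum_(k < m) (rho k *m col k Z) i j); last first.
  by apply/funext => Z; rewrite !mxE summxE.
apply: mulf_continuous; apply: sum_continuous => k.
apply: (@compf_continuous _ _ _ (fun X : 'M[R]_(n, m) => rho k *m col k X) (fun Y => Y i j)).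
  by apply: compf_continuous (@mulmx_continuous _ _ _ _ _); exact: col_continuous.
exact: coord_continuous.
Qed.

Let closure_bounded : exists2 N, 0 < N & forall x, closure Omega x -> `|x| <= N.
Proof.
have [N [_ ON]] := Omega_bounded.
exists (`|N| + 2) => [|x clx]; first by rewrite ltr_wpDl.
have N1 : N < `|N| + 1 by have := ler_norm N; lra.
have [y Oy yx] := (closure_enormP _ _).1 clx 1 ltr01.
have := ON _ N1 y Oy; have := norm_le_enorm (y - x); have := ler_normB y (y - x).
rewrite subKr /=; lra.
Qed.

Let K m : set 'M[R]_(n, m) := [set Z | forall i, closure Omega (col i Z)].

Arguments K : clear implicits.

Let K_compact m : compact (K m).
Proof.
apply: mx_bounded_closed_compact.
  have [N N0 ON] := closure_bounded; exists N; split; first exact: num_real.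
  move=> N' NN' Z KZ /=; apply: norm_le_coord => [|i j]; first by rewrite ltW ?(lt_trans N0).
  have := ON _ (KZ j); have := coord_le_norm (col j Z) i 0; rewrite mxE.
  by move=> h1 h2; apply: le_trans h1 _; apply: le_trans h2 _; exact: ltW.
rewrite (_ : K m = \bigcap_i ((fun Z => col i Z) @^-1` closure Omega)); last first.
  by apply/seteqP; split => Z H i => [_|]; exact: H.
apply: closed_bigI => i _; apply: preimage_closed => [Z _|]; last exact: closed_closure.
exact: col_continuous.
Qed.

Lemma pow_avg_ge0 m (z : 'I_m -> 'cV[R]_n) : 0 <= pow_avg z.
Proof. by rewrite mulr_ge0 ?invr_ge0// sumr_ge0// => i _; exact: powR_ge0. Qed.

Let fibre_max m x (z0 : 'I_m -> 'cV[R]_n) : fibre m x z0 ->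
  exists2 z, fibre m x z & forall z', fibre m x z' -> pow_avg z' <= pow_avg z.
Proof.
move=> [clz0 xz0].
pose Kx : set 'M[R]_(n, m) := K m `&` ((fun Z => rot_bary (fun i => col i Z)) @^-1` [set x]).
have Kx0 : Kx !=set0.
  exists (tuple_mx z0); rewrite /Kx /K /= ; split; last by rewrite /= col_tuple_mx xz0.
  by move=> i; rewrite col_tuple.
have cKx : compact Kx.
  apply: compact_closedI; first exact: K_compact.
  apply: preimage_closed => [Z _|]; first exact: rot_bary_continuous.
  exact: (accessible_closed_set1 (hausdorff_accessible (@norm_hausdorff _ _))).
have [|Z ZK Zmax] := compact_EVT_max Kx0 cKx (f := fun Z => pow_avg (fun i => col i Z)).
  by apply: continuous_subspaceT; exact: pow_avg_continuous.
rewrite inE in ZK; case: ZK => ZK Zx; exists (fun i => col i Z); first by split.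
move=> z' [clz' xz']; rewrite -(col_tuple_mx z'); apply: Zmax; rewrite inE; split.
  by move=> i; rewrite col_tuple.
by rewrite /= col_tuple_mx.
Qed.

Let rearr_step_max m x (z : 'I_m -> 'cV[R]_n) : fibre m x z ->
  (forall z', fibre m x z' -> pow_avg z' <= pow_avg z) ->
  rearr_step rho Omega u p m x = pow_avg z `^ p^-1.
Proof.
move=> fz zmax; rewrite rearr_stepE; apply/eqP; rewrite eq_le; apply/andP; split.
  apply: ge_sup; first by exists (pow_avg z `^ p^-1), z.
  move=> _ [z' fz' <-]; apply: ge0_ler_powR; rewrite ?nnegrE ?pow_avg_ge0 ?invr_ge0 ?(ltW p_gt0)//.
  exact: zmax.
apply: ub_le_sup; last by exists z.
exists (pow_avg z `^ p^-1) => _ [z' fz' <-].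
apply: ge0_ler_powR; rewrite ?nnegrE ?pow_avg_ge0 ?invr_ge0 ?(ltW p_gt0)//; exact: zmax.
Qed.

Lemma rearr_step_ge0 m x : 0 <= rearr_step rho Omega u p m x.
Proof.
have [[z0 fz0]|nf] := pselect (fibre m x !=set0).
  have [z fz zmax] := fibre_max fz0; rewrite (rearr_step_max fz zmax); exact: powR_ge0.
rewrite rearr_stepE (_ : [set _ | _ in _] = set0) ?sup0//.
by apply/seteqP; split => // _ [z fz <-]; apply: nf; exists z.
Qed.

Let powVK a : 0 <= a -> (a `^ p^-1) `^ p = a.
Proof. by move=> a0; rewrite -powRrM mulVf ?gt_eqF// powRr1. Qed.

Lemma pow_avg_le_rearr m (z : 'I_m -> 'cV[R]_n) : (forall i, closure Omega (z i)) ->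
  pow_avg z <= rearr_step rho Omega u p m (rot_bary z) `^ p.
Proof.
move=> clz; have fz : fibre m (rot_bary z) z by [].
have [z' fz' zmax] := fibre_max fz; rewrite (rearr_step_max fz' zmax) powVK ?pow_avg_ge0//.
exact: zmax.
Qed.

Lemma rearr_step_attained m x : 0 < rearr_step rho Omega u p m x ->
  exists z : 'I_m -> 'cV[R]_n, [/\ forall i, closure Omega (z i), rot_bary z = x &
    rearr_step rho Omega u p m x `^ p = pow_avg z].
Proof.
move=> W0; have [[z0 fz0]|nf] := pselect (fibre m x !=set0).
  have [z fz zmax] := fibre_max fz0; have E := rearr_step_max fz zmax.
  by exists z; case: fz => clz xz; split => //; rewrite E powVK ?pow_avg_ge0.
move: W0; rewrite rearr_stepE (_ : [set _ | _ in _] = set0) ?sup0 ?ltxx//.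
by apply/seteqP; split => // _ [z fz <-]; apply: nf; exists z.
Qed.

Lemma rearr_step_gt m (z : 'I_m -> 'cV[R]_n) t : (forall i, closure Omega (z i)) ->
  0 <= t -> t `^ p < pow_avg z -> t < rearr_step rho Omega u p m (rot_bary z).
Proof.
move=> clz t0 tz; rewrite ltNge; apply/negP => Wt.
have := lt_le_trans tz (pow_avg_le_rearr clz); apply/negP; rewrite -leNgt.
by apply: ge0_ler_powR; rewrite ?nnegrE ?rearr_step_ge0 ?(ltW p_gt0).
Qed.

Lemma rearr_step_support m x (r : R) : (forall y, closure Omega y -> enorm y <= r) ->
  0 < rearr_step rho Omega u p m x -> enorm x <= r.
Proof.
move=> Or /rearr_step_attained[z [clz <- _]].
have r0 : 0 <= r.
  by have [y Oy] := Omega_neq0; apply: le_trans (enorm_ge0 y) (Or _ _); exact: subset_closure.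
case: m z clz => [|m] z clz; first by rewrite /rot_bary /barycenter big_ord0 scaler0 enorm0.
rewrite /rot_bary /barycenter enormZ ger0_norm ?invr_ge0// mulrC ler_pdivrMr//.
apply: le_trans (enorm_sum _ _) _.
rewrite -[m.+1 in leRHS]card_ord mulr_natr -sumr_const; apply: ler_sum => i _.
by rewrite enorm_orthogonal ?special_orthogonal_tr//; exact: Or.
Qed.

(** The superlevel set is the image under [rot_bary] of a compact set of tuples; t > 0 excludes the
    points over which there is no tuple. *)
Lemma rearr_step_superlevel_closed m t : 0 < t ->
  closed [set x | t <= rearr_step rho Omega u p m x].
Proof.
move=> t0; pose Kt : set 'M[R]_(n, m) :=
  K m `&` ((fun Z => pow_avg (fun i => col i Z)) @^-1` [set s | t `^ p <= s]).
have -> : [set x | t <= rearr_step rho Omega u p m x] =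
    (fun Z => rot_bary (fun i => col i Z)) @` Kt.
  apply/seteqP; split => [x /= tx|_ [Z [KZ tZ] <-]].
    have [z [clz xz E]] := rearr_step_attained (lt_le_trans t0 tx).
    exists (tuple_mx z); last by rewrite col_tuple_mx.
    split=> [i|]; first by rewrite col_tuple.
    rewrite /= col_tuple_mx -E; apply: ge0_ler_powR; rewrite ?nnegrE ?(ltW p_gt0) ?(ltW t0)//.
    exact: rearr_step_ge0.
  rewrite /= leNgt; apply/negP => Wt.
  have := le_trans tZ (pow_avg_le_rearr KZ); apply/negP; rewrite -ltNge.
  by apply: gt0_ltr_powR; rewrite ?nnegrE ?(ltW t0)//; exact: rearr_step_ge0.
apply: compact_closed; first exact: norm_hausdorff.
apply: continuous_compact; first by apply: continuous_subspaceT; exact: rot_bary_continuous.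
apply: compact_closedI; first exact: K_compact.
apply: preimage_closed => [Z _|]; first exact: pow_avg_continuous.
exact: closed_ge.
Qed.

(** Moves the barycenter to x by changing z_j alone; the factor m compensates the averaging. *)
Let shift_one m (z : 'I_m -> 'cV[R]_n) (j : 'I_m) (x : 'cV[R]_n) : 'I_m -> 'cV[R]_n :=
  fun i => if i == j then z j + (rho j)^T *m (m%:R *: (x - rot_bary z)) else z i.

Let rot_bary_shift_one m (z : 'I_m -> 'cV[R]_n) j x : rot_bary (shift_one z j x) = x.
Proof.
have m0 : m%:R != 0 :> R by case: m z j => [_ []//|m' *]; rewrite pnatr_eq0.
rewrite {1}/rot_bary /barycenter (bigD1 j)//= /shift_one eqxx mulmxDr rhoTK.
rewrite (eq_bigr (fun i : 'I_m => rho i *m z i)); last by move=> i /negbTE ->.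
have S : \sum_(i < m) rho i *m z i = rho j *m z j + \sum_(i < m | i != j) rho i *m z i.
  by rewrite (bigD1 j).
rewrite addrAC -S scalerDr.
by rewrite scalerA mulVf// scale1r -/(barycenter _) -/(rot_bary z) subrKC.
Qed.

(** Some entry z_j of a maximizing tuple is interior. Moving it alone reaches every nearby y, stays
    in Omega and changes the average continuously. *)
Lemma rearr_step_superlevel_open m t : 0 <= t ->
  open [set x | t < rearr_step rho Omega u p m x].
Proof.
move=> t0; rewrite openE => x /= tx.
have W0 := le_lt_trans t0 tx.
have [z [clz xz E]] := rearr_step_attained W0.
have [j Uj] : exists j, 0 < U (z j).
  apply: contrapT => /forallNP nU; move: W0; apply/negP; rewrite -leNgt.
  have : rearr_step rho Omega u p m x `^ p = 0.
    rewrite E /pow_avg big1 ?mulr0// => i _; suff -> : (u \_ Omega) (z i) = 0 by rewrite powR0 ?gt_eqF.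
    by apply/eqP; rewrite eq_le U_ge0 andbT leNgt; apply/negP.
  by move=> /powR_eq0_eq0 ->.
have tz : t `^ p < pow_avg z.
  by rewrite -E; apply: gt0_ltr_powR; rewrite ?nnegrE// rearr_step_ge0.
pose w y := z j + (rho j)^T *m (m%:R *: (y - x)).
have d_cont : continuous (fun y : 'cV[R]_n => m%:R *: (y - x)).
  apply: scalef_continuous; apply: addf_continuous; last exact: cstf_continuous.
  by move=> y; exact: cvg_id.
have w_cont : continuous w.
  apply: addf_continuous; first exact: cstf_continuous.
  exact: compf_continuous d_cont (@mulmx_continuous _ _ _ _ (rho j)^T).
have wx : w x = z j by rewrite /w subrr scaler0 mulmx0 addr0.
pose f y := m%:R^-1 * (U (w y) `^ p + \sum_(i < m | i != j) U (z i) `^ p).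
have f_cont : continuous f.
  apply: mulf_continuous; apply: addf_continuous; last exact: cstf_continuous.
  apply: (powR_continuous p_gt0 (f := U \o w)) => [|v]; last exact: U_ge0.
  exact: compf_continuous w_cont cU.
have fx : t `^ p < f x.
  by rewrite /f wx; move: tz; rewrite /pow_avg (bigD1 j).
have H1 : \forall y \near x, t `^ p < f y by exact: continuous_near_gt.
have H2 : \forall y \near x, Omega (w y).
  by apply: continuous_near_open => //; rewrite wx; exact: U_gt0.
apply: filterS2 H1 H2 => y ty Oy.
rewrite -(rot_bary_shift_one z j y); apply: rearr_step_gt => //.
  move=> i; rewrite /shift_one; case: ifP => // _; rewrite xz; exact: subset_closure.
apply: lt_le_trans ty _; rewrite /f /pow_avg [X in _ <= _ * X](bigD1 j)//= /shift_one eqxx xz.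
rewrite le_eqVlt; apply/orP; left; apply/eqP; congr (_ * (_ + _)).
by apply: eq_bigr => i /negbTE ->.
Qed.

Lemma rearr_step_continuous m : continuous (rearr_step rho Omega u p m).
Proof.
apply: continuous_superlevels => [x|t t0|t t0]; first exact: rearr_step_ge0.
  exact: rearr_step_superlevel_closed.
exact: rearr_step_superlevel_open.
Qed.

End rearrangement_step.

(** * Convex sets, and growth of u at the boundary *)

Section convexity.
Context {R : realType}.

Lemma convex_set_comb (M : lmodType R) (A : set M) (x y : M) (t : R) :
  convex_set A -> 0 <= t <= 1 -> A x -> A y -> A (t *: x + (1 - t) *: y).
Proof.
move=> cA /andP[t0 t1] Ax Ay.
by have := cA x y (Itv01 t0 t1) (mem_set Ax) (mem_set Ay); rewrite inE.
Qed.

Lemma convex_set_mean (M : lmodType R) (A : set M) m (z : 'I_m.+1 -> M) :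
  convex_set A -> (forall i, A (z i)) -> A (m.+1%:R^-1 *: \sum_i z i).
Proof.
move=> cA; elim: m z => [|m IH] z Az; first by rewrite big_ord1 invr1 scale1r.
have t01 : 0 <= (m.+1%:R / m.+2%:R : R) <= 1.
  by rewrite divr_ge0//= ler_pdivrMr// mul1r ler_nat.
have := convex_set_comb cA t01 (IH (fun i => z (widen_ord (leqnSn _) i)) _) (Az ord_max).
move=> /(_ (fun i => Az _)); congr A.
rewrite [in RHS]big_ord_recr /= scalerDr scalerA mulrAC mulfV// mul1r; congr (_ + _ *: _).
by rewrite -[X in X - _](@mulfV _ m.+2%:R)// -mulrBl -natrB// subSnn mul1r.
Qed.

Lemma convex_closure_segment n (A : set 'cV[R]_n) x y (t : R) : open A -> convex_set A ->
  closure A x -> A y -> 0 < t <= 1 -> A (x + t *: (y - x)).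
Proof.
move=> oA cA clx Ay /andP[t0 t1].
have [->|t1'] := eqVneq t 1; first by rewrite scale1r subrKC.
have t'0 : 0 < 1 - t by rewrite subr_gt0 lt_neqAle t1' t1.
have /nbhs_enormP[r r0 rA] : nbhs y A by exact: open_nbhs_nbhs.
(* Replacing x by x' in A costs (1 - t)(x - x'), which is charged to y with weight t; the bound
   keeps the corrected endpoint within distance r of y. *)
have rt0 : 0 < r * t / (1 - t) by rewrite divr_gt0// mulr_gt0.
have [x' Ax' x'x] := (closure_enormP A x).1 clx _ rt0.
have yA : A (y + ((1 - t) / t) *: (x - x')).
  apply: rA; rewrite addrC addKr enormZ gtr0_norm ?divr_gt0//.
  rewrite -ltr_pdivlMl ?divr_gt0// invf_div; move: x'x; rewrite ltr_pdivlMr// enormB.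
  by rewrite mulrAC ltr_pdivlMr// mulrC (mulrC t).
have t01 : 0 <= t <= 1 by rewrite ltW.
have := convex_set_comb cA t01 yA Ax'; congr A.
rewrite scalerDr scalerA mulrCA mulfV ?gt_eqF// mulr1 scalerBr scalerBr.
by rewrite -addrA subrK scalerBl scale1r addrCA; congr (_ + _).
Qed.

End convexity.

Section boundary_growth.
Context {R : realType} {n : nat}.
Variables (Omega : set 'cV[R]_n) (u : 'cV[R]_n -> R).
Hypotheses (Omega_open : open Omega) (Omega_convex : convex_set Omega)
  (u_C1 : C1_on Omega u) (u_gt0 : forall x, Omega x -> 0 < u x).

(** Turns the extended-real lower limit into explicit constants; an infimum equal to +oo allows any
    c. *)
Lemma limf_einf_within_gt0 (x : 'cV[R]_n) (f : 'cV[R]_n -> R) :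
  (0 < limf_einf (fun y => (f y)%:E) (within Omega (nbhs x)))%E ->
  exists c r : R, [/\ 0 < c, 0 < r & forall y, enorm (y - x) < r -> Omega y -> c <= f y].
Proof.
rewrite limf_einfE => /ereal_sup_gt[_ [V VF <-] V0].
have [c c0 cV] : exists2 c : R, 0 < c & forall y, V y -> c <= f y.
  move: V0; case E : (ereal_inf _) => [c| |]// V0.
    exists c => // y Vy; rewrite -lee_fin -E; apply: ereal_inf_lbound.
    by exists y.
  exists 1 => // y Vy; rewrite -lee_fin; apply: (@le_trans _ _ +oo%E); first exact: leey.
  by rewrite -E; apply: ereal_inf_lbound; exists y.
have /nbhs_enormP[r r0 rV] := VF.
by exists c, r; split => // y yx Oy; apply: cV; exact: rV.
Qed.

Lemma near_at_right0 (P : set R) : (\forall s \near 0^'+, P s) ->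
  exists2 r, 0 < r & forall s, 0 < s -> s < r -> P s.
Proof.
rewrite near_withinE => /near0P[r r0 H]; exists r => // s s0 sr.
by apply: H => //; rewrite gtr0_norm.
Qed.

(** The mean value theorem is used between s / 2 and s, away from the boundary point where u need
    not be differentiable. The positive value at s / 2 is dropped, at the price of a factor 1/2 in
    c. *)
Lemma boundary_linear_growth x nu : boundary Omega x -> inward_direction Omega x nu ->
  (0 < limf_einf (fun y => ('D_nu u y)%:E) (within Omega (nbhs x)))%E ->
  exists c r : R, [/\ 0 < c, 0 < r & forall s, 0 < s -> s < r ->
    Omega (x + s *: nu) /\ c * s <= u (x + s *: nu)].
Proof.
have half_ge (a b c s : R) : 0 < b -> a - b = c * (s - s / 2) -> c / 2 * s <= a.
  by move=> ? E; have := E; nra.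
move=> bx [nu1 /near_at_right0[r1 r10 inw]] /limf_einf_within_gt0[c [r [c0 r0 cD]]].
exists (c / 2), (Num.min r1 r); split; [by rewrite divr_gt0|by rewrite lt_min r10 r0|].
move=> s s0; rewrite lt_min => /andP[sr1 sr]; split; first exact: inw.
have s2 : 0 < s / 2 by rewrite divr_gt0.
have s2s : s / 2 <= s by rewrite ler_pdivrMr// mulr_natr mulr2n lerDl ltW.
have line t : t \in `[s / 2, s] ->
    is_derive t 1 (fun t : R => u (x + t *: nu)) (dotv nu (grad u (x + t *: nu))).
  rewrite in_itv /= => /andP[t0 ts]; apply: (is_derive_line_C1 Omega_open u_C1).
  by apply: inw; [exact: lt_le_trans t0|exact: le_lt_trans sr1].
have line' t : t \in `]s / 2, s[ ->
    is_derive t 1 (fun t : R => u (x + t *: nu)) (dotv nu (grad u (x + t *: nu))).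
  by move=> /subset_itv_oo_cc; exact: line.
have cont : {within `[s / 2, s], continuous (fun t : R => u (x + t *: nu))}.
  by apply: derivable_within_continuous => t /line[].
have [t] := MVT_segment s2s line' cont; rewrite in_itv /= => /andP[t0 ts] E.
have Ot : Omega (x + t *: nu).
  by apply: inw; [exact: lt_le_trans t0|exact: le_lt_trans sr1].
have Dt : c <= dotv nu (grad u (x + t *: nu)).
  have [_ <-] := is_derive_C1 nu Omega_open u_C1 Ot; apply: cD => //.
  rewrite addrC addKr enormZ nu1 mulr1 gtr0_norm; first exact: le_lt_trans sr.
  exact: lt_le_trans t0.
have u2 : 0 < u (x + (s / 2) *: nu).
  by apply: u_gt0; apply: inw => //; exact: le_lt_trans sr1.
apply: le_trans (half_ge _ _ _ s u2 E).
by rewrite ler_wpM2r ?(ltW s0)// ler_wpM2r// invr_ge0.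
Qed.

End boundary_growth.

Section interior_maximizers.
Context {R : realType} {n : nat}.
Variables (Omega : set 'cV[R]_n) (u : 'cV[R]_n -> R) (p : R) (rho : nat -> 'M[R]_n).
Hypotheses (Omega_neq0 : Omega !=set0) (Omega_bounded : bounded_set Omega)
  (Omega_open : open Omega) (Omega_convex : convex_set Omega)
  (u_C2 : C2_on Omega u) (u_dirichlet : positive_zero_boundary Omega u)
  (u_normal : forall x nu, boundary Omega x -> inward_direction Omega x nu ->
      (0 < limf_einf (fun y => ('D_nu u y)%:E) (within Omega (nbhs x)))%E)
  (p_gt0 : 0 < p) (p_lt1 : p < 1) (rho_SO : forall i, special_orthogonal (rho i)).

Let u_gt0 x : Omega x -> 0 < u x. Proof. by case: u_dirichlet => _ _; exact. Qed.

Lemma inward_direction_exists x : boundary Omega x ->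
  exists nu, inward_direction Omega x nu.
Proof.
move=> [clx]; rewrite ((interior_id Omega).1 Omega_open) => nOx.
have [y Oy] := Omega_neq0.
have xy : 0 < enorm (y - x).
  by rewrite enorm_gt0 subr_eq0; apply/eqP => E; apply: nOx; rewrite -E.
exists ((enorm (y - x))^-1 *: (y - x)); split.
  by rewrite enormZ gtr0_norm ?invr_gt0// mulVf// gt_eqF.
near=> s; rewrite scalerA; apply: convex_closure_segment => //.
apply/andP; split; first by rewrite divr_gt0.
by rewrite ler_pdivrMr// mul1r; near: s; exact: nbhs_right_le.
Unshelve. all: by end_near. Qed.

Lemma not_linear_le_powR (c C r : R) : 0 < c -> 0 < r -> p < 1 ->
  exists s, [/\ 0 < s, s < r & C * s < (c * s) `^ p].
Proof.
move=> c0 r0 p1; have p1' : 0 < 1 - p by rewrite subr_gt0.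
have C1 : 0 < `|C| + 1 by rewrite ltr_wpDl.
(* For s at most d one has (|C| + 1) s^(1-p) <= c^p, and multiplying by s^p gives the claim. *)
pose d := (c `^ p / (`|C| + 1)) `^ (1 - p)^-1.
have d0 : 0 < d by rewrite powR_gt0// divr_gt0// powR_gt0.
pose s := Num.min (r / 2) d.
have s0 : 0 < s by rewrite lt_min d0 divr_gt0.
exists s; split => //.
  by rewrite gt_min ltr_pdivrMr// ltr_pMr// ltr1n.
have sd : s `^ (1 - p) <= c `^ p / (`|C| + 1).
  have <- : d `^ (1 - p) = c `^ p / (`|C| + 1).
    by rewrite /d -powRrM mulVf ?gt_eqF// powRr1// divr_ge0 ?powR_ge0 ?(ltW C1).
  apply: ge0_ler_powR; rewrite ?nnegrE ?(ltW p1') ?(ltW s0) ?(ltW d0)//.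
  by rewrite ge_min lexx orbT.
rewrite powRM ?(ltW c0) ?(ltW s0)//; apply: (@lt_le_trans _ _ ((`|C| + 1) * s)).
  by rewrite ltr_pM2r//; have := ler_norm C; lra.
have sE : s = s `^ (1 - p) * s `^ p.
  by rewrite -powRD ?subrK ?powRr1 ?(ltW s0)//; apply/implyP => _; rewrite gt_eqF.
rewrite [X in _ * X <= _]sE mulrA ler_wpM2r ?powR_ge0//; move: sd.
by rewrite ler_pdivlMr// mulrC.
Qed.

(* If z_i were a boundary point, moving it inwards by s would raise u(z_i)^p by at *)
(* least (c s)^p, while the compensating shift of an interior z_j costs O(s).      *)
Lemma maximizer_interior m x (z : 'I_m -> 'cV[R]_n) :
  0 < rearr_step rho Omega u p m x -> (forall i, closure Omega (z i)) ->
  rot_bary rho z = x -> rearr_step rho Omega u p m x `^ p = pow_avg Omega u p z ->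
  forall i, Omega (z i).
Proof.
move=> W0 clz xz E i; apply: contrapT => nOzi.
have u_E y : Omega y -> (u \_ Omega) y = u y by move=> Oy; rewrite patchE mem_set.
have Uzi : (u \_ Omega) (z i) = 0 by rewrite patchE memNset.
have m0 : 0 < m%:R :> R by rewrite ltr0n; case: m {x z W0 clz xz E nOzi Uzi} i => [[]|].
have [j Ozj] : exists j, Omega (z j).
  apply: contrapT => /forallNP nO; have := powR_gt0 p W0.
  rewrite E /pow_avg big1 ?mulr0 ?ltxx// => k _.
  by rewrite patchE memNset ?powR0// gt_eqF.
have ij : i != j by apply/eqP => ij; apply: nOzi; rewrite ij.
have bzi : boundary Omega (z i).
  by split; [exact: clz|rewrite ((interior_id Omega).1 Omega_open)].
have [nu inw] := inward_direction_exists bzi.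
have [c [r [c0 r0 Hi]]] := boundary_linear_growth Omega_open u_C2.1 u_gt0 bzi inw
  (u_normal bzi inw).
(* In rotated coordinates this cancels the displacement of z_i along [nu], so the barycenter stays
   at x. *)
pose h := - ((rho j)^T *m (rho i *m nu)).
have jet := jet2_powR p (g := fun s : R => u (z j + s *: h)) _
  (jet2_line h Omega_open u_C2 Ozj).
have {jet}[] := jet; first by rewrite scale0r addr0; exact: u_gt0.
move=> dg [/nbhs_singleton Hj dgE _].
have /(_ 1 ltr01) H1 := (is_derive0P _ _).1 Hj.
have H2 : \forall s \near (0 : R), Omega (z j + s *: h).
  by apply: near_line; exact: open_nbhs_nbhs.
have [r' r'0 H] := (near0P _).1 (filterI H1 H2).
have rr' : 0 < Num.min r r' by rewrite lt_min r0 r'0.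
(* The constant bounds the loss at z_j: the derivative of the p-th power of u along h, plus 1 for
   the first order error. *)
have [s [s0 + sp]] := not_linear_le_powR (`|dg 0| + 1) c0 rr' p_lt1.
rewrite lt_min => /andP[sr sr'].
have [Ozi' cs] := Hi s s0 sr.
have /H[/= Hs Ozj'] : `|s| < r' by rewrite gtr0_norm.
pose z' k := if k == i then z i + s *: nu else if k == j then z j + s *: h else z k.
have ji : (j == i) = false by rewrite eq_sym; exact: negbTE.
have clz' k : closure Omega (z' k).
  by rewrite /z'; case: ifP => _; [exact: subset_closure|case: ifP => _ //; exact: subset_closure].
have split2 (V : zmodType) (f : 'I_m -> V) :
    \sum_k f k = f i + (f j + \sum_(k | (k != i) && (k != j)) f k).
  by rewrite (bigD1 i)//= (bigD1 j) ?ji.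
have z'k k : (k != i) && (k != j) -> z' k = z k.
  by rewrite /z' => /andP[/negbTE -> /negbTE ->].
have z'i : z' i = z i + s *: nu by rewrite /z' eqxx.
have z'j : z' j = z j + s *: h by rewrite /z' ji eqxx.
have xz' : rot_bary rho z' = x.
  rewrite -xz /rot_bary /barycenter; congr (_ *: _); rewrite !split2 z'i z'j.
  rewrite (eq_bigr (fun k : 'I_m => rho k *m z k)); last by move=> k /z'k ->.
  have hj (v : 'cV[R]_n) : rho j *m ((rho j)^T *m v) = v.
    by have [hj _] := rho_SO j; rewrite mulmxA hj mul1mx.
  rewrite !addrA; congr (_ + _); rewrite !mulmxDr -!scalemxAr /h mulmxN hj.
  by rewrite scalerN addrA addrAC addrK.
have := pow_avg_le_rearr Omega_bounded Omega_open u_dirichlet p_gt0 rho_SO clz'.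
rewrite xz' E /pow_avg ler_pM2l ?invr_gt0// !split2.
rewrite (eq_bigr (fun k => (u \_ Omega) (z k) `^ p)); last by move=> k /z'k ->.
rewrite !addrA lerD2r z'i z'j Uzi !u_E// powR0 ?gt_eqF// add0r.
apply/negP; rewrite -ltNge.
have cs' : (c * s) `^ p <= u (z i + s *: nu) `^ p.
  apply: ge0_ler_powR; rewrite ?nnegrE ?(ltW p_gt0)//; last by rewrite ltW// u_gt0.
  by rewrite mulr_ge0 ?ltW.
move: Hs; rewrite scale0r addr0 mul1r (gtr0_norm s0) ler_norml => /andP[Hs _].
have dgs : - (`|dg 0| * s) <= dg 0 * s.
  by rewrite -mulNr ler_pM2r// lerNl; have := ler_norm (- dg 0); rewrite normrN.
move: sp cs' Hs dgs; rewrite mulrDl mul1r.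
move: (dg 0 * s) (`|dg 0| * s) (u _ `^ p) (u _ `^ p) (u _ `^ p) (_ `^ p) => a b d e f g.
lra.
Qed.

End interior_maximizers.

(** * The subsolution property *)

Section viscosity_step.
Context {R : realType} {n : nat}.
Variables (Omega : set 'cV[R]_n) (F : operator R n) (u : 'cV[R]_n -> R) (p : R)
  (rho : nat -> 'M[R]_n).
Hypotheses (Omega_neq0 : Omega !=set0) (Omega_bounded : bounded_set Omega)
  (Omega_open : open Omega) (Omega_convex : convex_set Omega)
  (F_elliptic : op_degenerate_elliptic F) (F_rotation : op_rotation_invariant F)
  (u_solution : classical_solution F Omega u) (u_dirichlet : positive_zero_boundary Omega u)
  (u_normal : forall x nu, boundary Omega x -> inward_direction Omega x nu ->
      (0 < limf_einf (fun y => ('D_nu u y)%:E) (within Omega (nbhs x)))%E)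
  (p_gt0 : 0 < p) (p_lt1 : p < 1)
  (F_convex : forall theta : 'cV[R]_n, convex_set (op_power_superlevel F p theta))
  (rho_SO : forall i, special_orthogonal (rho i)).

Let u_gt0 x : Omega x -> 0 < u x. Proof. by case: u_dirichlet => _ _; exact. Qed.

Let rhoTK i (x : 'cV[R]_n) : rho i *m ((rho i)^T *m x) = x.
Proof. by have [h _] := rho_SO i; rewrite mulmxA h mul1mx. Qed.

Let dotv_rhoT i (x y : 'cV[R]_n) : dotv ((rho i)^T *m x) y = dotv x (rho i *m y).
Proof. by rewrite dotv_mulmx. Qed.

Let powD (y r s : R) : 0 < y -> y `^ r * y `^ s = y `^ (r + s).
Proof. by move=> y0; rewrite powRD//; apply/implyP => _; rewrite gt_eqF. Qed.

Section touching.
Variables (m : nat) (x : 'cV[R]_n) (z : 'I_m -> 'cV[R]_n) (A : set 'cV[R]_n)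
  (phi : 'cV[R]_n -> R).
Let W := rearr_step rho Omega u p m.
Hypotheses (Oz : forall i, Omega (z i)) (xz : rot_bary rho z = x)
  (Wz : W x `^ p = pow_avg Omega u p z) (W_gt0 : 0 < W x)
  (A_open : open A) (Ax : A x) (phi_C2 : C2_on A phi) (phix : phi x = W x)
  (W_le_phi : \forall y \near x, W y <= phi y).

Let m_gt0 : 0 < m%:R :> R.
Proof.
rewrite ltr0n lt0n; apply/eqP => m0; have := powR_gt0 p W_gt0.
have minv : m%:R^-1 = 0 :> R by rewrite m0 invr0.
by rewrite Wz /pow_avg minv mul0r ltxx.
Qed.

Let m_neq0 : m%:R != 0 :> R. Proof. by rewrite gt_eqF. Qed.

Let uE y : Omega y -> (u \_ Omega) y = u y.
Proof. by move=> Oy; rewrite patchE mem_set. Qed.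

(* phi(x + s h)^p - (1/m) sum_i u(z_i + s a_i rho_i^T h)^p is minimal at s = 0 *)
(* whenever the speeds a_i have mean 1.                                        *)
Lemma touching_variation (a : 'I_m -> R) (h : 'cV[R]_n) : \sum_i a i = m%:R ->
  p * W x `^ (p - 1) * dotv h (grad phi x) =
    m%:R^-1 * \sum_i p * u (z i) `^ (p - 1) * (a i * dotv h (rho i *m grad u (z i))) /\
  m%:R^-1 * \sum_i (p * u (z i) `^ (p - 1)
        * (a i ^+ 2 * dotv h (rho i *m hess u (z i) *m (rho i)^T *m h))
      + p * (p - 1) * u (z i) `^ (p - 2) * (a i * dotv h (rho i *m grad u (z i))) ^+ 2) <=
    p * W x `^ (p - 1) * dotv h (hess phi x *m h)
      + p * (p - 1) * W x `^ (p - 2) * dotv h (grad phi x) ^+ 2.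
Proof.
move=> sum_a.
have [u_C2 _] := u_solution.
pose k (i : 'I_m) : 'cV[R]_n := a i *: ((rho i)^T *m h).
pose f (i : 'I_m) (s : R) := u (z i + s *: k i) `^ p.
pose g (s : R) := phi (x + s *: h) `^ p.
have jf i : jet2 (f i) (p * u (z i) `^ (p - 1) * (a i * dotv h (rho i *m grad u (z i))))
    (p * u (z i) `^ (p - 1)
        * (a i ^+ 2 * dotv h (rho i *m hess u (z i) *m (rho i)^T *m h))
      + p * (p - 1) * u (z i) `^ (p - 2) * (a i * dotv h (rho i *m grad u (z i))) ^+ 2).
  have := jet2_powR p (g := fun s : R => u (z i + s *: k i)) _
    (jet2_line (k i) Omega_open u_C2 (Oz i)).
  rewrite scale0r addr0 => /(_ (u_gt0 (Oz i))).
  congr (jet2 _ _ _).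
    by rewrite /k dotvZl dotv_rhoT.
  rewrite /k -scalemxAr !dotvZl dotvZr !dotv_rhoT !mulmxA; congr (_ * _ + _).
  by rewrite mulrA -expr2.
have jg : jet2 g (p * W x `^ (p - 1) * dotv h (grad phi x))
    (p * W x `^ (p - 1) * dotv h (hess phi x *m h)
      + p * (p - 1) * W x `^ (p - 2) * dotv h (grad phi x) ^+ 2).
  have := jet2_powR p (g := fun s : R => phi (x + s *: h)) _ (jet2_line h A_open phi_C2 Ax).
  by rewrite scale0r addr0 phix => /(_ W_gt0).
have J := jet2D jg (jet2Z (- m%:R^-1) (jet2_sum (index_enum 'I_m) jf)).
have f0 : m%:R^-1 * \sum_i f i 0 = W x `^ p.
  rewrite Wz /pow_avg; congr (_ * _); apply: eq_bigr => i _.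
  by rewrite /f scale0r addr0 uE.
have H1 : \forall s \near (0 : R), W (x + s *: h) <= phi (x + s *: h).
  by apply: (@near_line _ _ x h [set y | W y <= phi y]); exact: W_le_phi.
have /filter_forall H2 i : \forall s \near (0 : R), Omega (z i + s *: k i).
  by apply: (@near_line _ _ (z i) (k i) Omega); exact: open_nbhs_nbhs.
have [|E1 E2] := jet2_min J.
  apply: filterS2 H1 H2 => s Ws Os.
  rewrite /= /GRing.scale/= !mulNr f0 /g scale0r addr0 phix subrr subr_ge0.
  have xs : rot_bary rho (fun i => z i + s *: k i) = x + s *: h.
    rewrite -xz /rot_bary /barycenter.
    under eq_bigr do rewrite mulmxDr.
    rewrite big_split /= scalerDr; congr (_ + _).
    rewrite (eq_bigr (fun i => (a i * s) *: h)); last first.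
      by move=> i _; rewrite /k -!scalemxAr rhoTK scalerA mulrC.
    by rewrite -scaler_suml -mulr_suml sum_a scalerA mulrA mulVf// mul1r.
  have clz i : closure Omega (z i + s *: k i) by apply: subset_closure; exact: Os.
  have := pow_avg_le_rearr Omega_bounded Omega_open u_dirichlet p_gt0 rho_SO clz.
  rewrite xs /pow_avg => H.
  apply: (@le_trans _ _ (W (x + s *: h) `^ p)).
    apply: le_trans H; rewrite le_eqVlt; apply/orP; left; apply/eqP; congr (_ * _).
    by apply: eq_bigr => i _; rewrite /f uE.
  have W0 := rearr_step_ge0 Omega_bounded Omega_open u_dirichlet p_gt0 rho_SO m (x + s *: h).
  apply: ge0_ler_powR; rewrite ?nnegrE ?(ltW p_gt0)//.
  exact: le_trans W0 Ws.
split.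
  by apply/eqP; rewrite -subr_eq0 -mulNr E1.
by rewrite -subr_ge0 -mulNr.
Qed.

Let theta := W x `^ (p - 1) *: grad phi x.

Lemma touching_gradient i : u (z i) `^ (p - 1) *: (rho i *m grad u (z i)) = theta.
Proof.
have H h : dotv h (u (z i) `^ (p - 1) *: (rho i *m grad u (z i))) = dotv h theta.
  have [|E _] := @touching_variation (fun j => if j == i then m%:R else 0) h.
    by rewrite (bigD1 i)//= eqxx big1 ?addr0// => j /negbTE ->.
  move: E; rewrite (bigD1 i)//= eqxx big1 ?addr0; last first.
    by move=> j /negbTE ->; rewrite mul0r mulr0.
  rewrite !dotvZr => E; apply: (mulfI (lt0r_neq0 p_gt0)).
  rewrite mulrA [RHS]mulrA E; field.
  exact: m_neq0.
apply/matrixP => k l; rewrite ord1.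
have := H (basis_cV k); rewrite !(dotvC (basis_cV k)) !dotv_delta.
exact.
Qed.

Let pow_sq (y r : R) : (y `^ r) ^+ 2 = y `^ (r + r).
Proof. by rewrite -powR_mulrn ?powR_ge0// -powRrM mulr_natr mulr2n. Qed.

(** The factor u^(p-1) multiplies the Hessian term and the squared weight contributes u^(2p), whence
    the exponent 3p - 1; the power of W(x) on the left collects the normalization of the weights and
    the factor W(x)^(p-1) of the Hessian of phi. *)
Lemma touching_hessian h :
  W x `^ (1 - p * 3) * (m%:R^-1 * \sum_i u (z i) `^ (p * 3 - 1)
     * dotv h (rho i *m hess u (z i) *m (rho i)^T *m h)) <= dotv h (hess phi x *m h).
Proof.
set t := W x `^ p; have t0 : 0 < t by exact: powR_gt0.
pose a (i : 'I_m) := u (z i) `^ p / t.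
have sum_t : \sum_i u (z i) `^ p = m%:R * t.
  rewrite /t Wz /pow_avg mulrA mulfV// mul1r.
  by apply: eq_bigr => i _; rewrite uE.
have sum_a : \sum_i a i = m%:R by rewrite -mulr_suml sum_t mulfK// gt_eqF.
have [_] := touching_variation h sum_a.
pose tau := dotv h theta.
have gphi : dotv h (grad phi x) = W x `^ (1 - p) * tau.
  rewrite /tau dotvZr mulrA powD// addrA subrK subrr powRr0 mul1r//.
have gu (i : 'I_m) : dotv h (rho i *m grad u (z i)) = u (z i) `^ (1 - p) * tau.
  rewrite /tau -(touching_gradient i) dotvZr mulrA powD ?u_gt0//.
  by rewrite addrA subrK subrr powRr0 mul1r.
have E1 : p * (p - 1) * W x `^ (p - 2) * dotv h (grad phi x) ^+ 2 =
    p * (p - 1) * tau ^+ 2 * t^-1.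
  have -> : t^-1 = W x `^ (p - 2) * W x `^ (1 - p + (1 - p)).
    by rewrite powD// /t -powRN; congr (_ `^ _); ring.
  by rewrite gphi exprMn pow_sq; ring.
have E2 (i : 'I_m) : p * (p - 1) * u (z i) `^ (p - 2)
    * (a i * dotv h (rho i *m grad u (z i))) ^+ 2 =
    p * (p - 1) * tau ^+ 2 * t^-1 ^+ 2 * u (z i) `^ p.
  rewrite gu /a !exprMn !pow_sq.
  have -> : u (z i) `^ p = u (z i) `^ (p - 2) * u (z i) `^ (1 - p + (1 - p)) * u (z i) `^ (p + p).
    rewrite powD ?u_gt0// powD ?u_gt0//; congr (_ `^ _); ring.
  ring.
rewrite big_split /= (eq_bigr _ (fun i _ => E2 i)) -mulr_sumr sum_t E1 mulrDr.
rewrite (_ : m%:R^-1 * (p * (p - 1) * tau ^+ 2 * t^-1 ^+ 2 * (m%:R * t)) =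
    p * (p - 1) * tau ^+ 2 * t^-1); last first.
  field; by rewrite m_neq0 gt_eqF.
(* The gradient terms of both sides have become p (p - 1) tau^2 / t and cancel. *)
rewrite lerD2r => H.
have c0 : 0 < p^-1 * W x `^ (1 - p) by rewrite mulr_gt0 ?invr_gt0 ?powR_gt0.
have {}H := ler_wpM2l (ltW c0) H.
have ER : p^-1 * W x `^ (1 - p) * (p * W x `^ (p - 1) * dotv h (hess phi x *m h)) =
    dotv h (hess phi x *m h).
  rewrite (_ : _ * _ = p^-1 * p * (W x `^ (1 - p) * W x `^ (p - 1)) * dotv h (hess phi x *m h)).
    by rewrite powD// addrA subrK subrr powRr0 mulVf ?gt_eqF// !mul1r.
  ring.
rewrite ER in H; apply: le_trans H.
rewrite le_eqVlt; apply/orP; left; apply/eqP.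
rewrite mulrCA [RHS]mulrCA; congr (_ * _); rewrite !mulr_sumr; apply: eq_bigr => i _.
rewrite /a /t exprMn -powRN !pow_sq.
have -> : W x `^ (1 - p * 3) = W x `^ (1 - p) * W x `^ (- p + - p).
  by rewrite powD//; congr (_ `^ _); ring.
have -> : u (z i) `^ (p * 3 - 1) = u (z i) `^ (p - 1) * u (z i) `^ (p + p).
  by rewrite powD ?u_gt0//; congr (_ `^ _); ring.
by field; rewrite gt_eqF.
Qed.

End touching.

Lemma sum_triple (V1 V2 V3 : zmodType) (I : Type) (r : seq I) (a : I -> V1) (b : I -> V2)
    (d : I -> V3) :
  \sum_(i <- r) (a i, b i, d i) =
    (\sum_(i <- r) a i, \sum_(i <- r) b i, \sum_(i <- r) d i).
Proof. by elim: r => [|i r IH]; rewrite ?big_nil// !big_cons IH. Qed.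

Let powK (y r s : R) : 0 <= y -> r * s = 1 -> (y `^ r) `^ s = y.
Proof. by move=> y0 rs; rewrite -powRrM rs powRr1. Qed.

(** The domain A of the test function is arbitrary, so that the statement can later be used in the
    limit ball, which need not lie in the rotation mean. *)
Lemma rearr_step_viscosity m x A phi : open A -> A x -> C2_on A phi ->
  phi x = rearr_step rho Omega u p m x -> 0 < phi x ->
  (\forall y \near x, rearr_step rho Omega u p m y <= phi y) ->
  0 <= F x (phi x) (grad phi x) (hess phi x).
Proof.
move=> oA Ax C2phi phix phi0 W_le.
set W := rearr_step rho Omega u p m in phix W_le; have W0 : 0 < W x by rewrite -phix.
have [u_C2 Fu0] := u_solution.
have pV : p * p^-1 = 1 by rewrite mulfV// gt_eqF.
case: m @W phix W_le W0 => [|m] W phix W_le W0.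
  have [z [_ _]] := rearr_step_attained Omega_bounded Omega_open u_dirichlet p_gt0 rho_SO W0.
  rewrite /pow_avg big_ord0 mulr0 => E.
  by have := powR_gt0 p W0; rewrite /W E ltxx.
have [z [clz xz Wz]] :=
  rearr_step_attained Omega_bounded Omega_open u_dirichlet p_gt0 rho_SO W0.
have Oz := maximizer_interior Omega_neq0 Omega_bounded Omega_open Omega_convex u_C2
  u_dirichlet u_normal p_gt0 p_lt1 rho_SO W0 clz xz Wz.
have grad_z := touching_gradient Oz xz Wz W0 oA Ax C2phi phix W_le.
have hess_z := touching_hessian Oz xz Wz W0 oA Ax C2phi phix W_le.
pose t (i : 'I_m.+1) : R := u (z i) `^ p.
pose M (i : 'I_m.+1) : 'M[R]_n := rho i *m hess u (z i) *m (rho i)^T.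
pose N (i : 'I_m.+1) : 'M[R]_n := u (z i) `^ (p * 3 - 1) *: M i.
set theta := W x `^ (p - 1) *: grad phi x in grad_z.
have sM (i : 'I_m.+1) : symmx (M i).
  by rewrite /symmx /M !trmx_mul trmxK (hess_sym Omega_open u_C2 (Oz i)) mulmxA.
(* With t = u(z_i)^p the powers in [op_power_superlevel] undo those in theta and N_i, so F is
   evaluated at the rotated jet of u at z_i, where it vanishes. *)
pose P (i : 'I_m.+1) : 'cV[R]_n * R^o * 'M[R]_n := (rho i *m z i, t i, N i).
have mem i : op_power_superlevel F p theta (P i).
  have u0 := u_gt0 (Oz i); rewrite /op_power_superlevel /=; split; first exact: powR_gt0.
    by rewrite /symmx /N linearZ /= sM.
  rewrite powK ?(ltW u0)// /N -(grad_z i) !scalerA /t -!powRrM !powD//.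
  rewrite (_ : p * (p^-1 - 1) + (p - 1) = 0); last by rewrite mulrBr pV; ring.
  rewrite (_ : p * (p^-1 - 3) + (p * 3 - 1) = 0); last by rewrite mulrBr pV; ring.
  rewrite !powRr0 !scale1r F_rotation; [|exact: rho_SO|exact: hess_sym (Oz i)].
  by rewrite -/(op_at F u (z i)) Fu0.
have := convex_set_mean (@F_convex theta) mem.
pose Nm : 'M[R]_n := m.+1%:R^-1 *: \sum_i N i.
have -> : m.+1%:R^-1 *: (\sum_i P i) = (x, W x `^ p, Nm).
  rewrite /P sum_triple; congr (_, _, _); first exact: xz.
  rewrite Wz /pow_avg; congr (_ * _).
  by apply: eq_bigr => i _; rewrite patchE mem_set.
case=> /= _ sN; rewrite powK ?(ltW W0)// scalerA -!powRrM powD//.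
rewrite (_ : p * (p^-1 - 1) + (p - 1) = 0); last by rewrite mulrBr pV; ring.
rewrite (_ : p * (p^-1 - 3) = 1 - p * 3); last by rewrite mulrBr pV.
(* At the mean of the triples the matrix argument is exactly the lower bound of [touching_hessian],
   and ellipticity replaces it by the Hessian of phi. *)
rewrite powRr0 scale1r phix => F0; apply: (le_trans F0).
apply: F_elliptic; first by rewrite /symmx linearZ /= sN.
  exact: hess_sym oA C2phi Ax.
move=> h; rewrite mulmxBl dotvBr subr_ge0; apply: le_trans (hess_z h).
rewrite le_eqVlt; apply/orP; left; apply/eqP.
rewrite /Nm -!scalemxAl !dotvZr; congr (_ * (_ * _)).
rewrite mulmx_suml dotv_sumr; apply: eq_bigr => i _.
by rewrite /N -scalemxAl dotvZr.
Qed.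

End viscosity_step.

(** * Superlevel sets and lower bounds for the rearrangement steps *)

Section level_sets.
Context {R : realType} {n : nat}.
Variables (Omega : set 'cV[R]_n) (u : 'cV[R]_n -> R) (p : R) (rho : nat -> 'M[R]_n).
Hypotheses (Omega_neq0 : Omega !=set0) (Omega_bounded : bounded_set Omega)
  (Omega_open : open Omega) (Omega_convex : convex_set Omega)
  (u_dirichlet : positive_zero_boundary Omega u)
  (p_gt0 : 0 < p) (rho_SO : forall i, special_orthogonal (rho i)).

Let U : 'cV[R]_n -> R := u \_ Omega.

Let cU : continuous U. Proof. exact: zero_extension_continuous. Qed.

Let U_ge0 x : 0 <= U x.
Proof.
rewrite /U patchE; case: ifPn => //; rewrite inE => Ox.
by have [_ _ u0] := u_dirichlet; rewrite ltW ?u0.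
Qed.

Let U_gt0 x : 0 < U x -> Omega x.
Proof.
by rewrite /U patchE; case: ifPn => //; [rewrite inE|rewrite ltxx].
Qed.

Lemma bounded_set_enorm : exists2 N, 0 < N & forall x, Omega x -> enorm x <= N.
Proof.
have [N [_ ON]] := Omega_bounded.
exists (n.+1%:R * (`|N| + 1)) => [|x Ox]; first by rewrite mulr_gt0// ltr_wpDl.
have N1 : N < `|N| + 1 by have := ler_norm N; lra.
apply: le_trans (enorm_le_norm _) _; apply: ler_pM => //; first by rewrite ler_nat.
exact: ON Ox.
Qed.

Lemma pow_avg_ge m (z : 'I_m.+1 -> 'cV[R]_n) d : 0 <= d -> (forall i, d <= U (z i)) ->
  d `^ p <= pow_avg Omega u p z.
Proof.
move=> d0 dz; rewrite /pow_avg mulrC ler_pdivlMr//.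
rewrite -[m.+1 in leLHS]card_ord mulr_natr -sumr_const; apply: ler_sum => i _.
by apply: ge0_ler_powR; rewrite ?nnegrE ?(ltW p_gt0)//; exact: dz.
Qed.

Lemma pow_avg_gt m (z : 'I_m.+1 -> 'cV[R]_n) t : 0 <= t -> (forall i, t < U (z i)) ->
  t `^ p < pow_avg Omega u p z.
Proof.
move=> t0 tz; rewrite /pow_avg mulrC ltr_pdivlMr//.
rewrite -[m.+1 in ltLHS]card_ord mulr_natr -sumr_const; apply: ltr_sum => [|i _].
  by apply/hasP; exists ord0 => //; exact: mem_index_enum.
by apply: gt0_ltr_powR; rewrite ?nnegrE//; exact: tz.
Qed.

(** The barycenter of points taken from the rotated copies of the set where u > t has step value
    above t, and all these copies have the same measure. *)
Lemma leb_superlevel_le m (t : R) : 0 <= t ->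
  (leb [set x | (t < U x)%R] <= leb [set x | (t < rearr_step rho Omega u p m.+1 x)%R])%E.
Proof.
move=> t0; have [N N0 ON] := bounded_set_enorm.
have openU : open [set x | t < U x].
  rewrite openE => x /= tx; exact: continuous_near_gt cU tx.
have mU := cV_open_measurable openU.
have U_fin : (leb [set x | (t < U x)%R] < +oo)%E.
  by apply: (leb_bounded_lty mU) => x /(le_lt_trans t0)/U_gt0; exact: ON.
have [->|U_neq0] := eqVneq (leb [set x | t < U x]) 0%E; first exact: measure_ge0.
have c0 : 0 < fine (leb [set x | t < U x]).
  by rewrite fine_gt0// U_fin andbT lt_neqAle eq_sym U_neq0 measure_ge0.
have cE : (fine (leb [set x | t < U x]))%:E = leb [set x | t < U x].
  by rewrite fineK// ge0_fin_numE.
pose V i : set 'cV[R]_n := [set x | t < U ((rho i)^T *m x)].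
rewrite -cE; apply: (leb_barycenter c0 (V := V) (N := N)) => [i|i x /=|i||].
- have cUi : continuous (fun x => U ((rho i)^T *m x)).
    exact: compf_continuous (@mulmx_continuous _ _ _ _ (rho i)^T) cU.
  rewrite openE => x /= tx; exact: continuous_near_gt cUi tx.
- move=> /(le_lt_trans t0)/U_gt0/ON xN j; apply: le_trans (coord_le_enorm _ _) _.
  by rewrite -(enorm_orthogonal (rho := (rho i)^T))// trmxK; case: (rho_SO i).
- rewrite cE le_eqVlt; apply/orP; left; apply/eqP; apply/esym.
  apply: (leb_orthogonal (rho := (rho i)^T) _ (A := [set x | t < U x])) => //.
  by rewrite trmxK; case: (rho_SO i).
- by apply: cV_open_measurable; exact: rearr_step_superlevel_open.
- move=> y Vy; pose z (i : 'I_m.+1) := (rho i)^T *m y i.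
  have -> : barycenter y = rot_bary rho z.
    rewrite /rot_bary; congr barycenter; apply/funext => i.
    by have [h _] := rho_SO i; rewrite /z mulmxA h mul1mx.
  apply: rearr_step_gt => // [i|]; last exact: pow_avg_gt.
  by apply: subset_closure; apply: U_gt0; apply: le_lt_trans (Vy i).
Qed.

(* The homothetic image of closure Omega with center x0 and ratio 1 - tau is a   *)
(* compact subset of Omega, on which u is bounded below.                         *)
Lemma rearr_step_lower_bound (x0 : 'cV[R]_n) (tau : R) : Omega x0 -> 0 < tau <= 1 ->
  exists2 d, 0 < d & forall m (z : 'I_m.+1 -> 'cV[R]_n), (forall i, closure Omega (z i)) ->
    d <= rearr_step rho Omega u p m.+1
           (rot_bary rho z + tau *: (rot_bary rho (fun _ : 'I_m.+1 => x0) - rot_bary rho z)).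
Proof.
move=> Ox0 tau01.
pose f y := U (y + tau *: (x0 - y)).
have cd : continuous (fun y : 'cV[R]_n => x0 - y).
  apply: (addf_continuous (f := fun=> x0) (g := fun y : 'cV[R]_n => - y)).
    exact: cstf_continuous.
  exact: opp_continuous.
have cl : continuous (fun y : 'cV[R]_n => y + tau *: (x0 - y)).
  by apply: addf_continuous; [move=> y; exact: cvg_id|exact: scalef_continuous].
have cf : continuous f by exact: compf_continuous cl cU.
have K0 : closure Omega !=set0 by exists x0; exact: subset_closure.
have cK : compact (closure Omega).
  apply: mx_bounded_closed_compact; last exact: closed_closure.
  have [N N0 ON] := bounded_set_enorm.
  exists (N + 1); split=> [|N' NN' x clx /=]; first exact: num_real.
  have [y Oy yx] := (closure_enormP _ _).1 clx 1 ltr01.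
  have := ON y Oy; have := norm_le_enorm x; have := enormD y (x - y).
  by rewrite subrKC enormB; move: NN' yx; lra.
have [|y yK ymin] := compact_EVT_min K0 cK (f := f).
  exact: continuous_subspaceT.
have clOf y' : closure Omega y' -> Omega (y' + tau *: (x0 - y')).
  by move=> cly'; apply: convex_closure_segment.
exists (f y).
  rewrite /f /U patchE mem_set; last by apply: clOf; rewrite inE in yK.
  by have [_ _ u0] := u_dirichlet; apply: u0; apply: clOf; rewrite inE in yK.
move=> m z clz.
rewrite (_ : _ + _ = rot_bary rho (fun i => z i + tau *: (x0 - z i))); last first.
  rewrite /rot_bary /barycenter -scalerBr scalerA mulrC -scalerA -scalerDr; congr (_ *: _).
  rewrite -sumrB scaler_sumr -big_split /=; apply: eq_bigr => i _.
  by rewrite mulmxDr -scalemxAr mulmxBr.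
rewrite leNgt; apply/negP => W_lt.
have := @pow_avg_ge m (fun i => z i + tau *: (x0 - z i)) (f y) (U_ge0 _) _.
move=> /(_ (fun i => ymin _ (mem_set (clz i)))).
have clz' i : closure Omega (z i + tau *: (x0 - z i)).
  by apply: subset_closure; exact: clOf.
have := pow_avg_le_rearr Omega_bounded Omega_open u_dirichlet p_gt0 rho_SO clz'.
move=> h1 h2; have := le_trans h2 h1; apply/negP; rewrite -ltNge.
by apply: gt0_ltr_powR; rewrite ?nnegrE//; [exact: rearr_step_ge0|exact: U_ge0].
Qed.

End level_sets.

(** * Passage to the limit *)

Section quadratic_perturbation.
Context {R : realType} {n : nat}.
Implicit Types (f g : 'cV[R]_n -> R) (A : set 'cV[R]_n).

Lemma for_continuous_near (T : topologicalType) (f g : T -> R) x :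
  (\forall y \near x, f y = g y) -> {for x, continuous f} -> {for x, continuous g}.
Proof.
move=> fg cf; have fgx : f x = g x by exact: nbhs_singleton fg.
rewrite /prop_for /continuous_at -fgx; apply: cvg_trans cf; apply: near_eq_cvg.
by apply: filterS fg => y ->.
Qed.

Lemma for_continuousD (T : topologicalType) (f g : T -> R) x :
  {for x, continuous f} -> {for x, continuous g} -> {for x, continuous (fun y => f y + g y)}.
Proof. by move=> cf cg; apply: cvgD; [exact: cf|exact: cg]. Qed.

Lemma for_continuousN (T : topologicalType) (f : T -> R) x :
  {for x, continuous f} -> {for x, continuous (fun y => - f y)}.
Proof. by move=> cf; apply: cvgN; exact: cf. Qed.

Lemma pder_eq A f g i x : open A -> (forall y, A y -> f y = g y) -> A x ->
  pder i f x = pder i g x.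
Proof.
move=> oA fg Ax; apply: near_eq_derive.
by apply: (filterS fg); exact: open_nbhs_nbhs.
Qed.

Lemma C1_on_eq A f g : open A -> (forall x, A x -> f x = g x) -> C1_on A f -> C1_on A g.
Proof.
move=> oA fg [cf df cpf]; split.
- move=> x Ax; apply: for_continuous_near (cf x Ax).
  by apply: (filterS fg); exact: open_nbhs_nbhs.
- move=> i x Ax; apply: near_eq_derivable (df i x Ax).
  by apply: (filterS fg); exact: open_nbhs_nbhs.
- move=> i x Ax; apply: for_continuous_near (cpf i x Ax).
  apply: (@filterS _ _ _ A) => [y Ay|]; last exact: open_nbhs_nbhs.
  exact: pder_eq oA fg Ay.
Qed.

Lemma pderD A f g i x : C1_on A f -> C1_on A g -> A x ->
  pder i (fun y => f y + g y) x = pder i f x + pder i g x.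
Proof. by move=> [_ df _] [_ dg _] Ax; apply: deriveD; [exact: df|exact: dg]. Qed.

Lemma C1_onD A f g : open A -> C1_on A f -> C1_on A g -> C1_on A (fun y => f y + g y).
Proof.
move=> oA Cf Cg; have [cf df cpf] := Cf; have [cg dg cpg] := Cg; split.
- by move=> x Ax; apply: for_continuousD; [exact: cf|exact: cg].
- by move=> i x Ax; apply: derivableD; [exact: df|exact: dg].
- move=> i x Ax.
  apply: (for_continuous_near (f := fun y => pder i f y + pder i g y)); last first.
    by apply: for_continuousD; [exact: cpf|exact: cpg].
  apply: (@filterS _ _ _ A) => [y Ay|]; last exact: open_nbhs_nbhs.
  by rewrite (pderD i Cf Cg Ay).
Qed.

Lemma C2_onD A f g : open A -> C2_on A f -> C2_on A g -> C2_on A (fun y => f y + g y).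
Proof.
move=> oA Cf Cg; split=> [|i]; first exact: C1_onD oA Cf.1 Cg.1.
apply: (C1_on_eq oA (f := fun y => pder i f y + pder i g y)).
  by move=> y Ay; rewrite (pderD i Cf.1 Cg.1 Ay).
by apply: C1_onD => //; exact: C2_pder.
Qed.

Lemma gradD A f g x : C1_on A f -> C1_on A g -> A x ->
  grad (fun y => f y + g y) x = grad f x + grad g x.
Proof. by move=> Cf Cg Ax; apply/matrixP => i j; rewrite !mxE (pderD i Cf Cg Ax). Qed.

Lemma hessD A f g x : open A -> C2_on A f -> C2_on A g -> A x ->
  hess (fun y => f y + g y) x = hess f x + hess g x.
Proof.
move=> oA Cf Cg Ax; apply/matrixP => i j.
have addE (M N : 'M[R]_n) : (M + N) i j = M i j + N i j by rewrite mxE.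
have hessE h : hess h x i j = pder i (pder j h) x by rewrite mxE.
apply: etrans (hessE _) _; apply: etrans _ (esym (addE _ _)).
apply: etrans _ (congr2 +%R (esym (hessE f)) (esym (hessE g))).
transitivity (pder i (fun y => pder j f y + pder j g y) x).
  by apply: (pder_eq i oA _ Ax) => y Ay; exact: pderD Cf.1 Cg.1 Ay.
exact: pderD (C2_pder j Cf) (C2_pder j Cg) Ax.
Qed.

Lemma is_derive_quadratic (a b c : R) :
  is_derive (0 : R) 1 (fun t : R => a + b * t + c * t ^+ 2) b.
Proof.
apply/is_derive0P => e e0; have c1 : 0 < `|c| + 1 by rewrite ltr_wpDl.
apply/near0P; exists (e / (`|c| + 1)); first by rewrite divr_gt0.
move=> s; rewrite ltr_pdivlMr// => se.
rewrite mulr0 expr0n /= mulr0 !addr0 (_ : _ - _ = c * s * s); last by ring.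
rewrite normrM ler_wpM2r// normrM; apply: le_trans (ltW se).
by rewrite mulrC ler_wpM2l// lerDl.
Qed.

Definition paraboloid (x : 'cV[R]_n) (e c : R) (y : 'cV[R]_n) : R :=
  e * dotv (y - x) (y - x) + c.

Let affine (x : 'cV[R]_n) (e : R) (i : 'I_n) (y : 'cV[R]_n) : R := e * (y i 0 - x i 0).

Let paraboloid_is_derive x e c y h :
  is_derive y h (paraboloid x e c) (2 * e * dotv h (y - x)).
Proof.
apply: is_derive_lineP.
rewrite (_ : (fun _ => _) = fun t => paraboloid x e c y + 2 * e * dotv h (y - x) * t
    + e * dotv h h * t ^+ 2); first exact: is_derive_quadratic.
apply/funext => t; rewrite /paraboloid (_ : y + t *: h - x = (y - x) + t *: h).
  by move: (y - x) => k; rewrite dotvDl !dotvDr !dotvZl !dotvZr (dotvC k h); ring.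
by rewrite addrAC.
Qed.

Let affine_is_derive x e i y h : is_derive y h (affine x e i) (e * h i 0).
Proof.
apply: is_derive_lineP.
rewrite (_ : (fun _ => _) = fun t => affine x e i y + e * h i 0 * t + 0 * t ^+ 2).
  exact: is_derive_quadratic.
by apply/funext => t; rewrite /affine !mxE; ring.
Qed.

Let pder_affine x e i j : pder j (affine x e i) = cst (e * (i == j)%:R).
Proof.
apply/funext => y; rewrite /pder; have [_ ->] := affine_is_derive x e i y (basis_cV j).
by rewrite mxE eqxx andbT.
Qed.

Let pder_paraboloid x e c i : pder i (paraboloid x e c) = affine x (2 * e) i.
Proof.
apply/funext => y; rewrite /pder; have [_ ->] := paraboloid_is_derive x e c y (basis_cV i).
by rewrite dotvC dotv_delta /affine !mxE.
Qed.

Let affine_continuous x e i : continuous (affine x e i).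
Proof.
apply: mulf_continuous; apply: addf_continuous; last exact: cstf_continuous.
exact: coord_continuous.
Qed.

Lemma dotv_continuous x : continuous (fun y : 'cV[R]_n => dotv (y - x) (y - x)).
Proof.
rewrite (_ : (fun _ => _) = fun y : 'cV[R]_n => \sum_i (y i 0 - x i 0) ^+ 2).
  apply: sum_continuous => i.
  apply: (compf_continuous (f := fun y : 'cV[R]_n => y i 0 - x i 0) (g := fun t : R => t ^+ 2)).
    apply: addf_continuous; last exact: cstf_continuous.
    exact: coord_continuous.
  by move=> t; exact: exprn_continuous.
by apply/funext => y; apply: eq_bigr => i _; rewrite !mxE expr2.
Qed.

Let C1_affine A x e i : C1_on A (affine x e i).
Proof.
split=> [y _|j y _|j y _]; first exact: affine_continuous.
  by have [] := affine_is_derive x e i y (basis_cV j).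
by rewrite pder_affine; exact: cstf_continuous.
Qed.

Lemma C2_paraboloid A x e c : C2_on A (paraboloid x e c).
Proof.
split=> [|i]; last by rewrite pder_paraboloid; exact: C1_affine.
split=> [y _|j y _|j y _].
- apply: addf_continuous; last exact: cstf_continuous.
  by apply: mulf_continuous; exact: dotv_continuous.
- by have [] := paraboloid_is_derive x e c y (basis_cV j).
- by rewrite pder_paraboloid; exact: affine_continuous.
Qed.

Lemma grad_paraboloid x e c y : grad (paraboloid x e c) y = (2 * e) *: (y - x).
Proof. by apply/matrixP => i j; rewrite !mxE pder_paraboloid ord1. Qed.

Lemma hess_paraboloid x e c y : hess (paraboloid x e c) y = (2 * e)%:M.
Proof.
by apply/matrixP => i j; rewrite !mxE pder_paraboloid pder_affine /= eq_sym mulr_natr.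
Qed.

End quadratic_perturbation.

Section stability.
Context {R : realType} {n : nat}.

Lemma closed_closed_eball (x : 'cV[R]_n) r : closed (closed_eball x r).
Proof.
have [r0|r0] := leP 0 r; last first.
  rewrite (_ : closed_eball x r = set0); first exact: closed0.
  apply/seteqP; split => // y; rewrite /closed_eball /=.
  by move=> /(le_trans (enorm_ge0 _)); rewrite leNgt r0.
rewrite (_ : closed_eball x r = (fun y => dotv (y - x) (y - x)) @^-1` [set s | s <= r ^+ 2]).
  apply: preimage_closed => [y _|]; last exact: closed_le.
  exact: dotv_continuous.
by apply/seteqP; split => y; rewrite /closed_eball /= -sqr_enorm ler_sqr ?nnegrE ?enorm_ge0.
Qed.

Lemma compact_closed_eball (x : 'cV[R]_n) r : compact (closed_eball x r).
Proof.
apply: mx_bounded_closed_compact; last exact: closed_closed_eball.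
exists (`|x| + r); split=> [|N xN y yx /=]; first exact: num_real.
apply: le_trans (ltW xN); rewrite -(subrK x y) addrC.
by apply: le_trans (ler_normD _ _) _; rewrite lerD2l; exact: le_trans (norm_le_enorm _) yx.
Qed.

(** Continuity of F is known only along symmetric matrices, hence the restriction on N. *)
Lemma op_near_lt0 (F : operator R n) (x : 'cV[R]_n) t xi M : op_continuous F -> symmx M ->
  F x t xi M < 0 -> exists2 d, 0 < d & forall y s eta N, symmx N ->
    `|y - x| < d -> `|s - t| < d -> `|eta - xi| < d -> `|N - M| < d -> F y s eta N < 0.
Proof.
move=> /subspace_continuousP F_cont sM F0.
have Fz := F_cont (x, t, xi, M) sM.
have := @cvgr_lt _ _ _ (within_filter _ (nbhs_filter (x, t, xi, M))) _ _ Fz _ F0.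
rewrite near_withinE => /(nbhs_ballP _ _).1 [d /= d0 dF].
exists d => // y s eta N sN yx st ex NM.
apply: (dF (y, s, eta, N)) => //.
by split; [split; [split|]|]; rewrite /= -ball_normE /= distrC.
Qed.

Variables (F : operator R n) (W : nat -> 'cV[R]_n -> R) (w : 'cV[R]_n -> R).
Hypotheses (F_continuous : op_continuous F) (W_continuous : forall j, continuous (W j))
  (W_unif : forall e, 0 < e -> \forall j \near \oo, forall x, `|w x - W j x| < e)
  (W_viscosity : forall j x A phi, open A -> A x -> C2_on A phi -> phi x = W j x ->
    0 < phi x -> (\forall y \near x, W j y <= phi y) ->
    0 <= F x (phi x) (grad phi x) (hess phi x)).

Let near_C0 A (f : 'cV[R]_n -> R) x e : C0_on A f -> A x -> 0 < e ->
  \forall y \near x, `|f y - f x| < e.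
Proof.
move=> cf Ax e0; have /(@cvgrPdist_lt _ _ _ (nbhs x)) /(_ _ e0) := cf x Ax.
by apply: filterS => y; rewrite distrC.
Qed.

(** Adding e |y - x|^2 to phi makes the contact strict, so that the maximum of W_j minus the test
    function over a small closed ball is attained inside it. A constant then restores contact, and
    the jet there is too close to that of phi at x for F to be nonnegative. *)
Lemma viscosity_stability A phi x : open A -> A x -> C2_on A phi -> phi x = w x -> 0 < w x ->
  (\forall y \near x, w y <= phi y) -> 0 <= F x (w x) (grad phi x) (hess phi x).
Proof.
have S1 (a b a' b' f q c h : R) : `|a - b| < h -> `|a' - b'| < h -> a' <= f -> 0 <= q ->
    b - a <= c -> c = b' - (f + q) -> [/\ - h < c, c < h & q < h + h].
  by rewrite !ltr_norml => /andP[? ?] /andP[? ?] ? ? ? ?; split; lra.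
have S2 (D E h : R) : 0 < E -> D < h + h -> h <= E / 4 -> D < E by move=> ? ? ?; lra.
have S3 (f f' q c h d1 d : R) : `|f - f'| < d1 -> 0 <= q -> q < h + h -> - h < c -> c < h ->
    h <= d1 -> d1 <= d / 4 -> d1 <= f' / 4 -> 0 < f' ->
    `|f + q + c - f'| < d /\ 0 < f + q + c.
  by rewrite !ltr_norml => /andP[? ?] *; split; [apply/andP; split|]; lra.
have S4 (V : normedZmodType R) (a b : V) (d1 d : R) : 0 < d -> d1 <= d / 4 -> `|a| <= d1 ->
    `|b| <= d1 -> `|a + b| < d.
  by move=> ? ? ? ?; apply: le_lt_trans (ler_normD _ _) _; lra.
move=> oA Ax C2phi phix wx0 w_le; rewrite leNgt; apply/negP => F0.
have [d d0 dF] := op_near_lt0 F_continuous (hess_sym oA C2phi Ax) F0.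
(* All errors are kept below d, and the touching value stays positive. The choice e = d1 / 2 makes
   the Hessian of the paraboloid equal to d1 times the identity. *)
pose d1 := Num.min (d / 4) (w x / 4).
have d10 : 0 < d1 by rewrite lt_min !divr_gt0.
have d1d : d1 <= d / 4 by rewrite ge_min lexx.
have d1w : d1 <= w x / 4 by rewrite ge_min lexx orbT.
pose e := d1 / 2; have e0 : 0 < e by rewrite divr_gt0.
have [cphi _ cpphi] := C2phi.1.
have H1 : \forall y \near x, `|phi y - phi x| < d1 by exact: near_C0 cphi Ax d10.
have /filter_forall H2 i : \forall y \near x, `|pder i phi y - pder i phi x| < d1.
  exact: near_C0 (cpphi i) Ax d10.
have /filter_forall H3 i : \forall y \near x, forall j,
    `|pder i (pder j phi) y - pder i (pder j phi) x| < d1.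
  suff /filter_forall H : forall j, \forall y \near x,
    `|pder i (pder j phi) y - pder i (pder j phi) x| < d1 by exact: H.
  by move=> j; have [_ _ cp] := C2_pder j C2phi; exact: near_C0 (cp i) Ax d10.
have HA : \forall y \near x, A y by exact: open_nbhs_nbhs.
have [r0 r00 Hr] := (nbhs_enormP _ _).1 (filterI (filterI H1 w_le) (filterI (filterI H2 H3) HA)).
pose r := Num.min (r0 / 2) (Num.min 1 (d / 2)).
have r_gt0 : 0 < r by rewrite !lt_min !divr_gt0 ?ltr01.
have rr0 : r < r0 by rewrite gt_min ltr_pdivrMr// ltr_pMr// ltr1n.
have r1 : r <= 1 by rewrite !ge_min lexx orbT.
have rd : r < d.
  apply: (@le_lt_trans _ _ (d / 2)); first by rewrite !ge_min lexx !orbT.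
  by rewrite ltr_pdivrMr// ltr_pMr// ltr1n.
(* At the maximum the quadratic term is less than 2 eta, which is below e r^2: the maximum is not on
   the bounding sphere. *)
pose eta := Num.min (e * r ^+ 2 / 4) d1.
have eta0 : 0 < eta by rewrite lt_min d10 divr_gt0// mulr_gt0// exprn_gt0.
have eta1 : eta <= d1 by rewrite ge_min lexx orbT.
have eta2 : eta <= e * r ^+ 2 / 4 by rewrite ge_min lexx.
have [j _ /(_ j (leqnn j)) Wj] := W_unif eta0.
pose q := paraboloid x e 0.
pose psi0 y := phi y + q y.
have q_ge0 y : 0 <= q y by rewrite /q /paraboloid addr0 mulr_ge0 ?(ltW e0)// dotvv_ge0.
have qx : q x = 0.
  by rewrite /q /paraboloid subrr -sqr_enorm enorm0 expr0n /= mulr0 addr0.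
have [y By ymax] : exists2 y, closed_eball x r y &
    forall y', closed_eball x r y' -> W j y' - psi0 y' <= W j y - psi0 y.
  have Bx : closed_eball x r !=set0 by exists x; rewrite /closed_eball /= subrr enorm0 ltW.
  have [|y yB ymax] := compact_EVT_max Bx (@compact_closed_eball x r)
      (f := fun y => W j y + - psi0 y).
    apply: continuous_in_subspaceT => y; rewrite inE => By.
    have [_ [_ Ay]] := Hr y (le_lt_trans By rr0).
    suff : {for y, continuous (fun y => W j y + - psi0 y)} by [].
    apply: for_continuousD; first exact: W_continuous.
    apply: for_continuousN; apply: for_continuousD; first exact: cphi.
    by have [[+ _ _] _] := C2_paraboloid A x e 0; exact.
  by exists y => [|y' By']; [rewrite inE in yB|apply: ymax; rewrite inE].
have By0 : enorm (y - x) < r0 by exact: le_lt_trans By rr0.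
have [[phi_y wy] [[pphi_y ppphi_y] Ay]] := Hr y By0.
pose c := W j y - psi0 y.
have [c_gt c_lt qy] : [/\ - eta < c, c < eta & q y < eta + eta].
  apply: (S1 (w x) (W j x) (w y) (W j y) (phi y)) => //.
  have := ymax x; rewrite /psi0 qx addr0 phix; apply.
  by rewrite /closed_eball /= subrr enorm0 ltW.
have yr : enorm (y - x) < r.
  rewrite -ltr_sqr ?nnegrE ?enorm_ge0 ?(ltW r_gt0)// sqr_enorm -(ltr_pM2l e0).
  apply: (S2 _ _ eta _ _ eta2); first by rewrite mulr_gt0// exprn_gt0.
  by move: qy; rewrite /q /paraboloid addr0.
pose psi y := phi y + paraboloid x e c y.
have psiE y' : psi y' = psi0 y' + c.
  by rewrite /psi /psi0 /q /paraboloid addr0 addrA.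
have psiy : psi y = W j y by rewrite psiE /c subrKC.
have Cq : C2_on A (paraboloid x e c) by exact: C2_paraboloid.
have C2psi : C2_on A psi by exact: C2_onD.
have [psi_near psi_gt0] : `|psi y - w x| < d /\ 0 < psi y.
  rewrite psiE; apply: (S3 (phi y) (w x) (q y) c eta d1) => //.
  by rewrite -phix.
have W_le : \forall y' \near y, W j y' <= psi y'.
  apply/nbhs_enormP; exists (r - enorm (y - x)); first by rewrite subr_gt0.
  move=> y'; rewrite ltrBrDr => y'y; rewrite psiE -lerBlDl; apply: ymax.
  rewrite /closed_eball /= -(subrK y y') -addrA; apply: le_trans (enormD _ _) _.
  exact: ltW.
have := W_viscosity oA Ay C2psi psiy psi_gt0 W_le.
apply/negP; rewrite -ltNge; apply: dF => //.
- exact: hess_sym oA C2psi Ay.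
- by apply: le_lt_trans (norm_le_enorm _) _; exact: lt_trans rd.
- have yx1 : `|y - x| <= 1 by apply: le_trans (norm_le_enorm _) (le_trans By r1).
  rewrite (gradD C2phi.1 Cq.1 Ay) grad_paraboloid addrAC.
  apply: (S4 _ _ _ _ _ d0 d1d).
    apply: norm_le_coord (ltW d10) _ => i k; rewrite !mxE; exact: ltW.
  rewrite normrZ gtr0_norm ?mulr_gt0// /e mulrCA mulfV// mulr1.
  by rewrite ler_piMr// ltW.
- rewrite (hessD oA C2phi Cq Ay) hess_paraboloid addrAC.
  apply: (S4 _ _ _ _ _ d0 d1d).
    apply: norm_le_coord (ltW d10) _ => i k; rewrite !mxE; exact: ltW.
  apply: norm_le_coord (ltW d10) _ => i k; rewrite mxE /e mulrCA mulfV// mulr1.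
  by case: (_ == _); rewrite ?mulr1n ?mulr0n ?normr0 ?(ltW d10)// ger0_norm ?(ltW d10).
Qed.

End stability.

(** Used with q = 1/p to pass from uniform convergence of the p-th powers to that of the
    functions. *)
Lemma powR_lipschitz (R : realType) (q M a b : R) : 1 <= q -> 0 <= a <= M -> 0 <= b <= M ->
  `|a `^ q - b `^ q| <= q * M `^ (q - 1) * `|a - b|.
Proof.
move=> q1; have q0 : 0 < q by exact: lt_le_trans q1.
wlog ab : a b / a < b.
  move=> H aM bM; have [ab|ba|->] := ltgtP a b; first exact: H.
    by rewrite distrC (distrC a); exact: H.
  by rewrite !subrr !normr0 mulr0.
move=> /andP[a0 aM] /andP[b0 bM].
(* The absolute value gives a function continuous on the whole line that agrees with t^q for t >=
   0. *)
have cF : continuous (fun t : R => `|t| `^ q).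
  by apply: (powR_continuous q0) => [t|t //]; apply: norm_continuous.
have dF t : t \in `]a, b[ -> is_derive t 1 (fun t : R => `|t| `^ q) (q * t `^ (q - 1)).
  rewrite in_itv /= => /andP[at_ tb]; have t0 : 0 < t by exact: le_lt_trans at_.
  apply: near_eq_is_derive (is_derive1_powR q t0).
  by near=> s; rewrite gtr0_norm//; near: s; exact: lt_nbhsr.
have [|t] := MVT ab dF.
  exact: continuous_subspaceT.
rewrite in_itv /= => /andP[at_ tb].
rewrite (ger0_norm a0) (ger0_norm b0) => E.
rewrite distrC E normrM ger0_norm; last by rewrite mulr_ge0 ?(ltW q0)// powR_ge0.
rewrite (distrC a) ler_wpM2r// ler_wpM2l ?(ltW q0)//.
have t0 : 0 <= t by exact: le_trans (ltW at_).
apply: ge0_ler_powR; rewrite ?nnegrE ?subr_ge0//; first exact: le_trans bM.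
exact: le_trans (ltW tb) bM.
Unshelve. all: by end_near. Qed.

Section rearrangement_limit.
Context {R : realType} {n : nat}.
Variables (Omega : set 'cV[R]_n) (u : 'cV[R]_n -> R) (p : R) (rho : nat -> 'M[R]_n)
  (k : nat -> nat).
Hypotheses (Omega_neq0 : Omega !=set0) (Omega_bounded : bounded_set Omega)
  (Omega_open : open Omega) (u_dirichlet : positive_zero_boundary Omega u)
  (p_gt0 : 0 < p) (p_lt1 : p < 1) (rho_SO : forall i, special_orthogonal (rho i))
  (k_cvg : rearr_cvg rho Omega u p k).

Let W := rearr_step rho Omega u p.
Let g := rearr_pow_lim rho Omega u p k.
Let w := rearrangement rho Omega u p k.

Let W_ge0 m x : 0 <= W m x. Proof. exact: rearr_step_ge0. Qed.

Let radius := sup [set enorm x | x in closure Omega].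

Let closure_radius y : closure Omega y -> enorm y <= radius.
Proof.
move=> cly; apply: ub_le_sup; last by exists y.
have [N N0 ON] := bounded_set_enorm Omega_bounded.
exists N => _ [z clz <-]; apply/ler_addgt0Pr => e e0.
have [y' Oy' y'z] := (closure_enormP _ _).1 clz e e0.
rewrite -(subrK y' z) addrC; apply: le_trans (enormD _ _) _.
by rewrite lerD ?ON// enormB ltW.
Qed.

Let radius_ge0 : 0 <= radius.
Proof.
have [y Oy] := Omega_neq0; apply: le_trans (enorm_ge0 y) _.
by apply: closure_radius; exact: subset_closure.
Qed.

(** Uniform convergence is assumed on a ball of twice the radius of Omega; outside it all steps
    vanish, so it holds on the whole space. *)
Lemma rearr_pow_unif e : 0 < e ->
  \forall j \near \oo, forall x, `|g x - W (k j) x `^ p| < e.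
Proof.
move=> e0.
have Pg : nbhs (g : {uniform` closed_eball 0 (2 * radius) -> R})
    [set h | forall y, closed_eball 0 (2 * radius) y -> `|g y - h y| < e].
  apply/uniform_nbhs; exists [set ab : R * R | ball ab.1 e ab.2]; split=> //.
  exact: (entourage_ball R (PosNum e0)).
have [j0 _ Hj] := k_cvg Pg; exists j0 => // j j0j x; have H := Hj j j0j.
have [xK|xK] := leP (enorm x) (2 * radius).
  by apply: H; rewrite /closed_eball /= subr0.
have Wx i : W (k i) x `^ p = 0.
  have [W0|] := ltP 0 (W (k i) x).
    have := rearr_step_support Omega_neq0 Omega_bounded Omega_open u_dirichlet p_gt0 rho_SO
      closure_radius W0.
    by rewrite leNgt (le_lt_trans _ xK)// ler_peMl// ler1n.
  by move=> W0; rewrite (_ : W _ _ = 0) ?powR0 ?gt_eqF//; apply/eqP; rewrite eq_le W0 W_ge0.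
rewrite Wx (_ : g x = 0) ?subrr ?normr0//.
rewrite /g /rearr_pow_lim (_ : (fun _ => _) = cst 0); first exact: lim_cst.
by apply/funext => i; exact: Wx.
Qed.

Let g_ge0 x : 0 <= g x.
Proof.
rewrite leNgt; apply/negP => g0; have : 0 < - g x by rewrite oppr_gt0.
move=> /rearr_pow_unif[j _ /(_ j (leqnn j) x)].
by rewrite ler0_norm ?subr_le0 ?(le_trans (ltW g0)) ?powR_ge0// opprB ltrBlDr addNr ltNge powR_ge0.
Qed.

Let g_continuous : continuous g.
Proof.
move=> x; apply/(@cvgrPdist_lt _ _ _ (nbhs x)) => e e0.
have e3 : 0 < e / 3 by rewrite divr_gt0.
have [j _ /(_ j (leqnn j)) gW] := rearr_pow_unif e3.
have cW : continuous (fun y => W (k j) y `^ p).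
  by apply: powR_continuous => //; exact: rearr_step_continuous.
have /(@cvgrPdist_lt _ _ _ (nbhs x)) /(_ _ e3) := cW x.
apply: filterS => y Wxy; have := gW x; have := gW y; move: Wxy.
move: (g x) (g y) (W _ _ `^ p) (W _ _ `^ p) => a b c d; rewrite !ltr_norml.
by move=> /andP[? ?] /andP[? ?] /andP[? ?]; apply/andP; split; lra.
Qed.

Lemma rearrangement_ge0 x : 0 <= w x.
Proof. exact: powR_ge0. Qed.

Lemma rearrangement_continuous : continuous w.
Proof. by apply: powR_continuous => //; rewrite invr_gt0. Qed.

Let U_bounded : exists2 M, 0 <= M & forall x, (u \_ Omega) x <= M.
Proof.
have cU : continuous (u \_ Omega) by exact: zero_extension_continuous.
have cK := @compact_closed_eball R n 0 radius.
have K0 : closed_eball (0 : 'cV[R]_n) radius !=set0.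
  by exists 0; rewrite /closed_eball /= subrr enorm0 radius_ge0.
have [|y yK ymax] := compact_EVT_max K0 cK (f := u \_ Omega); first exact: continuous_subspaceT.
have [_ _ u0] := u_dirichlet.
exists (`|(u \_ Omega) y|) => [|x]; first exact: normr_ge0.
have [Ox|nOx] := pselect (Omega x); last first.
  by rewrite [(u \_ Omega) x]patchE memNset//; exact: normr_ge0.
apply: le_trans (ler_norm _); apply: ymax; rewrite inE /closed_eball /= subr0.
by apply: closure_radius; exact: subset_closure.
Qed.

Let G_bounded : exists2 M, 0 <= M & forall m x, W m x `^ p <= M.
Proof.
have [M M0 UM] := U_bounded; exists (M `^ p) => [|m x]; first exact: powR_ge0.
have [W0|] := ltP 0 (W m x); last first.
  move=> W0; rewrite (_ : W _ _ = 0) ?powR0 ?gt_eqF ?powR_ge0//.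
  by apply/eqP; rewrite eq_le W0 W_ge0.
have [z [_ _ ->]] := rearr_step_attained Omega_bounded Omega_open u_dirichlet p_gt0 rho_SO W0.
case: m z {W0} => [|m] z; first by rewrite /pow_avg big_ord0 mulr0 powR_ge0.
rewrite /pow_avg mulrC ler_pdivrMr//.
rewrite -[m.+1 in leRHS]card_ord mulr_natr -sumr_const; apply: ler_sum => i _.
apply: ge0_ler_powR; rewrite ?nnegrE ?(ltW p_gt0)//.
rewrite patchE; case: ifPn => //; rewrite inE => Oz.
by have [_ _ u0] := u_dirichlet; rewrite ltW ?u0.
Qed.

Lemma rearrangement_unif e : 0 < e ->
  \forall j \near \oo, forall x, `|w x - W (k j) x| < e.
Proof.
move=> e0; have [M M0 GM] := G_bounded.
have q1 : 1 <= p^-1 by rewrite invf_ge1// ltW.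
have g_le x : g x <= M + 1.
  have [j _ /(_ j (leqnn j) x)] := rearr_pow_unif ltr01.
  by rewrite ltr_norml => /andP[_ H]; have := GM (k j) x; move: H; lra.
pose L := p^-1 * (M + 1) `^ (p^-1 - 1).
have L0 : 0 <= L by rewrite mulr_ge0 ?powR_ge0 ?invr_ge0 ?ltW.
have L1 : 0 < L + 1 by rewrite ltr_wpDl.
have := rearr_pow_unif (divr_gt0 e0 L1); apply: filterS => j H x.
have WE : W (k j) x = (W (k j) x `^ p) `^ p^-1.
  by rewrite -powRrM mulfV ?gt_eqF// powRr1.
rewrite WE; apply: le_lt_trans (powR_lipschitz (M := M + 1) q1 _ _) _.
- by rewrite g_ge0 g_le.
- by rewrite powR_ge0 (le_trans (GM _ _))// lerDl.
apply: (@le_lt_trans _ _ ((L + 1) * `|g x - W (k j) x `^ p|)).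
  by rewrite ler_wpM2r// lerDl.
by rewrite mulrC -ltr_pdivlMr.
Qed.

End rearrangement_limit.

(** * Hausdorff convergence and the limit ball *)

Section hausdorff.
Context {R : realType} {n : nat}.
Implicit Types A B : set 'cV[R]_n.

Lemma hausdorff_distC A B : hausdorff_dist A B = hausdorff_dist B A.
Proof. by rewrite /hausdorff_dist maxC. Qed.

(** The bounds and the nonemptiness make the real [sup] and [inf] in the definition genuine ones. *)
Lemma hausdorff_dist_approx A B N e x : (forall y, A y -> enorm y <= N) ->
  (forall y, B y -> enorm y <= N) -> B !=set0 -> hausdorff_dist A B < e -> A x ->
  exists2 y, B y & enorm (x - y) < e.
Proof.
move=> AN BN [b Bb] ABe Ax.
have dist_lb y : lbound [set enorm (y - z) | z in B] 0.
  by move=> _ [z _ <-]; exact: enorm_ge0.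
have : dist_to x B < e.
  apply: le_lt_trans ABe; rewrite /hausdorff_dist le_max; apply/orP; left.
  apply: ub_le_sup; last by exists x.
  exists (N + N) => _ [y Ay <-]; apply: (@le_trans _ _ (enorm (y - b))).
    by apply: ge_inf; [exists 0; exact: dist_lb|exact: imageP].
  by apply: le_trans (enormD _ _) _; rewrite enormN lerD//; [exact: AN|exact: BN].
move=> /inf_lt[]; first by exists (enorm (x - b)), b.
by move=> _ [y By <-] ye; exists y.
Qed.

Lemma open_eball (x : 'cV[R]_n) r : open (eball x r).
Proof.
rewrite openE => y yr; apply/nbhs_enormP; exists (r - enorm (y - x)).
  by rewrite subr_gt0.
move=> z; rewrite ltrBrDr => zy; rewrite /eball /= -(subrK y z) -addrA.
exact: le_lt_trans (enormD _ _) zy.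
Qed.

Lemma eball_bounded (x : 'cV[R]_n) r y : eball x r y -> enorm y <= enorm x + r.
Proof.
move=> yr; have := enormD x (y - x); rewrite subrKC => /le_trans; apply.
by rewrite lerD2l; exact: ltW yr.
Qed.

Variables (rho : nat -> 'M[R]_n) (Omega : set 'cV[R]_n).
Hypothesis rho_SO : forall i, special_orthogonal (rho i).

Lemma rotation_mean_tuple m x : rotation_mean rho Omega m x ->
  exists2 z : 'I_m -> 'cV[R]_n, (forall i, Omega (z i)) & rot_bary rho z = x.
Proof.
move=> [y Hy <-].
have /choice[z Hz] : forall i : 'I_m, exists z, Omega z /\ rho i *m z = y i.
  by move=> i; have [z Oz zy] := Hy i; exists z.
exists z => [i|]; first by have [] := Hz i.
by rewrite /rot_bary; congr barycenter; apply/funext => i; have [] := Hz i.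
Qed.

Lemma rot_bary_bounded N m (z : 'I_m -> 'cV[R]_n) : 0 <= N -> (forall i, enorm (z i) <= N) ->
  enorm (rot_bary rho z) <= N.
Proof.
move=> N0 zN; case: m z zN => [|m] z zN.
  by rewrite /rot_bary /barycenter big_ord0 scaler0 enorm0.
rewrite /rot_bary /barycenter enormZ ger0_norm ?invr_ge0// mulrC ler_pdivrMr//.
apply: le_trans (enorm_sum _ _) _.
rewrite -[m.+1 in leRHS]card_ord mulr_natr -sumr_const; apply: ler_sum => i _.
by rewrite enorm_orthogonal ?special_orthogonal_tr.
Qed.

End hausdorff.

Section limit_domain.
Context {R : realType} {n : nat}.
Variables (Omega : set 'cV[R]_n) (u : 'cV[R]_n -> R) (p : R) (rho : nat -> 'M[R]_n)
  (k : nat -> nat) (c : 'cV[R]_n) (r : R).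
Hypotheses (Omega_neq0 : Omega !=set0) (Omega_bounded : bounded_set Omega)
  (Omega_open : open Omega) (Omega_convex : convex_set Omega)
  (u_dirichlet : positive_zero_boundary Omega u)
  (p_gt0 : 0 < p) (p_lt1 : p < 1) (rho_SO : forall i, special_orthogonal (rho i))
  (r_gt0 : 0 < r) (ball_lim :
    hausdorff_dist (rotation_mean rho Omega m) (eball c r) @[m --> \oo] --> (0 : R))
  (k_incr : {homo k : i j / (i < j)%N})
  (k_cvg : rearr_cvg rho Omega u p k).

Let W := rearr_step rho Omega u p.
Let w := rearrangement rho Omega u p k.

Let w_unif e : 0 < e -> \forall j \near \oo, forall x, `|w x - W (k j) x| < e.
Proof. exact: rearrangement_unif. Qed.

Let w_cont : continuous w. Proof. exact: (rearrangement_continuous (Omega := Omega)). Qed.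

Let w_ge0 x : 0 <= w x. Proof. exact: rearrangement_ge0. Qed.

Let k_ge j : (j <= k j)%N.
Proof. by elim: j => // j IH; apply: leq_ltn_trans IH _; exact: k_incr. Qed.

Let bound : exists2 N, 0 < N &
  (forall m x, rotation_mean rho Omega m x -> enorm x <= N) /\
  ((forall x, Omega x -> enorm x <= N) /\ forall x, eball c r x -> enorm x <= N).
Proof.
have [N N0 ON] := bounded_set_enorm Omega_bounded.
have cr0 : 0 <= enorm c + r by rewrite addr_ge0 ?enorm_ge0 ?ltW.
exists (N + (enorm c + r)); first by rewrite ltr_wpDr.
have ON' x : Omega x -> enorm x <= N + (enorm c + r).
  by move=> /ON xN; rewrite (le_trans xN)// lerDl.
split.
  move=> m x /rotation_mean_tuple[z Oz <-]; apply: rot_bary_bounded => // [|i].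
    by rewrite addr_ge0// ltW.
  exact: ON'.
by split=> // x /eball_bounded xN; rewrite (le_trans xN)// lerDr ltW.
Qed.

Let ball_near e : 0 < e -> \forall j \near \oo,
  hausdorff_dist (rotation_mean rho Omega (k j)) (eball c r) < e.
Proof.
move=> e0; have /cvgrPdist_lt /(_ _ e0)[j0 _ H] := ball_lim.
exists j0 => // j /= j0j; have := H (k j) (leq_trans j0j (k_ge j)).
by rewrite sub0r normrN; apply: le_lt_trans; exact: ler_norm.
Qed.

(** A point of the ball slightly farther out than x is approximated by a point of the rotation mean.
    Contracting the latter towards a fixed barycenter lands near x, where [rearr_step_lower_bound]
    gives a bound d valid for every m. *)
Lemma rearrangement_gt0 x : eball c r x -> 0 < w x.
Proof.
move=> xr; have [N N0 [mN [ON bN]]] := bound.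
have [x0 Ox0] := Omega_neq0.
pose s := r - enorm (x - c); have s0 : 0 < s by rewrite subr_gt0.
pose K := enorm x + N; have K0 : 0 < K by rewrite ltr_wpDl ?enorm_ge0.
(* K bounds the distance from x to [zm], so moving x away from [zm] by the factor [sg] stays within
   s / 2; [tau] is the ratio that brings the moved point back to x. *)
pose sg := s / 2 / K; have sg0 : 0 < sg by rewrite !divr_gt0.
have sg1 : 0 < 1 + sg by rewrite addr_gt0.
pose tau := sg / (1 + sg).
have tau01 : 0 < tau <= 1.
  by rewrite /tau divr_gt0//= ler_pdivrMr// mul1r lerDr.
have [d d0 Hd] := rearr_step_lower_bound Omega_bounded Omega_open Omega_convex u_dirichlet
  p_gt0 rho_SO Ox0 tau01.
have d3 : 0 < d / 3 by rewrite divr_gt0.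
have /(@cvgrPdist_lt _ _ _ (nbhs x)) /(_ _ d3) /nbhs_enormP[e e0 He] := @w_cont x.
have [j [[H1 H2] H3]] : exists j, ((forall y, `|w y - W (k j) y| < d / 3) /\
    hausdorff_dist (rotation_mean rho Omega (k j)) (eball c r) < e) /\ (0 < k j)%N.
  have [j1 _ Hj1] := w_unif d3; have [j2 _ Hj2] := ball_near e0.
  exists (maxn j1 j2).+1; split; last by apply: leq_trans (k_ge _).
  by split; [apply: Hj1|apply: Hj2] => /=; rewrite ltnW// ltnS ?leq_maxl ?leq_maxr.
case: (k j) H1 H2 H3 => // m H1 H2 _.
pose zm := rot_bary rho (fun _ : 'I_m.+1 => x0).
have zmN : enorm zm <= N by apply: rot_bary_bounded => // [|i]; [exact: ltW|exact: ON].
pose y := x + sg *: (x - zm).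
have yr : eball c r y.
  rewrite /eball /= /y addrAC; apply: le_lt_trans (enormD _ _) _.
  rewrite -ltrBrDl -/s enormZ gtr0_norm//; apply: (@le_lt_trans _ _ (sg * K)).
    rewrite ler_wpM2l ?(ltW sg0)//; apply: le_trans (enormD _ _) _.
    by rewrite enormN lerD2l.
  by rewrite /sg divfK ?gt_eqF// ltr_pdivrMr// ltr_pMr// ltr1n.
have rmE : rotation_mean rho Omega m.+1 !=set0.
  exists zm; exists (fun i : 'I_m.+1 => rho i *m x0) => // i.
  by exists x0.
rewrite hausdorff_distC in H2.
have [y' my' yy'] := hausdorff_dist_approx bN (mN m.+1) rmE H2 yr.
have [z Oz zy'] := rotation_mean_tuple my'.
have := Hd m z (fun i => subset_closure (Oz i)); rewrite zy' -/zm.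
set x' := y' + _ => dW.
have xE : x = y + tau *: (zm - y).
  rewrite /y; move: (zm) => v; apply/matrixP => i l; rewrite !mxE /tau; field.
  exact: lt0r_neq0.
have xx' : enorm (x' - x) < e.
  rewrite (_ : x' - x = (1 - tau) *: (y' - y)).
    rewrite enormZ; have [t0 t1] := andP tau01.
    rewrite ger0_norm ?subr_ge0//; apply: (@le_lt_trans _ _ (1 * enorm (y' - y))).
      by rewrite ler_wpM2r ?enorm_ge0// lerBlDr lerDl ltW.
    by rewrite mul1r enormB.
  rewrite [in LHS]xE /x'; move: (zm) (y) => v b; apply/matrixP => i l.
  by rewrite !mxE; ring.
have := He x' xx'; have := H1 x'; move: dW.
rewrite -/(W m.+1 x') !ltr_norml; move: (W _ _) (w x) (w x') => a b b'.
by move=> ? /andP[? ?] /andP[? ?]; lra.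
Qed.

Lemma rearrangement_eq0 x : ~ eball c r x -> w x = 0.
Proof.
move=> nxr.
(* Outside the closed ball, a positive value of a late step would place a point of the rotation mean
   too far from the ball. *)
have far y : r < enorm (y - c) -> w y <= 0.
  move=> ry; rewrite leNgt; apply/negP => wy.
  have [N N0 [mN [_ bN]]] := bound.
  pose s := enorm (y - c) - r; have s2 : 0 < s / 2 by rewrite divr_gt0// subr_gt0.
  have [j1 _ Hj1] := w_unif wy; have [j2 _ Hj2] := ball_near s2.
  pose j := maxn j1 j2.
  have {}Hj1 := Hj1 j (leq_maxl _ _) y; have {}Hj2 := Hj2 j (leq_maxr _ _).
  have Wy : 0 < W (k j) y by move: Hj1; rewrite ltr_norml => /andP[]; lra.
  have [z [clz zy _]] := rearr_step_attained Omega_bounded Omega_open u_dirichlet p_gt0 rho_SO Wy.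
  have := rot_bary_closure rho_SO clz; rewrite zy.
  move=> /closure_enormP/(_ _ s2)[y1 my1 y1y].
  have b0 : eball c r !=set0 by exists c; rewrite /eball /= subrr enorm0.
  have [y2 by2 y12] := hausdorff_dist_approx (mN _) bN b0 Hj2 my1.
  suff : enorm (y - c) < enorm (y - c) by rewrite ltxx.
  rewrite {1}(_ : y - c = (y - y1) + ((y1 - y2) + (y2 - c))); last by rewrite !subrKA.
  apply: le_lt_trans (enormD _ _) _; rewrite enormB.
  apply: (@lt_le_trans _ _ (s / 2 + (s / 2 + r))); last first.
    by rewrite addrA -splitr /s subrK.
  apply: ltr_leD => //; apply: le_trans (enormD _ _) _.
  by apply: lerD; [exact: ltW y12|exact: ltW by2].
apply: le_anti; apply/andP; split; last exact: w_ge0.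
rewrite leNgt; apply/negP => wx.
(* To include the sphere: by continuity a positive value at x would persist slightly farther out
   along the ray from c. *)
have /near0P[e e0 He] := near_line (x - c) (continuous_near_gt w_cont wx).
have e2 : 0 < e / 2 by rewrite divr_gt0.
have := He (e / 2); rewrite gtr0_norm// ltr_pdivrMr// ltr_pMr// ltr1n => /(_ isT).
apply/negP; rewrite -leNgt; apply: far.
rewrite addrAC -{1}(scale1r (x - c)) -scalerDl enormZ gtr0_norm ?addr_gt0//.
have rx : r <= enorm (x - c) by rewrite leNgt; exact/negP.
apply: (le_lt_trans rx); rewrite ltr_pMl; first by rewrite ltrDl.
exact: lt_le_trans rx.
Qed.

Lemma leb_superlevel_lim t : 0 <= t ->
  (leb [set x | (t < (u \_ Omega) x)%R] <= leb [set x | (t < w x)%R])%E.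
Proof.
move=> t0; set U := u \_ Omega.
have cU : continuous U by exact: zero_extension_continuous.
have open_level (f : 'cV[R]_n -> R) s : continuous f -> open [set x | s < f x].
  by move=> cf; rewrite openE => x /= sx; exact: continuous_near_gt cf sx.
have m_level (f : 'cV[R]_n -> R) s : continuous f -> measurable [set x | s < f x].
  by move=> cf; apply: cV_open_measurable; exact: open_level.
(* Uniform approximation costs a margin in the level. The margin 1/(i + 1) is removed by continuity
   of the measure from below. *)
pose E i := [set x | t + i.+1%:R^-1 < U x].
have EE : [set x | t < U x] = \bigcup_i E i.
  apply/seteqP; split=> [x /= tx|x [i _ /=]]; last first.
    by apply: lt_trans; rewrite ltrDl.
  have [i iU] := ltr_add_invr tx.
  by exists i => //; rewrite /E /= ; exact: iU.
have E_le i : (leb (E i) <= leb [set x | (t < w x)%R])%E.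
  have i0 : 0 < i.+1%:R^-1 :> R by rewrite invr_gt0.
  have [j0 _ Hj] := w_unif i0.
  have {Hj} := Hj j0.+1 (leqW (leqnn _)); have := leq_trans _ (k_ge j0.+1) : (0 < k j0.+1)%N.
  move=> /(_ isT); case: (k j0.+1) => // m _ Hm.
  have t1 : 0 <= t + i.+1%:R^-1 by rewrite addr_ge0.
  have := leb_superlevel_le Omega_bounded Omega_open u_dirichlet p_gt0 rho_SO m t1.
  move=> H; apply: (le_trans H); apply: le_measure; rewrite ?inE.
  - by apply: m_level; exact: rearr_step_continuous.
  - exact: m_level.
  - move=> x /= tx; have := Hm x; rewrite ltr_norml => /andP[+ _]; move: tx.
    by rewrite -/(W _ _); move: (W _ _) (w x) (_^-1) => a b e; lra.
have E_cvg : leb (E i) @[i --> \oo] --> leb (\bigcup_i E i).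
  apply: nondecreasing_cvg_mu => [i||i j ij].
  - exact: m_level.
  - by rewrite -EE; exact: m_level.
  - apply/subsetPset => x /=; apply: le_lt_trans; rewrite lerD2l.
    by rewrite lef_pV2 ?posrE// ler_nat ltnS.
rewrite EE -(cvg_lim _ E_cvg)//; apply: lime_le; first by apply/cvg_ex; exists (leb (\bigcup_i E i)).
by apply: nearW => i; exact: E_le.
Qed.

End limit_domain.

(** * Comparison with v *)

Theorem theorem6p6 (R : realType) (n : nat) (n_ge2 : (2 <= n)%N)
    (Omega : set 'cV[R]_n) (Omega_neq0 : Omega !=set0)
    (Omega_bounded : bounded_set Omega) (Omega_open : open Omega)
    (Omega_convex : convex_set Omega)
    (F : operator R n) (F_continuous : op_continuous F)
    (F_proper : op_proper F) (F_elliptic : op_degenerate_elliptic F)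
    (F_rotation : op_rotation_invariant F)
    (u : 'cV[R]_n -> R) (u_solution : classical_solution F Omega u)
    (u_dirichlet : positive_zero_boundary Omega u)
    (u_normal : forall x nu, boundary Omega x -> inward_direction Omega x nu ->
      (0 < limf_einf (fun y => ('D_nu u y)%:E) (within Omega (nbhs x)))%E)
    (p : R) (p_gt0 : 0 < p) (p_lt1 : p < 1)
    (F_convex : forall theta : 'cV[R]_n,
      convex_set (op_power_superlevel F p theta))
    (rho : nat -> 'M[R]_n) (rho_SO : forall i, special_orthogonal (rho i))
    (c : 'cV[R]_n) (Omegas : set 'cV[R]_n)
    (Omegas_ball : Omegas = eball c (mean_width Omega / 2))
    (Omegas_lim :
      hausdorff_dist (rotation_mean rho Omega m) Omegas @[m --> \oo] --> (0 : R))
    (k : nat -> nat) (k_incr : {homo k : i j / (i < j)%N})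
    (k_cvg : rearr_cvg rho Omega u p k)
    (v : 'cV[R]_n -> R) (v_dirichlet : positive_zero_boundary Omegas v)
    (v_solution_CP :
      (classical_solution F Omegas v /\
         comparison_principle F (classical_supersolution F) Omegas) \/
      (viscosity_solution F Omegas v /\
         comparison_principle F (viscosity_supersolution F) Omegas)) :
  (forall x, Omegas x -> rearrangement rho Omega u p k x <= v x) /\
  (forall q : \bar R, (0 < q)%E ->
    (Lq_norm Omega q u <= Lq_norm Omegas q v)%E).
Proof.
have [u_C2 _] := u_solution.
pose r := mean_width Omega / 2.
have r_gt0 : 0 < r by rewrite divr_gt0// mean_width_gt0// (leq_trans _ n_ge2).
have OmegasE : Omegas = eball c r := Omegas_ball.
have Omegas_open : open Omegas by rewrite OmegasE; exact: open_eball.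
have lim_ball : hausdorff_dist (rotation_mean rho Omega m) (eball c r) @[m --> \oo] --> (0 : R).
  by rewrite -OmegasE.
pose w := rearrangement rho Omega u p k.
have w_cont : continuous w by exact: (rearrangement_continuous (Omega := Omega)).
have w_ge0 x : 0 <= w x by exact: rearrangement_ge0.
have w_gt0 x : Omegas x -> 0 < w x.
  by rewrite OmegasE; exact: (rearrangement_gt0 (c := c) (r := r)).
have w_eq0 x : ~ Omegas x -> w x = 0.
  by rewrite OmegasE; exact: (rearrangement_eq0 (c := c) (r := r)).
have w_C0 : C0_closure Omegas w by exact: continuous_subspaceT.
have w_sub : viscosity_subsolution F Omegas w.
  split=> [x a _ wxa|x phi Ox C2phi phix w_le]; first exact: continuous_near_lt wxa.
  apply: (viscosity_stability (W := fun j => rearr_step rho Omega u p (k j)) F_continuous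
    _ _ _ Omegas_open Ox C2phi phix (w_gt0 _ Ox) w_le).
  - by move=> j; exact: rearr_step_continuous.
  - by move=> e e0; exact: rearrangement_unif.
  - by move=> j y A psi; exact: rearr_step_viscosity.
have [v_C0 v_bd v_gt0] := v_dirichlet.
have w_bd x : boundary Omegas x -> w x <= v x.
  move=> bx; rewrite v_bd//; case: bx => _.
  by rewrite ((interior_id Omegas).1 Omegas_open) => /w_eq0 ->.
have w_le_v x : Omegas x -> w x <= v x.
  (* In both cases v is a supersolution of the kind that its comparison principle accepts. *)
  case: v_solution_CP => [[[C2v Fv] CP]|[[_ _ v_super] CP]] Ox.
    by apply: CP v_C0 _ w_C0 w_sub w_bd _ Ox; split=> // y Oy; rewrite Fv.
  exact: CP v_C0 v_super w_C0 w_sub w_bd _ Ox.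
split=> // q q0; rewrite /Lq_norm.
have cU := zero_extension_continuous Omega_open u_dirichlet.
have cV := zero_extension_continuous Omegas_open v_dirichlet.
apply: Lnorm_le_distribution => //.
- exact: continuous_measurable_cV.
- exact: continuous_measurable_cV.
- move=> x; rewrite patchE; case: ifPn => //; rewrite inE => Ox.
  by have [_ _ u0] := u_dirichlet; exact: ltW (u0 x Ox).
- by move=> x; rewrite patchE; case: ifPn => //; rewrite inE => /v_gt0/ltW.
(* The superlevel sets of u are no larger than those of w, which lie in those of v; w vanishes off
   the ball, so t >= 0 confines its superlevel sets to it. *)
move=> t t0.
have H := leb_superlevel_lim Omega_neq0 Omega_bounded Omega_open u_dirichlet p_gt0 p_lt1 rho_SO
  k_incr k_cvg t0.
apply: le_trans H _; apply: le_measure; rewrite ?inE.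
- apply: cV_open_measurable; rewrite openE => x /= tx; exact: continuous_near_gt w_cont tx.
- apply: cV_open_measurable; rewrite openE => x /= tx; exact: continuous_near_gt cV tx.
move=> x /= tx; have [Ox|/w_eq0 wx] := pselect (Omegas x).
  by rewrite patchE mem_set//; apply: lt_le_trans tx (w_le_v x Ox).
by move: tx; rewrite -/(w x) wx ltNge t0.
Qed.
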